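(* Let $1\le n<\infty$ and let $u(x,t)$ be the solution of $u_t=u_{xx}+f(u)$ on $\mathbb{R}\times(0,\infty)$ with kink-antikink initial datum $u_0(x;n,n)$, with kink positions $\xi_j^-(t)$ and antikink positions $\xi_j^+(t)$, $1\le j\le n$, as defined in the context. Then there are unique times $0<t_1<t_2<\dots<t_n$ such that $\xi_j^-(t_j)=\xi_j^+(t_j)$, $1\le j\le n$, i.e. the successively innermost kink and antikink collide at these times. Moreover, there are unique times $t_j^A\in(t_j,t_{j+1})$, $1\le j\le n-1$, such that $\min_{x\in\mathbb{R}}u(x,t_j^A)=2\pi j$, i.e. at these times the successively innermost kink and antikink annihilate.
   Context: $f(\theta)=\cos(\theta+\Theta_0)+f_0$ with $f_0\in(0,1)$ and $\Theta_0\in(0,\pi)$ the unique number such that $f(0)=0$. Initial data: let $H^-(x)=2\pi$ for $x<0$, $\pi$ for $x=0$, $0$ for $x>0$, and $H^+(x)=H^-(-x)$. For positions $\xi_m^-<\dots<\xi_1^-<\xi_1^+<\dots<\xi_n^+$ set $$u_0(x;m,n)=\sum_{j=1}^{m}(\rho_{\varepsilon_j^-}*H^-)(x-\xi_j^-)+\sum_{j=1}^{n}(\rho_{\varepsilon_j^+}*H^+)(x-\xi_j^+),$$ where $\rho_\varepsilon$ is a smooth symmetric mollifier of integral $1$, supported on $[-\varepsilon,\varepsilon]$ and positive in the interior of its support, and each $\varepsilon_j^\pm>0$ is smaller than half the distance of $\xi_j^\pm$ to each neighbouring position. Positions: $\xi_j^\pm(t)$ denote the continuous curves in $\{\xi\in\mathbb{R}:\exists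 k\in\mathbb{Z},\ u(\xi,t)=(2k+1)\pi\}$ starting at $\xi_j^\pm(0)=\xi_j^\pm$ (so $u(\xi_j^\pm(t),t)=(2j-1)\pi$), followed as long as they exist and extended by continuity to the time at which $\xi_j^-$ and $\xi_j^+$ meet. *)

(* Defs.v *)
From Stdlib Require Import Reals ZArith.
From Coquelicot Require Import Coquelicot.
Open Scope R_scope.

Definition reaction (f0 Theta0 theta : R) : R := cos (theta + Theta0) + f0.

Definition Hminus (x : R) : R :=
  if Rlt_dec x 0 then 2 * PI else if Req_EM_T x 0 then PI else 0.

Definition Hplus (x : R) : R := Hminus (- x).

Definition convolution (g h : R -> R) (x : R) : R :=
  RInt_gen (fun y => g y * h (x - y)) (Rbar_locally m_infty) (Rbar_locally p_infty).

(* The support is exactly [-eps, eps]; the value at the two end points is 0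
   by continuity. *)
Record mollifier (eps : R) (r : R -> R) : Prop := {
  mollifier_smooth : forall (k : nat) (x : R), ex_derive_n r k x;
  mollifier_sym : forall x, r (- x) = r x;
  mollifier_int : is_RInt_gen r (Rbar_locally m_infty) (Rbar_locally p_infty) 1;
  mollifier_pos : forall x, Rabs x < eps -> 0 < r x;
  mollifier_supp : forall x, eps < Rabs x -> r x = 0
}.

(* Kinks are indexed by 1 <= j <= m and antikinks by 1 <= j <= n, both counted
   from the innermost one outwards; values at other indices are irrelevant. *)
Definition ordered_positions (m n : nat) (xim xip : nat -> R) : Prop :=
  (forall j, (1 <= j < m)%nat -> xim (S j) < xim j) /\
  (forall j, (1 <= j < n)%nat -> xip j < xip (S j)) /\
  ((1 <= m)%nat -> (1 <= n)%nat -> xim 1%nat < xip 1%nat).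

(* Each width is positive and smaller than half the distance of its position to
   each neighbouring position; the last clause concerns the innermost kink and
   the innermost antikink, which are neighbours of each other. *)
Definition admissible_widths (m n : nat) (xim xip epsm epsp : nat -> R) : Prop :=
  (forall j, (1 <= j <= m)%nat -> 0 < epsm j) /\
  (forall j, (1 <= j <= n)%nat -> 0 < epsp j) /\
  (forall j, (1 <= j < m)%nat ->
     epsm j < (xim j - xim (S j)) / 2 /\ epsm (S j) < (xim j - xim (S j)) / 2) /\
  (forall j, (1 <= j < n)%nat ->
     epsp j < (xip (S j) - xip j) / 2 /\ epsp (S j) < (xip (S j) - xip j) / 2) /\
  ((1 <= m)%nat -> (1 <= n)%nat ->
     epsm 1%nat < (xip 1%nat - xim 1%nat) / 2 /\
     epsp 1%nat < (xip 1%nat - xim 1%nat) / 2).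

(* [sum_n_m a 1 m] is a_1 + ... + a_m, and 0 if m = 0. *)
Definition initial_datum (rho : R -> R -> R) (m n : nat)
    (xim xip epsm epsp : nat -> R) (x : R) : R :=
  sum_n_m (fun j => convolution (rho (epsm j)) Hminus (x - xim j)) 1 m
  + sum_n_m (fun j => convolution (rho (epsp j)) Hplus (x - xip j)) 1 n.

(* Classical solution of u_t = u_xx + f(u) with initial value u0, in the class
   of functions bounded on every strip R x [0, T], where it is unique. The
   function u is written u x t; its values for t < 0 are irrelevant. *)
Record classical_solution (f u0 : R -> R) (u : R -> R -> R) : Prop := {
  sol_init : forall x, u x 0 = u0 x;
  sol_cont : forall x t, 0 <= t ->
    filterlim (fun p : R * R => u (fst p) (snd p))
      (within (fun p : R * R => 0 <= snd p) (locally (x, t))) (locally (u x t));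
  sol_bounded : forall T, exists M, forall x t, 0 <= t <= T -> Rabs (u x t) <= M;
  sol_ex_t : forall x t, 0 < t -> ex_derive (fun s => u x s) t;
  sol_ex_x : forall x t, 0 < t -> ex_derive (fun y => u y t) x;
  sol_ex_xx : forall x t, 0 < t -> ex_derive_n (fun y => u y t) 2 x;
  sol_cont_t : forall x t, 0 < t ->
    continuous (fun p : R * R => Derive (fun s => u (fst p) s) (snd p)) (x, t);
  sol_cont_x : forall x t, 0 < t ->
    continuous (fun p : R * R => Derive (fun y => u y (snd p)) (fst p)) (x, t);
  sol_cont_xx : forall x t, 0 < t ->
    continuous (fun p : R * R => Derive_n (fun y => u y (snd p)) 2 (fst p)) (x, t);
  sol_eq : forall x t, 0 < t ->
    Derive (fun s => u x s) t = Derive_n (fun y => u y t) 2 x + f (u x t)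
}.

Definition is_position (u : R -> R -> R) (t xi : R) : Prop :=
  exists k : Z, u xi t = IZR (2 * k + 1) * PI.

(* [I] is the time domain of the curve: an interval [0, T), [0, T] or
   [0, infinity). *)
Record position_curve (u : R -> R -> R) (xi0 : R) (I : R -> Prop) (xi : R -> R) :
    Prop := {
  curve_dom0 : I 0;
  curve_dom_ge0 : forall t, I t -> 0 <= t;
  curve_dom_itv : forall s t, I t -> 0 <= s <= t -> I s;
  curve_init : xi 0 = xi0;
  curve_cont : forall t, I t -> filterlim xi (within I (locally t)) (locally (xi t));
  curve_pos : forall t, I t -> is_position u t (xi t)
}.

(* A curve followed as long as it exists. If u is continuous and xi has a finite
   limit at a finite end point T of its domain, then the limit is again a
   position, so that maximality forces T into the domain with xi T equal to that
   limit: the extension by continuity to a meeting time is built in. *)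
Definition maximal_position_curve (u : R -> R -> R) (xi0 : R) (I : R -> Prop)
    (xi : R -> R) : Prop :=
  position_curve u xi0 I xi /\
  forall (I' : R -> Prop) (xi' : R -> R),
    position_curve u xi0 I' xi' ->
    (forall t, I t -> I' t /\ xi' t = xi t) ->
    forall t, I' t -> I t.

Definition meet_at (I1 : R -> Prop) (xi1 : R -> R) (I2 : R -> Prop) (xi2 : R -> R)
    (t : R) : Prop :=
  I1 t /\ I2 t /\ xi1 t = xi2 t.

Definition is_minimum (g : R -> R) (v : R) : Prop :=
  (exists x, g x = v) /\ (forall x, v <= g x).

(* Main.v *)
Require Import Defs.
From Stdlib Require Import Reals ZArith Lra Lia Psatz Classical ClassicalEpsilon.
From Coquelicot Require Import Coquelicot.
Open Scope R_scope.
Set Bullet Behavior "Strict Subproofs".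

(** The datum is a well: it descends from N = 2 PI n to 0 along the kinks and
    climbs back to N along the antikinks. As time passes the well fills up, and
    everything is read off its minimum: the kink and the antikink j meet when the
    minimum passes (2 j - 1) PI, and have annihilated when it reaches 2 PI j.

    Each of these levels is passed exactly once. If f(c) >= 0, the constant c is a
    subsolution, so u >= c at one time implies u > c at all later times
    ([well_above_constant]). It remains to see that every level below N is exceeded in
    the end ([well_filling]). Writing f(a) = f0 (1 - cos a) - sin Theta0 sin a, the
    kink 4 atan(exp(- k y)) with k^2 = sin Theta0 is stationary for the sine
    term alone. The nonnegative remainder f0 (1 - cos a) allows it to be lowered
    by a small constant and moved into the well at a small speed, as a
    subsolution ([front_defect], [invasion_left]). One level after the other is
    invaded from both sides, and [crossing_time_exists] follows. The times are
    ordered as the levels are, since at its crossing time each level is attained.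

    A collision also requires the two position curves to end at one point, which is
    a statement about the shape of the well. It stays quasiconvex: by the
    maximum principle for three points ([three_point_principle]), two
    differences u(x) - u(a), u(x) - u(b) with a <= x <= b that are as large as possible
    cannot have been created by diffusion, x being a local maximum and a, b
    local minima. Flat pieces on the flanks are excluded by the strong maximum
    principle for u(x) - u(x + h) ([no_flat_left_flank]). The bottom needs more, for
    u(x) - u(x + h) may change its sign there. If the bottom is flat at
    some time, adding an arbitrarily small bump destroys quasiconvexity, and the three-point
    principle, which tolerates the error, transports this failure
    to earlier times; letting the bump tend to 0 shows that the bottom was flat
    there too ([flat_minimum_persists_backwards]). But a bottom that is flat during
    an interval of time follows the equation theta' = f(theta), whereas by the strong
    maximum principle u runs strictly ahead of it ([single_minimizer_instant]).
    Hence the bottom is a single point at the collision ([unique_minimizer]).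

    So before its crossing time the level (2 j - 1) PI is taken at exactly two points, which
    depend continuously on time and merge at the crossing time. A continuous curve of
    positions cannot leave its level, because odd multiples of PI are isolated, nor
    change from one point to the other, because they are separated; being
    maximal, it reaches the merging point ([maximal_left_curve]). Antikinks are
    the kinks of the reflected solution. *)

(** * Real induction, compactness and tubes *)

(** Real induction replaces the usual supremum arguments: compactness of segments,
    persistence of the level of a curve and the choice of a branch of roots all
    reduce to its two one-sided steps. *)
Lemma real_induction (a b : R) (P : R -> Prop) :
  a <= b -> P a ->
  (forall s, a <= s < b -> P s ->
     exists d, 0 < d /\ forall s', s < s' < s + d -> s' <= b -> P s') ->
  (forall s, a < s <= b -> (forall s', a <= s' < s -> P s') -> P s) ->
  P b.
Proof.
  intros Hab Ha Hright Hleft.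
  set (E := fun t => a <= t <= b /\ forall s, a <= s <= t -> P s).
  assert (HEa : E a).
  { split; [lra|]. intros s Hs. replace s with a by lra. exact Ha. }
  destruct (completeness E) as [m [Hub Hlub]].
  { exists b. intros t [Ht _]. lra. }
  { now exists a. }
  assert (Ham : a <= m) by (apply Hub; exact HEa).
  assert (Hmb : m <= b) by (apply Hlub; intros t [Ht _]; lra).
  assert (Hbelow : forall s, a <= s < m -> P s).
  { intros s Hs. apply NNPP. intros HP.
    assert (m <= s); [|lra]. apply Hlub. intros t [Ht1 Ht2].
    destruct (Rle_lt_dec t s) as [|Hst]; auto. exfalso. apply HP, Ht2. lra. }
  assert (HPm : P m).
  { destruct (Req_dec a m) as [<-|]; auto. apply Hleft; auto. lra. }
  destruct (Req_dec m b) as [<-|Hne]; auto.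
  destruct (Hright m) as [d [Hd Hd']]; auto; [lra|].
  set (t := Rmin b (m + d / 2)).
  assert (Hmt : m < t) by (apply Rmin_glb_lt; lra).
  assert (Htb : t <= b) by apply Rmin_l.
  assert (Htd : t <= m + d / 2) by apply Rmin_r.
  assert (E t); [|assert (t <= m) by (apply Hub; auto); lra].
  split; [lra|]. intros s Hs.
  destruct (Rtotal_order s m) as [|[->|]]; auto.
  - apply Hbelow; lra.
  - apply Hd'; lra.
Qed.

(** Compactness as an induction principle: a property of sets that is hereditary,
    stable under union and true locally is true on the whole set. This is the
    finite subcover property, with no lists of neighbourhoods to handle, and it
    passes to products by fixing one coordinate at a time. *)
Definition compact_set {X : UniformSpace} (K : X -> Prop) : Prop :=
  forall Q : (X -> Prop) -> Prop,
    (forall A B : X -> Prop, (forall x, A x -> B x) -> Q B -> Q A) ->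
    (forall A B : X -> Prop, Q A -> Q B -> Q (fun x => A x \/ B x)) ->
    (forall x, K x -> exists V, locally x V /\ Q V) ->
    Q K.

Lemma compact_segment (a b : R) : a <= b -> compact_set (fun x : R => a <= x <= b).
Proof.
  intros Hab Q Hsub Hun Hloc.
  apply (real_induction a b (fun m => Q (fun x => a <= x <= m))); auto.
  - destruct (Hloc a) as [V [HV HQ]]; [lra|].
    apply Hsub with V; auto. intros x Hx. replace x with a by lra.
    exact (locally_singleton _ _ HV).
  - intros s Hs HP. destruct (Hloc s) as [V [[d HV] HQ]]; [lra|].
    exists d. split; [apply cond_pos|]. intros s' Hs' Hb.
    eapply Hsub; [|apply (Hun _ _ HP HQ)]. intros x Hx. simpl.
    destruct (Rle_lt_dec x s); [left; lra|right].
    apply HV. change (Rabs (x - s) < d). rewrite Rabs_right; lra.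
  - intros s Hs HP. destruct (Hloc s) as [V [[d HV] HQ]]; [lra|].
    assert (Hd := cond_pos d).
    set (m := Rmax a (s - d / 2)).
    assert (Hm : a <= m < s) by (split; [apply Rmax_l|apply Rmax_lub_lt; lra]).
    assert (Hm' : s - d / 2 <= m) by apply Rmax_r.
    eapply Hsub; [|apply (Hun _ _ (HP m Hm) HQ)]. intros x Hx. simpl.
    destruct (Rle_lt_dec x m); [left; lra|right].
    apply HV. change (Rabs (x - s) < d). apply Rabs_def1; lra.
Qed.

(** For a fixed point of the second factor, having a good strip around that point is again hereditary, additive and local in the first factor. *)
Lemma compact_prod {X Y : UniformSpace} (K : X -> Prop) (L : Y -> Prop) :
  compact_set K -> compact_set L ->
  compact_set (fun p : X * Y => K (fst p) /\ L (snd p)).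
Proof.
  intros HK HL Q Hsub Hun Hloc.
  apply (HL (fun B => Q (fun p : X * Y => K (fst p) /\ B (snd p)))).
  - intros A B HAB. apply Hsub. intros p [? ?]; auto.
  - intros A B HA HB. eapply Hsub; [|apply (Hun _ _ HA HB)].
    intros p [? [?|?]]; auto.
  - intros y Hy.
    destruct (HK (fun A => exists V, locally y V /\
                Q (fun p : X * Y => A (fst p) /\ V (snd p)))) as [V [HV HQ]].
    + intros A B HAB [V [HV HQ]]. exists V. split; auto.
      eapply Hsub; [|exact HQ]. intros p [? ?]; auto.
    + intros A B [V [HV HQ]] [W [HW HQ']].
      exists (fun y => V y /\ W y). split; [now apply filter_and|].
      eapply Hsub; [|apply (Hun _ _ HQ HQ')]. intros p [[?|?] [? ?]]; auto.
    + intros x Hx. destruct (Hloc (x, y)) as [V [[d HV] HQ]]; [now split|].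
      exists (ball x d). split; [now exists d|].
      exists (ball y d). split; [now exists d|].
      eapply Hsub; [|exact HQ]. intros [x' y'] [? ?]. apply HV. now split.
    + exists V. now split.
Qed.

(** Without a maximum, the sets on which F stays strictly below one of its own
    values would be local and stable under union, hence would include K itself. *)
Lemma compact_max {X : UniformSpace} (K : X -> Prop) (F : X -> R) :
  compact_set K -> (exists p, K p) -> (forall p, K p -> continuous F p) ->
  exists p, K p /\ forall q, K q -> F q <= F p.
Proof.
  intros HK [p0 Hp0] HF. apply NNPP. intros Hno.
  assert (Hbig : forall p, K p -> exists q, K q /\ F p < F q).
  { intros p Hp. apply NNPP. intros Hp'. apply Hno. exists p. split; auto.
    intros q Hq. destruct (Rle_lt_dec (F q) (F p)); auto.
    exfalso. apply Hp'. now exists q. }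
  destruct (HK (fun A => exists p, K p /\ forall x, A x -> F x < F p))
    as [p [Hp Hp']].
  - intros A B HAB [p [Hp Hp']]. exists p. auto.
  - intros A B [p [Hp Hp']] [q [Hq Hq']].
    destruct (Rle_lt_dec (F p) (F q)).
    + exists q. split; auto. intros x [Hx|Hx]; [|auto].
      apply Rlt_le_trans with (F p); auto.
    + exists p. split; auto. intros x [Hx|Hx]; [auto|].
      apply Rlt_trans with (F q); auto.
  - intros p Hp. destruct (Hbig p Hp) as [q [Hq Hpq]].
    exists (fun x => F x < F q). split; [|now exists q].
    apply (HF p Hp (fun y => y < F q)). now apply open_lt.
  - specialize (Hp' p Hp). lra.
Qed.

(** Continuity on the whole plane. Solutions are only meaningful for t >= 0; freezing
    them at their initial value for t < 0 makes them continuous everywhere, which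
    spares all one-sided limits at t = 0. *)
Definition continuous2 (z : R -> R -> R) : Prop :=
  forall x t, continuous (fun p : R * R => z (fst p) (snd p)) (x, t).

Lemma continuous2_comp {X : UniformSpace} (z : R -> R -> R) (f g : X -> R) (p : X) :
  continuous2 z -> continuous f p -> continuous g p ->
  continuous (fun p => z (f p) (g p)) p.
Proof. intros Hz Hf Hg. apply (continuous_comp_2 f g z); auto. Qed.

Lemma continuous2_ball (z : R -> R -> R) x t e :
  continuous2 z -> 0 < e ->
  exists d, 0 < d /\ forall y s, Rabs (y - x) < d -> Rabs (s - t) < d ->
    Rabs (z y s - z x t) < e.
Proof.
  intros Hz He.
  destruct (Hz x t (fun v => Rabs (v - z x t) < e)) as [d Hd].
  { exists (mkposreal e He). intros v Hv. exact Hv. }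
  exists d. split; [apply cond_pos|]. intros y s Hy Hs.
  apply (Hd (y, s)). split; assumption.
Qed.

Lemma continuous2_gt (z : R -> R -> R) x t c :
  continuous2 z -> c < z x t ->
  exists d, 0 < d /\ forall y s, Rabs (y - x) < d -> Rabs (s - t) < d -> c < z y s.
Proof.
  intros Hz Hc. destruct (continuous2_ball z x t (z x t - c)) as [d [Hd H]]; auto.
  { lra. }
  exists d. split; auto. intros y s Hy Hs. specialize (H y s Hy Hs).
  apply Rabs_def2 in H. lra.
Qed.

Lemma continuous2_lt (z : R -> R -> R) x t c :
  continuous2 z -> z x t < c ->
  exists d, 0 < d /\ forall y s, Rabs (y - x) < d -> Rabs (s - t) < d -> z y s < c.
Proof.
  intros Hz Hc. destruct (continuous2_ball z x t (c - z x t)) as [d [Hd H]]; auto.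
  { lra. }
  exists d. split; auto. intros y s Hy Hs. specialize (H y s Hy Hs).
  apply Rabs_def2 in H. lra.
Qed.

(** Only the segment of x has to be compact for the inequality to survive at all nearby
    times simultaneously. *)
Lemma tube (z : R -> R -> R) a b t c :
  continuous2 z -> (forall x, a <= x <= b -> c < z x t) ->
  exists d, 0 < d /\
    forall x s, a <= x <= b -> Rabs (s - t) < d -> c < z x s.
Proof.
  intros Hz Hc. destruct (Rle_lt_dec a b) as [Hab|Hab].
  2: { exists 1. split; [lra|]. intros; lra. }
  apply (compact_segment a b Hab (fun A => exists d, 0 < d /\
    forall x s, A x -> Rabs (s - t) < d -> c < z x s)).
  - intros A B HAB [d [Hd H]]. exists d. split; auto.
  - intros A B [d [Hd H]] [e [He H']]. exists (Rmin d e).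
    split; [now apply Rmin_glb_lt|]. intros x s [Hx|Hx] Hs.
    + apply H; auto. apply Rlt_le_trans with (1 := Hs), Rmin_l.
    + apply H'; auto. apply Rlt_le_trans with (1 := Hs), Rmin_r.
  - intros x Hx. destruct (continuous2_gt z x t c Hz (Hc x Hx)) as [d [Hd H]].
    exists (fun y => Rabs (y - x) < d). split; [now exists (mkposreal d Hd)|].
    exists d. split; auto.
Qed.

Lemma segment_max (g : R -> R) a b :
  a <= b -> (forall x, continuous g x) ->
  exists x, a <= x <= b /\ forall y, a <= y <= b -> g y <= g x.
Proof.
  intros Hab Hg. apply (compact_max (fun x : R => a <= x <= b) g); auto.
  - now apply compact_segment.
  - exists a. lra.
Qed.

Lemma segment_min (g : R -> R) a b :
  a <= b -> (forall x, continuous g x) ->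
  exists x, a <= x <= b /\ forall y, a <= y <= b -> g x <= g y.
Proof.
  intros Hab Hg. destruct (segment_max (fun x => - g x) a b Hab) as [x [Hx H]].
  - intros x. apply (continuous_opp g x), Hg.
  - exists x. split; auto. intros y Hy. specialize (H y Hy). lra.
Qed.

Lemma rectangle_max (z : R -> R -> R) a b c d :
  a <= b -> c <= d -> continuous2 z ->
  exists x t, a <= x <= b /\ c <= t <= d /\
    forall y s, a <= y <= b -> c <= s <= d -> z y s <= z x t.
Proof.
  intros Hab Hcd Hz.
  destruct (compact_max (fun p : R * R => (a <= fst p <= b) /\ (c <= snd p <= d))
     (fun p => z (fst p) (snd p))) as [[x t] [[Hx Ht] H]].
  - apply (compact_prod (fun x : R => a <= x <= b) (fun t : R => c <= t <= d));
      now apply compact_segment.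
  - exists (a, c). simpl. lra.
  - intros [x t] _. apply Hz.
  - exists x, t. repeat split; try easy. intros y s Hy Hs. apply (H (y, s)).
    now split.
Qed.

(** * Maximum principles for the heat operator *)

Lemma continuous2_plus (y z : R -> R -> R) :
  continuous2 y -> continuous2 z -> continuous2 (fun x t => y x t + z x t).
Proof. intros Hy Hz x t. exact (continuous_plus _ _ _ (Hy x t) (Hz x t)). Qed.

Lemma continuous2_mult (y z : R -> R -> R) :
  continuous2 y -> continuous2 z -> continuous2 (fun x t => y x t * z x t).
Proof. intros Hy Hz x t. exact (continuous_mult _ _ _ (Hy x t) (Hz x t)). Qed.

Lemma continuous2_opp (z : R -> R -> R) :
  continuous2 z -> continuous2 (fun x t => - z x t).
Proof. intros Hz x t. exact (continuous_opp _ _ (Hz x t)). Qed.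

Lemma continuous2_minus (y z : R -> R -> R) :
  continuous2 y -> continuous2 z -> continuous2 (fun x t => y x t - z x t).
Proof. intros Hy Hz x t. exact (continuous_minus _ _ _ (Hy x t) (Hz x t)). Qed.

Lemma continuous2_lift (h : R -> R) (z : R -> R -> R) :
  (forall x, continuous h x) -> continuous2 z -> continuous2 (fun x t => h (z x t)).
Proof.
  intros Hh Hz x t.
  exact (continuous_comp (fun p : R * R => z (fst p) (snd p)) h (x, t) (Hz x t) (Hh _)).
Qed.

Lemma continuous2_fst : continuous2 (fun x _ => x).
Proof. intros x t. apply continuous_fst. Qed.

Lemma continuous2_snd : continuous2 (fun _ t => t).
Proof. intros x t. apply continuous_snd. Qed.

Lemma continuous2_const c : continuous2 (fun _ _ => c).
Proof. intros x t. apply continuous_const. Qed.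

Lemma is_derive_continuous (g : R -> R) x l : is_derive g x l -> continuous g x.
Proof. intros H. apply (ex_derive_continuous g). now exists l. Qed.

Lemma continuous2_slice_x (z : R -> R -> R) t x :
  continuous2 z -> continuous (fun x => z x t) x.
Proof.
  intros Hz. apply (continuous2_comp z (fun x => x) (fun _ => t)); auto.
  - apply continuous_id.
  - apply continuous_const.
Qed.

Lemma continuous2_slice_t (z : R -> R -> R) x t :
  continuous2 z -> continuous (fun t => z x t) t.
Proof.
  intros Hz. apply (continuous2_comp z (fun _ => x) (fun t => t)); auto.
  - apply continuous_const.
  - apply continuous_id.
Qed.

Lemma continuous2_reflect (z : R -> R -> R) :
  continuous2 z -> continuous2 (fun x t => z (- x) t).
Proof.
  intros Hz x t. apply (continuous2_comp z (fun p : R * R => - fst p) snd); auto.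
  - apply (continuous_opp (fun p : R * R => fst p)), continuous_fst.
  - apply continuous_snd.
Qed.

Lemma continuous2_translate (z : R -> R -> R) h :
  continuous2 z -> continuous2 (fun x t => z (x + h) t).
Proof.
  intros Hz x t. apply (continuous2_comp z (fun p : R * R => fst p + h) snd); auto.
  - apply (continuous_plus (fun p : R * R => fst p) (fun _ => h)).
    apply continuous_fst. apply continuous_const.
  - apply continuous_snd.
Qed.

Ltac cont2 :=
  repeat first [assumption | apply continuous2_const | apply continuous2_fst
    | apply continuous2_snd | apply continuous2_minus | apply continuous2_plus
    | apply continuous2_opp | apply continuous2_mult].

(** The number l is the value of z_t - z_xx at (x, t). The spatial derivative is required
    on the whole line at time t, as the second derivative needs it near x. *)
Definition heat_at (z : R -> R -> R) (x t l : R) : Prop :=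
  exists (zt : R) (zx : R -> R) (zxx : R),
    is_derive (fun s => z x s) t zt /\
    (forall y, is_derive (fun y => z y t) y (zx y)) /\
    is_derive zx x zxx /\ l = zt - zxx.

Lemma heat_plus y z x t l m :
  heat_at y x t l -> heat_at z x t m ->
  heat_at (fun x t => y x t + z x t) x t (l + m).
Proof.
  intros (yt & yx & yxx & H1 & H2 & H3 & ->) (zt & zx & zxx & H4 & H5 & H6 & ->).
  exists (yt + zt), (fun x => yx x + zx x), (yxx + zxx). refine (conj _ (conj _ (conj _ _))).
  - apply (is_derive_plus (fun s => y x s) (fun s => z x s) t _ _ H1 H4).
  - intros w. apply (is_derive_plus (fun w => y w t) (fun w => z w t) w _ _ (H2 w) (H5 w)).
  - apply (is_derive_plus yx zx x _ _ H3 H6).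
  - ring.
Qed.

Lemma heat_scal k z x t l :
  heat_at z x t l -> heat_at (fun x t => k * z x t) x t (k * l).
Proof.
  intros (zt & zx & zxx & H4 & H5 & H6 & ->).
  exists (k * zt), (fun x => k * zx x), (k * zxx). refine (conj _ (conj _ (conj _ _))).
  - apply (is_derive_scal (fun s => z x s) t k zt H4).
  - intros w. apply (is_derive_scal (fun w => z w t) w k _ (H5 w)).
  - apply (is_derive_scal zx x k _ H6).
  - ring.
Qed.

Lemma heat_ext y z x t l :
  (forall x t, y x t = z x t) -> heat_at y x t l -> heat_at z x t l.
Proof.
  intros E (zt & zx & zxx & H4 & H5 & H6 & ->).
  exists zt, zx, zxx. refine (conj _ (conj _ (conj _ _))); auto.
  - apply (is_derive_ext (fun s => y x s)); auto.
  - intros w. apply (is_derive_ext (fun w => y w t)); auto.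
Qed.

Lemma heat_minus y z x t l m :
  heat_at y x t l -> heat_at z x t m ->
  heat_at (fun x t => y x t - z x t) x t (l - m).
Proof.
  intros Hy Hz. replace (l - m) with (l + (-1) * m) by ring.
  apply heat_ext with (fun x t => y x t + (-1) * z x t).
  { intros; ring. }
  apply heat_plus; auto. now apply heat_scal.
Qed.

Lemma heat_time (phi : R -> R) (x t l : R) :
  is_derive phi t l -> heat_at (fun _ s => phi s) x t l.
Proof.
  intros H. exists l, (fun _ => 0), 0. refine (conj _ (conj _ (conj _ _))); auto.
  - intros y. apply (is_derive_const (phi t) y).
  - apply (is_derive_const 0 x).
  - ring.
Qed.

Lemma heat_space (g g1 : R -> R) (x t l : R) :
  (forall y, is_derive g y (g1 y)) -> is_derive g1 x l ->
  heat_at (fun y _ => g y) x t (- l).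
Proof.
  intros H H1. exists 0, g1, l. refine (conj _ (conj _ (conj _ _))); auto.
  - apply (is_derive_const (g x) t).
  - ring.
Qed.

(** The heat operator is invariant under translations and reflections. *)
Lemma heat_affine a b z x t l :
  a * a = 1 -> heat_at z (a * x + b) t l -> heat_at (fun x t => z (a * x + b) t) x t l.
Proof.
  intros Ha (zt & zx & zxx & H4 & H5 & H6 & ->).
  assert (Haff : forall y, is_derive (fun y => a * y + b) y a).
  { intros y. auto_derive; auto. ring. }
  exists zt, (fun y => a * zx (a * y + b)), (a * (a * zxx)). refine (conj _ (conj _ (conj _ _))); auto.
  - intros y. apply (is_derive_comp (fun w => z w t) (fun y => a * y + b) y).
    apply H5. apply Haff.
  - apply (is_derive_scal (fun y => zx (a * y + b)) x a).
    apply (is_derive_comp zx (fun y => a * y + b) x); auto.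
  - replace (a * (a * zxx)) with (a * a * zxx) by ring. rewrite Ha. ring.
Qed.

Lemma heat_reflect z x t l :
  heat_at z (- x) t l -> heat_at (fun x t => z (- x) t) x t l.
Proof.
  intros H. apply heat_ext with (fun x t => z (-1 * x + 0) t).
  { intros y s. f_equal. ring. }
  apply heat_affine; [ring|]. replace (-1 * x + 0) with (- x) by ring. exact H.
Qed.

Lemma heat_translate z h x t l :
  heat_at z (x + h) t l -> heat_at (fun x t => z (x + h) t) x t l.
Proof.
  intros H. apply heat_ext with (fun x t => z (1 * x + h) t).
  { intros y s. f_equal. ring. }
  apply heat_affine; [ring|]. replace (1 * x + h) with (x + h) by ring. exact H.
Qed.

Lemma derive_pos_increasing (g : R -> R) (x l : R) :
  is_derive g x l -> 0 < l ->
  exists d, 0 < d /\ (forall y, x < y < x + d -> g x < g y) /\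
    (forall y, x - d < y < x -> g y < g x).
Proof.
  intros H Hl. apply is_derive_Reals in H. destruct (H l Hl) as [d Hd].
  exists d. split; [apply cond_pos|]. split; intros y Hy.
  - specialize (Hd (y - x)). replace (x + (y - x)) with y in Hd by ring.
    assert (Hq : Rabs ((g y - g x) / (y - x) - l) < l).
    { apply Hd; [lra|]. rewrite Rabs_right; lra. }
    apply Rabs_def2 in Hq. destruct Hq as [_ Hq].
    assert (0 < (g y - g x) / (y - x)) by lra.
    assert (0 < (g y - g x) / (y - x) * (y - x)) by (apply Rmult_lt_0_compat; lra).
    replace ((g y - g x) / (y - x) * (y - x)) with (g y - g x) in * by (field; lra). lra.
  - specialize (Hd (y - x)). replace (x + (y - x)) with y in Hd by ring.
    assert (Hq : Rabs ((g y - g x) / (y - x) - l) < l).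
    { apply Hd; [lra|]. rewrite Rabs_left; lra. }
    apply Rabs_def2 in Hq. destruct Hq as [_ Hq].
    assert (0 < (g y - g x) / (y - x)) by lra.
    assert (0 < (g y - g x) / (y - x) * (x - y)) by (apply Rmult_lt_0_compat; lra).
    replace ((g y - g x) / (y - x) * (x - y)) with (g x - g y) in * by (field; lra). lra.
Qed.

Lemma derive_local_max (g : R -> R) (x l d : R) :
  is_derive g x l -> 0 < d -> (forall y, Rabs (y - x) < d -> g y <= g x) -> l = 0.
Proof.
  intros H Hd Hmax. destruct (Rtotal_order l 0) as [Hl|[Hl|Hl]]; auto; exfalso.
  - destruct (derive_pos_increasing (fun y => - g y) x (- l)) as [e [He [_ H2]]].
    { apply (is_derive_opp g x l H). } { lra. }
    assert (0 < Rmin d e) by now apply Rmin_glb_lt.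
    assert (Rmin d e <= d) by apply Rmin_l. assert (Rmin d e <= e) by apply Rmin_r.
    specialize (H2 (x - Rmin d e / 2)). specialize (Hmax (x - Rmin d e / 2)).
    rewrite Rabs_left in Hmax; lra.
  - destruct (derive_pos_increasing g x l) as [e [He [H2 _]]]; auto.
    assert (0 < Rmin d e) by now apply Rmin_glb_lt.
    assert (Rmin d e <= d) by apply Rmin_l. assert (Rmin d e <= e) by apply Rmin_r.
    specialize (H2 (x + Rmin d e / 2)). specialize (Hmax (x + Rmin d e / 2)).
    rewrite Rabs_right in Hmax; lra.
Qed.

Lemma derive2_local_max (g g1 : R -> R) (x l d : R) :
  (forall y, is_derive g y (g1 y)) -> is_derive g1 x l ->
  0 < d -> (forall y, Rabs (y - x) < d -> g y <= g x) -> l <= 0.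
Proof.
  intros H H1 Hd Hmax. apply Rnot_lt_le. intros Hl.
  assert (H0 := derive_local_max g x (g1 x) d (H x) Hd Hmax).
  destruct (derive_pos_increasing g1 x l H1 Hl) as [e [He [H2 _]]].
  assert (0 < Rmin d e) by now apply Rmin_glb_lt.
  assert (Rmin d e <= d) by apply Rmin_l. assert (Rmin d e <= e) by apply Rmin_r.
  destruct (MVT_cor2 g g1 x (x + Rmin d e / 2)) as [c [Hc1 Hc2]].
  { lra. } { intros c _. apply is_derive_Reals, H. }
  assert (0 < g1 c) by (rewrite <- H0; apply H2; lra).
  specialize (Hmax (x + Rmin d e / 2)). rewrite Rabs_right in Hmax by lra.
  assert (0 < g1 c * (x + Rmin d e / 2 - x)) by (apply Rmult_lt_0_compat; lra).
  lra.
Qed.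

(** If g grows at a rate below K g, then exp(- K s) g(s) was larger just before t.
    Every maximum principle below contradicts maximality at an earlier time
    in this way. *)
Lemma derive_left_strict (g : R -> R) (t l K : R) :
  is_derive g t l -> l < K * g t ->
  exists d, 0 < d /\
    forall s, t - d < s < t -> exp (- K * t) * g t < exp (- K * s) * g s.
Proof.
  intros H Hl. assert (He := exp_pos (- K * t)).
  destruct (derive_pos_increasing (fun s => - (exp (- K * s) * g s)) t
     (exp (- K * t) * (K * g t - l))) as [d [Hd [_ H2]]].
  - assert (ex_derive g t) by now exists l. auto_derive; auto.
    replace (Derive (fun x : R => g x) t) with l
      by (symmetry; now apply is_derive_unique).
    ring.
  - apply Rmult_lt_0_compat; lra.
  - exists d. split; auto. intros s Hs. specialize (H2 s Hs). lra.
Qed.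

Lemma derive_left_max (g : R -> R) (t l K d : R) :
  is_derive g t l -> 0 < d ->
  (forall s, t - d < s < t -> exp (- K * s) * g s <= exp (- K * t) * g t) ->
  K * g t <= l.
Proof.
  intros H Hd Hmax. apply Rnot_lt_le. intros Hl.
  destruct (derive_left_strict g t l K H Hl) as [e [He H2]].
  assert (0 < Rmin d e) by now apply Rmin_glb_lt.
  assert (Rmin d e <= d) by apply Rmin_l. assert (Rmin d e <= e) by apply Rmin_r.
  specialize (H2 (t - Rmin d e / 2)). specialize (Hmax (t - Rmin d e / 2)).
  lra.
Qed.

(** At a positive maximum of exp(- (K + 1) t) z inside the rectangle, z_xx <= 0 and
    z_t >= (K + 1) z, which is more than z_t - z_xx <= K z allows. The top
    side may carry the maximum, since only times before it are compared. *)
Lemma rectangle_max_principle (z : R -> R -> R) x1 x2 t0 t1 K :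
  continuous2 z ->
  (forall x, x1 <= x <= x2 -> z x t0 <= 0) ->
  (forall t, t0 <= t <= t1 -> z x1 t <= 0 /\ z x2 t <= 0) ->
  (forall x t, x1 < x < x2 -> t0 < t <= t1 -> 0 < z x t ->
     exists l, heat_at z x t l /\ l <= K * z x t) ->
  forall x t, x1 <= x <= x2 -> t0 <= t <= t1 -> z x t <= 0.
Proof.
  intros Hz Hbot Hside Hint x t Hx Ht.
  set (y := fun x t => exp (- (K + 1) * t) * z x t).
  assert (Hy : continuous2 y).
  { apply continuous2_mult; auto.
    apply (continuous2_lift (fun t => exp (- (K + 1) * t)) (fun _ t => t)).
    - intros s. apply (ex_derive_continuous (fun t => exp (- (K + 1) * t))).
      auto_derive; auto.
    - apply continuous2_snd. }
  destruct (rectangle_max y x1 x2 t0 t1) as (p & q & Hp & Hq & Hmax); auto; try lra.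
  assert (Hpos : forall x t, 0 < z x t -> 0 < y x t).
  { intros v w Hv. apply Rmult_lt_0_compat; auto. apply exp_pos. }
  apply Rnot_lt_le. intros Hlt.
  assert (Hypq : 0 < y p q).
  { apply Rlt_le_trans with (y x t); auto. }
  assert (Hzpq : 0 < z p q).
  { apply Rmult_lt_reg_l with (exp (- (K + 1) * q)). apply exp_pos.
    rewrite Rmult_0_r. exact Hypq. }
  assert (q <> t0) by (intros ->; specialize (Hbot p Hp); lra).
  assert (p <> x1) by (intros ->; specialize (Hside q Hq); lra).
  assert (p <> x2) by (intros ->; specialize (Hside q Hq); lra).
  destruct (Hint p q) as (l & (zt & zx & zxx & H4 & H5 & H6 & ->) & Hl); try lra.
  assert (zxx <= 0).
  { apply (derive2_local_max (fun y => z y q) zx p zxx (Rmin (p - x1) (x2 - p))); auto.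
    - apply Rmin_glb_lt; lra.
    - intros w Hw.
      assert (Rmin (p - x1) (x2 - p) <= p - x1) by apply Rmin_l.
      assert (Rmin (p - x1) (x2 - p) <= x2 - p) by apply Rmin_r.
      apply Rabs_def2 in Hw.
      apply Rmult_le_reg_l with (exp (- (K + 1) * q)); [apply exp_pos|].
      apply Hmax; lra. }
  assert ((K + 1) * z p q <= zt); [|lra].
  apply (derive_left_max (fun s => z p s) q zt (K + 1) (q - t0)); auto; [lra|].
  intros s Hs. apply Hmax; lra.
Qed.

(** The whole line is reached from rectangles by a penalty (1 + x^2) exp((K + 2) (t - t0)),
    which satisfies the opposite inequality and dominates the bounded z far out. *)
Lemma line_max_principle (z : R -> R -> R) t0 t1 K M :
  0 <= K -> continuous2 z ->
  (forall x t, t0 <= t <= t1 -> z x t <= M) ->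
  (forall x, z x t0 <= 0) ->
  (forall x t, t0 < t <= t1 -> 0 < z x t ->
     exists l, heat_at z x t l /\ l <= K * z x t) ->
  forall x t, t0 <= t <= t1 -> z x t <= 0.
Proof.
  intros HK Hz HM Hbot Hint x t Ht.
  (* K + 2 rather than K: the extra 2 absorbs the second derivative of 1 + x^2. *)
  set (pen := fun x t => (1 + x * x) * exp ((K + 2) * (t - t0))).
  assert (Hexp : forall s, t0 <= s -> 1 <= exp ((K + 2) * (s - t0))).
  { intros s Hs. rewrite <- exp_0. destruct (Rle_lt_or_eq_dec t0 s Hs).
    - left. apply exp_increasing. apply Rmult_lt_0_compat; lra.
    - subst. right. f_equal. ring. }
  apply Rnot_lt_le. intros Hlt.
  (* So small that subtracting e times the penalty leaves z positive at (x, t). *)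
  set (e := z x t / (2 * pen x t)).
  assert (Hpen : forall x t, 0 < pen x t).
  { intros y s. apply Rmult_lt_0_compat; [nra|apply exp_pos]. }
  assert (He : 0 < e).
  { apply Rdiv_lt_0_compat; auto. specialize (Hpen x t). lra. }
  set (y := fun x t => z x t - e * pen x t).
  set (r := Rabs x + Rabs M / e + 1).
  assert (Hr : 1 <= r).
  { assert (0 <= Rabs M / e). apply Rdiv_le_0_compat; auto. apply Rabs_pos.
    assert (0 <= Rabs x) by apply Rabs_pos. unfold r. lra. }
  assert (Hside : forall s w, t0 <= s <= t1 -> w * w = r * r -> y w s <= 0).
  { intros s w Hs Hw. unfold y, pen. rewrite Hw.
    assert (z w s <= M) by now apply HM.
    assert (M <= e * r).
    { assert (Rabs M / e <= r) by (assert (0 <= Rabs x) by apply Rabs_pos; unfold r; lra).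
      apply Rle_trans with (Rabs M); [apply Rle_abs|].
      replace (Rabs M) with (e * (Rabs M / e)) by (field; lra).
      apply Rmult_le_compat_l; lra. }
    assert (e * r <= e * ((1 + r * r) * exp ((K + 2) * (s - t0)))).
    { apply Rmult_le_compat_l; [lra|].
      assert (1 <= exp ((K + 2) * (s - t0))) by (apply Hexp; lra). nra. }
    lra. }
  assert (y x t <= 0).
  { apply (rectangle_max_principle y (- r) r t0 t1 K); auto.
    - apply continuous2_minus; auto. apply continuous2_mult; [apply continuous2_const|].
      apply continuous2_mult.
      + apply (continuous2_lift (fun x => 1 + x * x) (fun x _ => x)).
        * intros w. apply (ex_derive_continuous (fun x => 1 + x * x)). auto_derive; auto.
        * apply continuous2_fst.
      + apply (continuous2_lift (fun t => exp ((K + 2) * (t - t0))) (fun _ t => t)).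
        * intros w. apply (ex_derive_continuous (fun t => exp ((K + 2) * (t - t0)))).
          auto_derive; auto.
        * apply continuous2_snd.
    - intros w Hw. unfold y. specialize (Hbot w).
      assert (0 < e * pen w t0) by (apply Rmult_lt_0_compat; auto). lra.
    - intros s Hs. split; apply Hside; auto; ring.
    - intros w s Hw Hs Hpos. unfold y in Hpos.
      assert (0 < e * pen w s) by (apply Rmult_lt_0_compat; auto).
      destruct (Hint w s) as [l [Hl Hle]]; [lra|lra|].
      exists (l - e * ((K + 2) * pen w s - 2 * exp ((K + 2) * (s - t0)))).
      split.
      + apply heat_minus; auto. apply (heat_scal e pen).
        exists ((K + 2) * pen w s), (fun w => 2 * w * exp ((K + 2) * (s - t0))),
          (2 * exp ((K + 2) * (s - t0))).
        unfold pen. refine (conj _ (conj _ (conj _ _))).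
        * auto_derive; auto. unfold Rminus. ring.
        * intros v. auto_derive; auto. ring.
        * auto_derive; auto. ring.
        * ring.
      + unfold y. assert (exp ((K + 2) * (s - t0)) <= pen w s).
        { unfold pen. assert (0 < exp ((K + 2) * (s - t0))) by apply exp_pos. nra. }
        assert (e * exp ((K + 2) * (s - t0)) <= e * pen w s)
          by (apply Rmult_le_compat_l; lra).
        lra.
    - unfold r. assert (0 <= Rabs M / e) by (apply Rdiv_le_0_compat; auto; apply Rabs_pos).
      assert (- Rabs x <= x) by (destruct (Rcase_abs x); [rewrite Rabs_left|rewrite Rabs_right]; lra).
      assert (x <= Rabs x) by apply Rle_abs. lra. }
  unfold y, e in H. replace (z x t / (2 * pen x t) * pen x t) with (z x t / 2) in H.
  lra. field. specialize (Hpen x t). lra.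
Qed.

(** A quantitative strong maximum principle: positivity on the left side, kept during
    the whole time interval, spreads to the right however small z is initially.
    The barrier is an exponential in x - x1 + kappa (t1 - t), cut off where this
    quantity reaches the length of the interval, so that it is nonpositive
    initially and on the right side. *)
Lemma spreading_positivity (z : R -> R -> R) x1 x2 t0 t1 K :
  0 <= K -> t0 < t1 -> continuous2 z ->
  (forall x t, x1 <= x <= x2 -> t0 <= t <= t1 -> 0 <= z x t) ->
  (forall t, t0 <= t <= t1 -> 0 < z x1 t) ->
  (forall x t, x1 < x < x2 -> t0 < t <= t1 ->
     exists l, heat_at z x t l /\ - K * z x t <= l) ->
  forall x, x1 <= x < x2 -> 0 < z x t1.
Proof.
  intros HK Ht Hz Hnn Hleft Hint x Hx.
  set (r := x2 - x1). set (kap := r / (t1 - t0)). set (A := kap + K + 1).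
  assert (Hr : 0 < r) by (unfold r; lra).
  assert (Hkap : 0 < kap) by (apply Rdiv_lt_0_compat; lra).
  assert (HA : K <= A * A - A * kap)
    by (replace (A * A - A * kap) with (A * (K + 1)) by (unfold A; ring); unfold A; nra).
  assert (HA0 : 0 < A) by (unfold A; lra).
  destruct (segment_min (fun t => z x1 t) t0 t1) as [tm [Htm Hmin]]; [lra| |].
  { intros s. now apply continuous2_slice_t. }
  set (e := z x1 tm). assert (He : 0 < e) by now apply Hleft.
  set (E := fun x t => exp (- A * ((x - x1) + kap * (t1 - t)))).
  set (psi := fun x t => E x t - exp (- A * r)).
  assert (Hexp : forall a b, a <= b -> exp a <= exp b).
  { intros a b [Hab| ->]; [left; now apply exp_increasing|right; auto]. }
  assert (Hmono : forall y s v, v <= (y - x1) + kap * (t1 - s) -> E y s <= exp (- A * v)).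
  { intros y s v Hv. apply Hexp. assert (A * v <= A * ((y - x1) + kap * (t1 - s)))
      by (apply Rmult_le_compat_l; lra). lra. }
  assert (Hkt : forall s, s <= t1 -> 0 <= kap * (t1 - s)) by (intros s Hs; apply Rmult_le_pos; lra).
  assert (e * psi x t1 - z x t1 <= 0).
  { apply (rectangle_max_principle (fun x t => e * psi x t - z x t) x1 x2 t0 t1 0); try lra.
    - apply continuous2_minus; auto. apply continuous2_mult; [apply continuous2_const|].
      apply continuous2_minus; [|apply continuous2_const].
      apply (continuous2_lift exp (fun x t => - A * ((x - x1) + kap * (t1 - t)))).
      + intros y. apply (ex_derive_continuous exp). auto_derive; auto.
      + cont2.
    - intros y Hy.
      assert (E y t0 <= exp (- A * r)).
      { apply Hmono. replace (kap * (t1 - t0)) with r by (unfold kap; field; lra). lra. }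
      assert (0 <= e * (exp (- A * r) - E y t0)) by (apply Rmult_le_pos; lra).
      assert (0 <= z y t0) by (apply Hnn; lra). unfold psi. lra.
    - intros s Hs. split.
      + assert (E x1 s <= 1).
        { rewrite <- exp_0. replace 0 with (- A * 0) by ring. apply Hmono.
          specialize (Hkt s). lra. }
        assert (0 < exp (- A * r)) by apply exp_pos.
        assert (e * psi x1 s <= e * 1) by (apply Rmult_le_compat_l; unfold psi; lra).
        assert (e <= z x1 s) by now apply Hmin. lra.
      + assert (E x2 s <= exp (- A * r)).
        { apply Hmono. specialize (Hkt s). unfold r. lra. }
        assert (0 <= e * (exp (- A * r) - E x2 s)) by (apply Rmult_le_pos; lra).
        assert (0 <= z x2 s) by (apply Hnn; lra). unfold psi. lra.
    - intros y s Hy Hs Hpos. destruct (Hint y s Hy Hs) as [l [Hl Hle]].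
      exists (e * ((A * kap - A * A) * E y s) - l). split.
      + apply heat_minus; auto. apply heat_scal.
        exists (A * kap * E y s), (fun y => - A * E y s), (A * A * E y s).
        unfold psi, E. refine (conj _ (conj _ (conj _ _))).
        * auto_derive; auto. unfold Rminus. ring.
        * intros v. auto_derive; auto. unfold Rminus. ring.
        * auto_derive; auto. unfold Rminus. ring.
        * ring.
      + assert (0 < E y s) by apply exp_pos. assert (0 < exp (- A * r)) by apply exp_pos.
        assert (e * ((A * kap - A * A) * E y s) <= e * (- K * E y s)).
        { apply Rmult_le_compat_l; [lra|]. apply Rmult_le_compat_r; lra. }
        assert (e * (- K * E y s) <= - K * (e * psi y s)).
        { unfold psi. assert (0 <= K * e * exp (- A * r)).
          { apply Rmult_le_pos; [apply Rmult_le_pos|]; lra. } lra. }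
        assert (0 <= K * (e * psi y s - z y s)) by (apply Rmult_le_pos; lra).
        lra. }
  assert (0 < psi x t1).
  { unfold psi, E. assert (exp (- A * r) < exp (- A * (x - x1 + kap * (t1 - t1)))); [|lra].
    apply exp_increasing. unfold r. assert (0 < A * (x2 - x)) by (apply Rmult_lt_0_compat; lra). lra. }
  assert (0 < e * psi x t1) by (apply Rmult_lt_0_compat; lra). lra.
Qed.

(** * A maximum principle at three points *)

Lemma continuous_Rmin {X : UniformSpace} (f g : X -> R) (p : X) :
  continuous f p -> continuous g p -> continuous (fun p => Rmin (f p) (g p)) p.
Proof.
  intros Hf Hg.
  apply continuous_ext with (fun p => / 2 * ((f p + g p) - Rabs (f p - g p))).
  { intros q. unfold Rmin. destruct (Rle_dec (f q) (g q)).
    - rewrite Rabs_left1; lra.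
    - rewrite Rabs_right; lra. }
  apply (continuous_scal_r (/ 2) (fun p => (f p + g p) - Rabs (f p - g p))).
  apply (continuous_minus (fun p => f p + g p) (fun p => Rabs (f p - g p))).
  - now apply (continuous_plus f g).
  - apply (continuous_comp (fun p => f p - g p) Rabs).
    + now apply (continuous_minus f g).
    + apply continuous_Rabs.
Qed.

(** At a spatial maximum x and a spatial minimum a the diffusion lowers z(x) - z(a), so only
    the source terms can increase it. *)
Lemma heat_difference_decay (z : R -> R -> R) x a t gx ga K d :
  heat_at z x t gx -> heat_at z a t ga -> 0 < d ->
  (forall y, Rabs (y - x) < d -> z y t <= z x t) ->
  (forall y, Rabs (y - a) < d -> z a t <= z y t) ->
  gx - ga < K * (z x t - z a t) ->
  exists e, 0 < e /\ forall s, t - e < s < t ->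
    exp (- K * t) * (z x t - z a t) < exp (- K * s) * (z x s - z a s).
Proof.
  intros (zt & zx & zxx & H1 & H2 & H3 & ->) (wt & wx & wxx & H4 & H5 & H6 & ->)
    Hd Hx Ha Hlt.
  apply (derive_left_strict (fun s => z x s - z a s) t (zt - wt) K).
  - apply (is_derive_minus (fun s => z x s) (fun s => z a s) t zt wt H1 H4).
  - assert (zxx <= 0) by (apply (derive2_local_max (fun y => z y t) zx x zxx d); auto).
    assert (- wxx <= 0); [|lra].
    apply (derive2_local_max (fun y => - z y t) (fun y => - wx y) a (- wxx) d); auto.
    + intros y. apply (is_derive_opp (fun y => z y t) y (wx y) (H5 y)).
    + apply (is_derive_opp wx a wxx H6).
    + intros y Hy. specialize (Ha y Hy). lra.
Qed.

(** Failure of quasiconvexity of z at time t is measured by the largest lam such that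
    z(x) - z(a) >= lam and z(x) - z(b) >= lam for some a <= x <= b. At an optimal
    triple, x is a local maximum, and a, b can be taken to be local minima, because they
    minimize z on their side of x. Diffusion then lowers both differences, so a
    failure at time T comes from a failure at time s, smaller at most by the
    factor exp((K + 1) (T - s)). The hypothesis on r confines the triples to a compact
    set. Sources that are Lipschitz functions of z are admitted, and more generally those
    whose increments are controlled once the difference is at least lam; the
    latter is what allows a small perturbation of the solution later on. *)
Lemma three_point_principle (z g : R -> R -> R) s T K lam r :
  0 <= K -> s <= T -> 0 < lam -> continuous2 z ->
  (forall x t, s < t <= T -> heat_at z x t (g x t)) ->
  (forall x a t, s < t <= T -> lam <= z x t - z a t ->
     g x t - g a t <= K * (z x t - z a t)) ->
  (forall a x b t, s <= t <= T -> a <= x <= b ->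
     lam <= z x t - z a t -> lam <= z x t - z b t -> - r < a /\ b < r) ->
  forall a x b, a <= x <= b ->
    lam * exp ((K + 1) * (T - s)) <= z x T - z a T ->
    lam * exp ((K + 1) * (T - s)) <= z x T - z b T ->
  exists a x b, a <= x <= b /\ lam <= z x s - z a s /\ lam <= z x s - z b s.
Proof.
  intros HK HsT Hlam Hz Hheat Hlip Hfar a1 x1 b1 Hord1 Ha1 Hb1.
  set (E := fun t => exp (- (K + 1) * (t - s))).
  assert (HE : forall t, 0 < E t) by (intros t; apply exp_pos).
  assert (HE1 : forall t, s <= t -> E t <= 1).
  { intros t Ht. unfold E. apply Rle_trans with (exp 0); [|right; apply exp_0].
    assert (0 <= (K + 1) * (t - s)) by (apply Rmult_le_pos; lra).
    destruct H as [H|H].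
    - left. apply exp_increasing. lra.
    - right. f_equal. lra. }
  (* With a = x - p and b = x + q the order a <= x <= b holds on a box. *)
  set (P := fun x p q t =>
    E t * Rmin (z x t - z (x - p) t) (z x t - z (x + q) t)).
  assert (Hexp1 : 1 <= exp ((K + 1) * (T - s))).
  { apply Rle_trans with (exp 0); [right; symmetry; apply exp_0|].
    assert (0 <= (K + 1) * (T - s)) by (apply Rmult_le_pos; lra).
    destruct H as [H|H]; [left; now apply exp_increasing|right; now f_equal]. }
  assert (Hr1 : - r < a1 /\ b1 < r).
  { assert (lam * 1 <= lam * exp ((K + 1) * (T - s))) by (apply Rmult_le_compat_l; lra).
    apply (Hfar a1 x1 b1 T); try lra. }
  destruct (compact_max
    (fun w : (R * R) * (R * R) => (- r <= fst (fst w) <= r /\ 0 <= snd (fst w) <= 2 * r)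
       /\ (0 <= fst (snd w) <= 2 * r /\ s <= snd (snd w) <= T))
    (fun w => P (fst (fst w)) (snd (fst w)) (fst (snd w)) (snd (snd w))))
    as [[[x p] [q t]] [[[Hx Hp] [Hq Ht]] Hmax]].
  - apply (compact_prod (fun w : R * R => - r <= fst w <= r /\ 0 <= snd w <= 2 * r)
      (fun w : R * R => 0 <= fst w <= 2 * r /\ s <= snd w <= T)).
    + apply (compact_prod (fun x : R => - r <= x <= r) (fun p : R => 0 <= p <= 2 * r));
        apply compact_segment; lra.
    + apply (compact_prod (fun x : R => 0 <= x <= 2 * r) (fun p : R => s <= p <= T));
        apply compact_segment; lra.
  - exists ((x1, x1 - a1), (b1 - x1, T)). simpl. lra.
  - intros w _.
    assert (C1 : continuous (fun w : (R * R) * (R * R) => fst (fst w)) w).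
    { apply (continuous_comp fst fst); apply continuous_fst. }
    assert (C2 : continuous (fun w : (R * R) * (R * R) => snd (fst w)) w).
    { apply (continuous_comp fst snd); [apply continuous_fst|apply continuous_snd]. }
    assert (C3 : continuous (fun w : (R * R) * (R * R) => fst (snd w)) w).
    { apply (continuous_comp snd fst); [apply continuous_snd|apply continuous_fst]. }
    assert (C4 : continuous (fun w : (R * R) * (R * R) => snd (snd w)) w).
    { apply (continuous_comp snd snd); apply continuous_snd. }
    apply (continuous_mult (fun w : (R * R) * (R * R) => E (snd (snd w)))
      (fun w => Rmin _ _)).
    + apply (continuous_comp (fun w : (R * R) * (R * R) => snd (snd w)) E); auto.
      apply (ex_derive_continuous E). unfold E. auto_derive; auto.
    + apply continuous_Rmin.
      * apply (continuous_minus (fun w : (R * R) * (R * R) => z (fst (fst w)) (snd (snd w)))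
          (fun w => z (fst (fst w) - snd (fst w)) (snd (snd w)))).
        -- now apply continuous2_comp.
        -- apply continuous2_comp; auto. now apply (continuous_minus (fun w : (R * R) * (R * R) => fst (fst w)) (fun w => snd (fst w))).
      * apply (continuous_minus (fun w : (R * R) * (R * R) => z (fst (fst w)) (snd (snd w)))
          (fun w => z (fst (fst w) + fst (snd w)) (snd (snd w)))).
        -- now apply continuous2_comp.
        -- apply continuous2_comp; auto. now apply (continuous_plus (fun w : (R * R) * (R * R) => fst (fst w)) (fun w => fst (snd w))).
  - simpl in Hx, Hp, Hq, Ht.
    assert (HP : forall a y b t', s <= t' <= T -> - r <= a -> b <= r -> a <= y <= b ->
        E t' * Rmin (z y t' - z a t') (z y t' - z b t') <= P x p q t).
    { intros a y b t' Ht' Ha Hb Hy.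
      specialize (Hmax ((y, y - a), (b - y, t'))). simpl in Hmax.
      unfold P at 1 in Hmax.
      replace (y - (y - a)) with a in Hmax by ring.
      replace (y + (b - y)) with b in Hmax by ring. apply Hmax. lra. }
    assert (Hlow : lam <= P x p q t).
    { apply Rle_trans with (2 := HP a1 x1 b1 T ltac:(lra) ltac:(lra) ltac:(lra) Hord1).
      replace lam with (E T * (lam * exp ((K + 1) * (T - s)))).
      - apply Rmult_le_compat_l; [left; apply HE|]. now apply Rmin_glb.
      - unfold E. replace (- (K + 1) * (T - s)) with (- ((K + 1) * (T - s))) by ring.
        rewrite exp_Ropp. field. apply Rgt_not_eq, exp_pos. }
    assert (Hbelow : lam <= Rmin (z x t - z (x - p) t) (z x t - z (x + q) t)).
    { apply Rnot_lt_le. intros Hlt. unfold P in Hlow.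
      assert (E t * Rmin (z x t - z (x - p) t) (z x t - z (x + q) t) < E t * lam)
        by (apply Rmult_lt_compat_l; auto).
      assert (E t * lam <= 1 * lam) by (apply Rmult_le_compat_r; [lra|apply HE1; lra]).
      lra. }
    assert (Hm1 := Rmin_l (z x t - z (x - p) t) (z x t - z (x + q) t)).
    assert (Hm2 := Rmin_r (z x t - z (x - p) t) (z x t - z (x + q) t)).
    assert (Hfar1 : - r < x - p /\ x + q < r) by (apply (Hfar (x - p) x (x + q) t); lra).
    (* Replacing a and b by minimizers on their sides keeps the triple optimal. *)
    destruct (segment_min (fun y => z y t) (- r) x) as [a [Ha Hamin]]; [lra| |].
    { intros y. now apply continuous2_slice_x. }
    destruct (segment_min (fun y => z y t) x r) as [b [Hb Hbmin]]; [lra| |].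
    { intros y. now apply continuous2_slice_x. }
    assert (Hap : z a t <= z (x - p) t) by (apply Hamin; lra).
    assert (Hbq : z b t <= z (x + q) t) by (apply Hbmin; lra).
    assert (Hfar2 : - r < a /\ b < r) by (apply (Hfar a x b t); lra).
    destruct (Req_dec t s) as [->|Hts].
    { exists a, x, b. lra. }
    exfalso.
    assert (Hax : a <> x) by (intros ->; lra).
    assert (Hbx : b <> x) by (intros ->; lra).
    set (M := Rmin (z x t - z a t) (z x t - z b t)).
    assert (HM : P x p q t <= E t * M).
    { apply Rmult_le_compat_l; [left; apply HE|]. apply Rmin_glb.
      - apply Rle_trans with (1 := Hm1). lra.
      - apply Rle_trans with (1 := Hm2). lra. }
    set (d := Rmin (Rmin (a + r) (x - a)) (Rmin (b - x) (r - b))).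
    assert (Hd : 0 < d) by (repeat apply Rmin_glb_lt; lra).
    assert (Hd1 : d <= a + r) by (apply Rle_trans with (2 := Rmin_l (a + r) (x - a)), Rmin_l).
    assert (Hd2 : d <= x - a) by (apply Rle_trans with (2 := Rmin_r (a + r) (x - a)), Rmin_l).
    assert (Hd3 : d <= b - x) by (apply Rle_trans with (2 := Rmin_l (b - x) (r - b)), Rmin_r).
    assert (Hd4 : d <= r - b) by (apply Rle_trans with (2 := Rmin_r (b - x) (r - b)), Rmin_r).
    assert (Hxmax : forall y, Rabs (y - x) < d -> z y t <= z x t).
    { intros y Hy. apply Rabs_def2 in Hy. apply Rnot_lt_le. intros Hlt.
      assert (HPy := HP a y b t ltac:(lra) ltac:(lra) ltac:(lra) ltac:(lra)).
      assert (Rmin (z y t - z a t) (z y t - z b t) <= M).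
      { apply Rmult_le_reg_l with (E t); [apply HE|lra]. }
      assert (M < Rmin (z y t - z a t) (z y t - z b t)); [|lra].
      assert (M <= z x t - z a t) by apply Rmin_l.
      assert (M <= z x t - z b t) by apply Rmin_r.
      apply Rmin_glb_lt; lra. }
    assert (Hloc : forall c, (c = a \/ c = b) -> exists e, 0 < e /\ forall s', t - e < s' < t ->
      exp (- (K + 1) * t) * (z x t - z c t) < exp (- (K + 1) * s') * (z x s' - z c s')).
    { intros c Hc. apply (heat_difference_decay z x c t (g x t) (g c t) (K + 1) d); auto.
      - apply Hheat; lra.
      - apply Hheat; lra.
      - intros y Hy. apply Rabs_def2 in Hy.
        destruct Hc as [-> | ->]; [apply Hamin|apply Hbmin]; lra.
      - assert (lam <= z x t - z c t) by (destruct Hc as [-> | ->]; lra).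
        assert (g x t - g c t <= K * (z x t - z c t)) by (apply Hlip; lra). lra. }
    destruct (Hloc a) as [e1 [He1 H1]]; auto.
    destruct (Hloc b) as [e2 [He2 H2]]; auto.
    set (e := Rmin (Rmin e1 e2) (t - s)).
    assert (He : 0 < e) by (repeat apply Rmin_glb_lt; lra).
    assert (Hee1 : e <= e1) by (apply Rle_trans with (2 := Rmin_l e1 e2), Rmin_l).
    assert (Hee2 : e <= e2) by (apply Rle_trans with (2 := Rmin_r e1 e2), Rmin_l).
    assert (Hee3 : e <= t - s) by apply Rmin_r.
    specialize (H1 (t - e / 2) ltac:(lra)). specialize (H2 (t - e / 2) ltac:(lra)).
    assert (HPe := HP a x b (t - e / 2) ltac:(lra) ltac:(lra) ltac:(lra) ltac:(lra)).
    assert (HEe : forall t', E t' = exp ((K + 1) * s) * exp (- (K + 1) * t')).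
    { intros t'. unfold E. rewrite <- exp_plus. f_equal. ring. }
    assert (E t * M < E (t - e / 2) *
      Rmin (z x (t - e / 2) - z a (t - e / 2)) (z x (t - e / 2) - z b (t - e / 2))).
    { assert (Hps := exp_pos ((K + 1) * s)). rewrite !HEe, !Rmult_assoc.
      apply Rmult_lt_compat_l; auto.
      assert (M <= z x t - z a t) by apply Rmin_l.
      assert (M <= z x t - z b t) by apply Rmin_r.
      assert (Hpt := exp_pos (- (K + 1) * t)).
      assert (exp (- (K + 1) * t) * M <= exp (- (K + 1) * t) * (z x t - z a t))
        by (apply Rmult_le_compat_l; lra).
      assert (exp (- (K + 1) * t) * M <= exp (- (K + 1) * t) * (z x t - z b t))
        by (apply Rmult_le_compat_l; lra).
      unfold Rmin at 1.
      destruct (Rle_dec (z x (t - e / 2) - z a (t - e / 2)) (z x (t - e / 2) - z b (t - e / 2))); lra. }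
    lra.
Qed.

(** * The reaction term and the well-shaped solution *)

Definition admissible (f0 Theta0 : R) : Prop :=
  0 < f0 < 1 /\ 0 < Theta0 < PI /\ cos Theta0 = - f0.

Lemma reaction_lipschitz f0 Theta0 a b :
  Rabs (reaction f0 Theta0 a - reaction f0 Theta0 b) <= Rabs (a - b).
Proof.
  unfold reaction.
  replace (cos (a + Theta0) + f0 - (cos (b + Theta0) + f0))
    with (cos (a + Theta0) - cos (b + Theta0)) by ring.
  destruct (MVT_gen (fun y => cos (y + Theta0)) b a (fun y => - sin (y + Theta0)))
    as [c [_ Hc]].
  - intros y _. auto_derive; auto. ring.
  - intros y _. apply continuity_pt_filterlim.
    apply (ex_derive_continuous (fun y => cos (y + Theta0))). auto_derive; auto.
  - cbv beta in Hc. rewrite Hc, Rabs_mult.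
    rewrite <- (Rmult_1_l (Rabs (a - b))) at 2.
    apply Rmult_le_compat_r; [apply Rabs_pos|].
    assert (H := SIN_bound (c + Theta0)). apply Rabs_le. lra.
Qed.

Lemma reaction_lower f0 Theta0 a b :
  a <= b -> reaction f0 Theta0 b - reaction f0 Theta0 a >= - (b - a).
Proof.
  intros Hab. assert (H := reaction_lipschitz f0 Theta0 b a).
  rewrite (Rabs_right (b - a)) in H by lra.
  assert (H' := Rle_abs (- (reaction f0 Theta0 b - reaction f0 Theta0 a))).
  rewrite Rabs_Ropp in H'. lra.
Qed.

Lemma reaction_upper f0 Theta0 a b :
  a <= b -> reaction f0 Theta0 b - reaction f0 Theta0 a <= b - a.
Proof.
  intros Hab. assert (H := reaction_lipschitz f0 Theta0 b a).
  rewrite (Rabs_right (b - a)) in H by lra.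
  assert (H' := Rle_abs (reaction f0 Theta0 b - reaction f0 Theta0 a)). lra.
Qed.

Lemma reaction_period f0 Theta0 a (k : nat) :
  reaction f0 Theta0 (2 * PI * INR k + a) = reaction f0 Theta0 a.
Proof.
  unfold reaction. f_equal. rewrite <- (cos_period (a + Theta0) k). f_equal. ring.
Qed.

(** The form behind the travelling subsolution: the sine term alone has the exact
    stationary kink 4 atan(exp(- k x)), and the remainder f0 (1 - cos a) is nonnegative. *)
Lemma reaction_expand f0 Theta0 a :
  admissible f0 Theta0 ->
  reaction f0 Theta0 a = f0 * (1 - cos a) - sin Theta0 * sin a.
Proof.
  intros (_ & _ & Hc). unfold reaction. rewrite cos_plus, Hc. ring.
Qed.

Lemma reaction_rest f0 Theta0 (k : nat) :
  admissible f0 Theta0 -> reaction f0 Theta0 (2 * PI * INR k) = 0.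
Proof.
  intros H. rewrite <- (Rplus_0_r (2 * PI * INR k)), reaction_period.
  rewrite (reaction_expand _ _ _ H), cos_0, sin_0. ring.
Qed.

(** Quasiconvexity means decreasing, then increasing. Unlike a statement about the
    sign of u_x, it can be propagated by comparing three values. *)
Definition quasiconvex (g : R -> R) : Prop :=
  forall a x b, a <= x <= b -> g x <= g a \/ g x <= g b.

(** What is used of the solution and of its datum: a quasiconvex well from the rest
    state 2 PI n down to 0 and back, flat outside a compact set. The class is stable under
    reflection, so statements on the left flank give those on the right. *)
Record well_solution (f0 Theta0 : R) (n : nat) (u : R -> R -> R) : Prop := {
  well_admissible : admissible f0 Theta0;
  well_cont : continuous2 u;
  well_heat : forall x t, 0 < t -> heat_at u x t (reaction f0 Theta0 (u x t));
  well_bounded : forall T, exists M, forall x t, 0 <= t <= T -> Rabs (u x t) <= M;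
  well_init_range : forall x, 0 <= u x 0 <= 2 * PI * INR n;
  well_init_far : exists L, forall x, L <= Rabs x -> u x 0 = 2 * PI * INR n;
  well_init_quasiconvex : quasiconvex (fun x => u x 0);
  well_init_zero : exists x, u x 0 = 0
}.

Lemma well_reflect f0 Theta0 n u :
  well_solution f0 Theta0 n u -> well_solution f0 Theta0 n (fun x t => u (- x) t).
Proof.
  intros Hu. split.
  - apply Hu.
  - apply continuous2_reflect, Hu.
  - intros x t Ht. apply heat_reflect, Hu, Ht.
  - intros T. destruct (well_bounded _ _ _ _ Hu T) as [M HM]. exists M.
    intros x t Ht. now apply HM.
  - intros x. apply Hu.
  - destruct (well_init_far _ _ _ _ Hu) as [L HL]. exists L.
    intros x Hx. apply HL. now rewrite Rabs_Ropp.
  - intros a x b H. destruct (well_init_quasiconvex _ _ _ _ Hu (- b) (- x) (- a)); auto.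
    lra.
  - destruct (well_init_zero _ _ _ _ Hu) as [x Hx]. exists (- x). now rewrite Ropp_involutive.
Qed.

Lemma well_range f0 Theta0 n u x t :
  well_solution f0 Theta0 n u -> 0 <= t -> 0 <= u x t <= 2 * PI * INR n.
Proof.
  intros Hu Ht. destruct (well_bounded _ _ _ _ Hu t) as [M HM].
  assert (HadM := well_admissible _ _ _ _ Hu).
  assert (H0 := reaction_rest f0 Theta0 0 HadM). simpl INR in H0. rewrite Rmult_0_r in H0.
  assert (HN := reaction_rest f0 Theta0 n HadM).
  set (N := 2 * PI * INR n) in *.
  assert (Hc := well_cont _ _ _ _ Hu).
  split.
  - assert (0 - u x t <= 0); [|lra].
    apply (line_max_principle (fun x t => 0 - u x t) 0 t 1 M); try lra.
    + cont2.
    + intros y s Hs. specialize (HM y s Hs). apply Rabs_le_between in HM. lra.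
    + intros y. assert (Hr := well_init_range _ _ _ _ Hu y). lra.
    + intros y s Hs Hpos. exists (0 - reaction f0 Theta0 (u y s)). split.
      * apply heat_minus; [|apply Hu; lra].
        apply (heat_time (fun _ => 0)), (is_derive_const 0 s).
      * assert (Hb := reaction_upper f0 Theta0 (u y s) 0 ltac:(lra)). lra.
  - assert (u x t - N <= 0); [|lra].
    apply (line_max_principle (fun x t => u x t - N) 0 t 1 (M - N)); try lra.
    + cont2.
    + intros y s Hs. specialize (HM y s Hs). apply Rabs_le_between in HM. lra.
    + intros y. assert (Hr := well_init_range _ _ _ _ Hu y). fold N in Hr. lra.
    + intros y s Hs Hpos. exists (reaction f0 Theta0 (u y s) - 0). split.
      * apply heat_minus; [apply Hu; lra|].
        apply (heat_time (fun _ => N)), (is_derive_const N s).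
      * assert (Hb := reaction_upper f0 Theta0 N (u y s) ltac:(lra)). lra.
Qed.

(** The defect 2 PI n - u vanishes initially for x <= - L and grows at most like the
    equation w_t = w_xx + w allows; 2 PI n exp(x + |L| + 2 t) solves that equation
    and dominates the defect initially. *)
Lemma well_far_left f0 Theta0 n u T e :
  well_solution f0 Theta0 n u -> 0 < e ->
  exists r, 0 < r /\ forall x t, 0 <= t <= T -> x <= - r -> 2 * PI * INR n - e < u x t.
Proof.
  intros Hu He. destruct (well_init_far _ _ _ _ Hu) as [L HL].
  assert (HN := reaction_rest f0 Theta0 n (well_admissible _ _ _ _ Hu)).
  set (N := 2 * PI * INR n) in *.
  assert (HN0 : 0 <= N).
  { assert (Hr := well_init_range _ _ _ _ Hu 0). fold N in Hr. lra. }
  assert (Hc := well_cont _ _ _ _ Hu).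
  set (E := fun x t => exp (x + Rabs L + 2 * t)).
  assert (Hbound : forall x t, 0 <= t -> N - u x t <= N * E x t).
  { intros x t Ht.
    assert (N - u x t - N * E x t <= 0); [|lra].
    apply (line_max_principle (fun x t => N - u x t - N * E x t) 0 t 1 N); try lra.
    - cont2. apply (continuous2_lift exp (fun x t => x + Rabs L + 2 * t)).
      + intros y. apply (ex_derive_continuous exp). auto_derive; auto.
      + cont2.
    - intros y s Hs. assert (Hr := well_range _ _ _ _ y s Hu ltac:(lra)).
      assert (0 <= N * E y s) by (apply Rmult_le_pos; [lra|left; apply exp_pos]). lra.
    - intros y. destruct (Rle_lt_dec L (Rabs y)) as [Hy|Hy].
      + rewrite (HL y Hy). fold N.
        assert (0 <= N * E y 0) by (apply Rmult_le_pos; [lra|left; apply exp_pos]). lra.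
      + assert (Hr := well_init_range _ _ _ _ Hu y).
        assert (Rabs L >= Rabs y) by (assert (Hl := Rle_abs L); lra).
        assert (0 <= y + Rabs L + 2 * 0).
        { assert (Hy' := Rle_abs (- y)). rewrite Rabs_Ropp in Hy'. lra. }
        assert (1 <= E y 0).
        { apply Rle_trans with (exp 0); [right; symmetry; apply exp_0|].
          destruct H0 as [H0|H0]; [left; now apply exp_increasing|right; unfold E; now f_equal]. }
        assert (N * 1 <= N * E y 0) by (apply Rmult_le_compat_l; lra). lra.
    - intros y s Hs Hpos. exists (0 - reaction f0 Theta0 (u y s) - N * E y s). split.
      + apply heat_minus; [apply heat_minus|].
        * apply (heat_time (fun _ => N)), (is_derive_const N s).
        * apply Hu; lra.
        * apply heat_scal. exists (2 * E y s), (fun y => E y s), (E y s). unfold E.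
          refine (conj _ (conj _ (conj _ _))).
          -- auto_derive; auto. ring.
          -- intros w. auto_derive; auto. ring.
          -- auto_derive; auto. ring.
          -- ring.
      + assert (Hr := well_range _ _ _ _ y s Hu ltac:(lra)). fold N in Hr.
        assert (Hb := reaction_lower f0 Theta0 (u y s) N ltac:(lra)).
        assert (Hb' := reaction_upper f0 Theta0 (u y s) N ltac:(lra)). lra. }
  assert (HNe : 0 <= N / e) by (apply Rdiv_le_0_compat; lra).
  (* The term N / e makes the exponential smaller than e / N. *)
  exists (Rabs L + 2 * Rabs T + N / e + 1).
  assert (HL0 := Rabs_pos L). assert (HT0 := Rabs_pos T). assert (HT1 := Rle_abs T).
  split; [lra|]. intros x t Ht Hx.
  assert (HB := Hbound x t ltac:(lra)).
  assert (N * E x t < e); [|lra].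
  assert (E x t <= exp (- (N / e + 1))).
  { unfold E. assert (x + Rabs L + 2 * t <= - (N / e + 1)) as [H|H] by lra.
    left; now apply exp_increasing. right; now f_equal. }
  assert (1 + (N / e + 1) < exp (N / e + 1)) by (apply exp_ineq1; lra).
  assert (HEp := exp_pos (N / e + 1)).
  apply Rle_lt_trans with (N * exp (- (N / e + 1))).
  { now apply Rmult_le_compat_l. }
  rewrite exp_Ropp. apply Rmult_lt_reg_r with (exp (N / e + 1)); auto.
  rewrite Rmult_assoc, Rinv_l by lra.
  assert (e * (N / e) = N) by (field; lra).
  assert (e * (N / e + 1) < e * exp (N / e + 1)) by (apply Rmult_lt_compat_l; lra).
  lra.
Qed.

Lemma well_far f0 Theta0 n u T e :
  well_solution f0 Theta0 n u -> 0 < e ->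
  exists r, 0 < r /\ forall x t, 0 <= t <= T -> r <= Rabs x -> 2 * PI * INR n - e < u x t.
Proof.
  intros Hu He. destruct (well_far_left _ _ _ _ T e Hu He) as [r1 [Hr1 H1]].
  destruct (well_far_left _ _ _ _ T e (well_reflect _ _ _ _ Hu) He) as [r2 [Hr2 H2]].
  assert (r1 <= Rmax r1 r2) by apply Rmax_l. assert (r2 <= Rmax r1 r2) by apply Rmax_r.
  exists (Rmax r1 r2). split; [lra|]. intros x t Ht Hx.
  destruct (Rcase_abs x) as [Hx'|Hx'].
  - rewrite Rabs_left in Hx by lra. apply H1; lra.
  - rewrite Rabs_right in Hx by lra. rewrite <- (Ropp_involutive x). apply H2; lra.
Qed.

(** Quasiconvexity is preserved: a failure at time t would come from one at time 0. *)
Lemma well_quasiconvex f0 Theta0 n u t :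
  well_solution f0 Theta0 n u -> 0 <= t -> quasiconvex (fun x => u x t).
Proof.
  intros Hu Ht a x b Hord. apply NNPP. intros Hno.
  apply not_or_and in Hno. destruct Hno as [Ha Hb].
  apply Rnot_le_lt in Ha, Hb.
  set (p := Rmin (u x t - u a t) (u x t - u b t)).
  assert (Hp : 0 < p) by (apply Rmin_glb_lt; lra).
  assert (Hpa : p <= u x t - u a t) by apply Rmin_l.
  assert (Hpb : p <= u x t - u b t) by apply Rmin_r.
  (* The size of failure at time 0 that would lead to p at time t. *)
  set (lam := p * exp (- ((1 + 1) * (t - 0)))).
  assert (Hlam : 0 < lam) by (apply Rmult_lt_0_compat; auto; apply exp_pos).
  assert (Hback : lam * exp ((1 + 1) * (t - 0)) = p).
  { unfold lam. rewrite Rmult_assoc, <- exp_plus, Rplus_opp_l, exp_0. ring. }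
  destruct (well_far _ _ _ _ t lam Hu Hlam) as [r [Hr Hfar]].
  destruct (three_point_principle u (fun x t => reaction f0 Theta0 (u x t)) 0 t 1 lam r)
    with (a := a) (x := x) (b := b) as (a' & x' & b' & Hord' & Ha' & Hb'); try lra.
  - apply Hu.
  - intros y s Hs. apply Hu. lra.
  - intros y c s Hs Hd.
    assert (H := reaction_upper f0 Theta0 (u c s) (u y s) ltac:(lra)). lra.
  - intros a' x' b' s Hs Hord' Ha' Hb'.
    assert (Hx' := well_range _ _ _ _ x' s Hu ltac:(lra)).
    split; apply Rnot_le_lt; intros Hle.
    + assert (H := Hfar a' s Hs). rewrite Rabs_left1 in H; lra.
    + assert (H := Hfar b' s Hs). rewrite Rabs_right in H; lra.
  - destruct (well_init_quasiconvex _ _ _ _ Hu a' x' b' Hord'); lra.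
Qed.

(** * Comparison, invasion of the well, crossing times *)

Lemma well_above_left_stable f0 Theta0 n u t c A :
  well_solution f0 Theta0 n u -> c < 2 * PI * INR n -> 0 <= t ->
  (forall x, x <= A -> c < u x t) ->
  exists d, 0 < d /\ forall s, 0 <= s -> Rabs (s - t) < d ->
    forall x, x <= A -> c < u x s.
Proof.
  intros Hu Hc Ht HA.
  destruct (well_far_left _ _ _ _ (t + 1) (2 * PI * INR n - c) Hu) as [r [Hr Hfar]]; [lra|].
  destruct (tube u (- r) A t c) as [d [Hd H]].
  - apply Hu.
  - intros x Hx. apply HA. lra.
  - exists (Rmin d 1). split; [apply Rmin_glb_lt; lra|]. intros s Hs Hsd x Hx.
    assert (Rmin d 1 <= d) by apply Rmin_l. assert (Rmin d 1 <= 1) by apply Rmin_r.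
    destruct (Rle_lt_dec x (- r)) as [Hxr|Hxr].
    + apply Rabs_def2 in Hsd. assert (Hf := Hfar x s ltac:(lra) Hxr). lra.
    + apply H; lra.
Qed.

Lemma well_above_right_stable f0 Theta0 n u t c A :
  well_solution f0 Theta0 n u -> c < 2 * PI * INR n -> 0 <= t ->
  (forall x, A <= x -> c < u x t) ->
  exists d, 0 < d /\ forall s, 0 <= s -> Rabs (s - t) < d ->
    forall x, A <= x -> c < u x s.
Proof.
  intros Hu Hc Ht HA.
  destruct (well_above_left_stable _ _ _ _ t c (- A) (well_reflect _ _ _ _ Hu)) as [d [Hd H]]; auto.
  - intros x Hx. apply HA. lra.
  - exists d. split; auto. intros s Hs Hsd x Hx. rewrite <- (Ropp_involutive x).
    apply H; auto. lra.
Qed.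

Lemma well_above_stable f0 Theta0 n u t c :
  well_solution f0 Theta0 n u -> c < 2 * PI * INR n -> 0 <= t ->
  (forall x, c < u x t) ->
  exists d, 0 < d /\ forall s, 0 <= s -> Rabs (s - t) < d -> forall x, c < u x s.
Proof.
  intros Hu Hc Ht HA.
  destruct (well_above_left_stable _ _ _ _ t c 0 Hu) as [d [Hd H]]; auto.
  destruct (well_above_right_stable _ _ _ _ t c 0 Hu) as [e [He H']]; auto.
  exists (Rmin d e). split; [now apply Rmin_glb_lt|]. intros s Hs Hsd x.
  assert (Rmin d e <= d) by apply Rmin_l. assert (Rmin d e <= e) by apply Rmin_r.
  destruct (Rle_lt_dec x 0); [apply H|apply H']; lra.
Qed.

(** A spatially constant subsolution below u at time t0 stays below by comparison, and strictly,
    since u is above it far to the left and this gap spreads. *)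
Lemma well_above_subsolution f0 Theta0 n u (phi dphi : R -> R) t0 t1 Phi :
  well_solution f0 Theta0 n u -> 0 <= t0 < t1 -> Phi < 2 * PI * INR n ->
  (forall t, is_derive phi t (dphi t)) ->
  (forall t, t0 < t <= t1 -> dphi t <= reaction f0 Theta0 (phi t)) ->
  (forall t, t0 <= t <= t1 -> phi t <= Phi) ->
  (forall x, phi t0 <= u x t0) ->
  forall x, phi t1 < u x t1.
Proof.
  intros Hu Ht HPhi Hd Hsub Hb H0 x.
  assert (Hc := well_cont _ _ _ _ Hu).
  assert (Hphi : continuous2 (fun _ t => phi t)).
  { apply (continuous2_lift phi (fun _ t => t)).
    - intros s. now apply (is_derive_continuous phi s (dphi s)).
    - apply continuous2_snd. }
  assert (Hweak : forall y s, t0 <= s <= t1 -> phi s <= u y s).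
  { intros y s Hs. assert (phi s - u y s <= 0); [|lra].
    apply (line_max_principle (fun y s => phi s - u y s) t0 s 1 Phi); try lra.
    - cont2.
    - intros w v Hv. assert (Hr := well_range _ _ _ _ w v Hu ltac:(lra)).
      specialize (Hb v). lra.
    - intros w. specialize (H0 w). lra.
    - intros w v Hv Hpos. exists (dphi v - reaction f0 Theta0 (u w v)). split.
      + apply heat_minus; [apply (heat_time phi); auto|apply Hu; lra].
      + specialize (Hsub v ltac:(lra)).
        assert (H := reaction_upper f0 Theta0 (u w v) (phi v) ltac:(lra)). lra. }
  destruct (well_far_left _ _ _ _ t1 (2 * PI * INR n - Phi) Hu) as [r [Hr Hfar]]; [lra|].
  set (x1 := Rmin (- r) x).
  assert (Hx1 : x1 <= - r) by apply Rmin_l. assert (Hx1' : x1 <= x) by apply Rmin_r.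
  assert (0 < u x t1 - phi t1); [|lra].
  apply (spreading_positivity (fun x t => u x t - phi t) x1 (x + 1) t0 t1 1); try lra.
  - cont2.
  - intros y s _ Hs. specialize (Hweak y s Hs). lra.
  - intros s Hs. specialize (Hfar x1 s ltac:(lra) Hx1). specialize (Hb s Hs). lra.
  - intros y s Hy Hs. exists (reaction f0 Theta0 (u y s) - dphi s). split.
    + apply heat_minus; [apply Hu; lra|apply (heat_time phi); auto].
    + specialize (Hsub s Hs). specialize (Hweak y s ltac:(lra)).
      assert (H := reaction_lower f0 Theta0 (phi s) (u y s) ltac:(lra)). lra.
Qed.

Lemma well_above_constant f0 Theta0 n u t0 t1 c :
  well_solution f0 Theta0 n u -> 0 <= t0 < t1 -> c < 2 * PI * INR n ->
  0 <= reaction f0 Theta0 c ->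
  (forall x, c <= u x t0) -> forall x, c < u x t1.
Proof.
  intros Hu Ht Hc Hf H0.
  apply (well_above_subsolution f0 Theta0 n u (fun _ => c) (fun _ => 0) t0 t1 c); auto.
  - intros t. apply (is_derive_const c t).
  - intros; lra.
Qed.

Lemma atan_le_id r : 0 <= r -> atan r <= r.
Proof.
  intros Hr. destruct (MVT_gen atan 0 r (fun y => / (1 + y ^ 2))) as [c [_ Hc]].
  - intros y _. auto_derive; auto. field. nra.
  - intros y _. apply derivable_continuous_pt, derivable_pt_atan.
  - rewrite atan_0 in Hc.
    assert (/ (1 + c ^ 2) <= 1).
    { rewrite <- Rinv_1. apply Rinv_le_contravar; nra. }
    assert (/ (1 + c ^ 2) * (r - 0) <= 1 * (r - 0)) by (apply Rmult_le_compat_r; lra). lra.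
Qed.

Lemma sin_2atan r : sin (2 * atan r) = 2 * r / (1 + r ^ 2).
Proof.
  assert (Hp : 0 < 1 + r ^ 2) by nra.
  rewrite sin_2a, sin_atan, cos_atan. unfold Rsqr.
  replace (1 + r * r) with (1 + r ^ 2) by ring.
  assert (Hs : sqrt (1 + r ^ 2) * sqrt (1 + r ^ 2) = 1 + r ^ 2) by (apply sqrt_sqrt; lra).
  assert (Hs0 : 0 < sqrt (1 + r ^ 2)) by now apply sqrt_lt_R0.
  rewrite <- Hs at 3. field. lra.
Qed.

Lemma cos_2atan r : cos (2 * atan r) = (1 - r ^ 2) / (1 + r ^ 2).
Proof.
  assert (Hp : 0 < 1 + r ^ 2) by nra.
  rewrite cos_2a, sin_atan, cos_atan. unfold Rsqr.
  replace (1 + r * r) with (1 + r ^ 2) by ring.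
  assert (Hs : sqrt (1 + r ^ 2) * sqrt (1 + r ^ 2) = 1 + r ^ 2) by (apply sqrt_sqrt; lra).
  assert (Hs0 : 0 < sqrt (1 + r ^ 2)) by now apply sqrt_lt_R0.
  rewrite <- Hs at 5. field. lra.
Qed.

Lemma sin_4atan r : sin (4 * atan r) = 4 * r * (1 - r ^ 2) / (1 + r ^ 2) ^ 2.
Proof.
  replace (4 * atan r) with (2 * (2 * atan r)) by ring.
  rewrite sin_2a, sin_2atan, cos_2atan. field. nra.
Qed.

(** For the kink 4 atan(exp(- k y)) lowered by q, the sum bounded below is the amount by
    which the stationary profile exceeds being a subsolution. Where cos theta is not close
    to 1 the term f0 (1 - cos) of the reaction pays; near the rest states the
    stability of these states pays an amount of order q. The uniform bound eta
    can be spent on a positive speed. *)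
Lemma front_defect f0 Theta0 q :
  admissible f0 Theta0 -> 0 < q <= f0 / 6 ->
  exists eta, 0 < eta /\ forall theta,
    eta <= reaction f0 Theta0 (theta - q) + sin Theta0 * sin theta.
Proof.
  intros Had Hq. assert (Hf0 : 0 < f0 < 1) by apply Had.
  assert (HS : 0 < sin Theta0) by (apply sin_gt_0; apply Had).
  assert (HS1 : sin Theta0 <= 1) by apply SIN_bound.
  set (h := sin (q / 2)). assert (HPI := PI_RGT_0). assert (HPI3 := PI2_3_2).
  assert (Hh : 0 < h) by (apply sin_gt_0; lra).
  assert (Hh2 : h < q / 2) by (apply sin_lt_x; lra).
  assert (Hcq : 0 < cos (q / 2)) by (apply cos_gt_0; lra).
  assert (Hcq1 : cos (q / 2) <= 1) by apply COS_bound.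
  (* The two bounds correspond to cos b >= 1/2 and cos b < 1/2, where b = theta - q / 2. *)
  exists (Rmin (sin Theta0 * h) (f0 / 4)). split.
  { apply Rmin_glb_lt; [now apply Rmult_lt_0_compat|lra]. }
  intros theta. set (b := theta - q / 2).
  rewrite reaction_expand by exact Had.
  replace (theta - q) with (b - q / 2) by (unfold b; field).
  replace theta with (b + q / 2) by (unfold b; field).
  rewrite cos_minus, sin_minus, sin_plus. fold h.
  assert (Hsb := SIN_bound b). assert (Hcb := COS_bound b).
  destruct (Rle_lt_dec (1 / 2) (cos b)) as [Hb|Hb].
  - apply Rle_trans with (sin Theta0 * h); [apply Rmin_l|].
    assert (H1 : cos b * cos (q / 2) + sin b * h <= 1).
    { unfold h. rewrite <- cos_minus. apply COS_bound. }
    assert (0 <= f0 * (1 - (cos b * cos (q / 2) + sin b * h))) by (apply Rmult_le_pos; lra).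
    assert (sin Theta0 * h * (1 / 2) <= sin Theta0 * h * cos b).
    { apply Rmult_le_compat_l; auto. apply Rmult_le_pos; lra. }
    lra.
  - apply Rle_trans with (f0 / 4); [apply Rmin_r|].
    assert (cos b * cos (q / 2) <= 1 / 2).
    { destruct (Rle_lt_dec 0 (cos b)).
      - assert (cos b * cos (q / 2) <= cos b * 1) by (apply Rmult_le_compat_l; lra). lra.
      - assert (0 <= - cos b * cos (q / 2)) by (apply Rmult_le_pos; lra). lra. }
    assert (sin b * h <= 1 * h) by (apply Rmult_le_compat_r; lra).
    assert (f0 * (1 / 2 - h) <= f0 * (1 - (cos b * cos (q / 2) + sin b * h)))
      by (apply Rmult_le_compat_l; lra).
    assert (f0 * h <= 1 * h) by (apply Rmult_le_compat_r; lra).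
    assert (sin Theta0 * h * (-1) <= sin Theta0 * h * cos b).
    { apply Rmult_le_compat_l; [apply Rmult_le_pos|]; lra. }
    assert (sin Theta0 * h <= 1 * h) by (apply Rmult_le_compat_r; lra).
    lra.
Qed.

(** Where u is already close to 2 PI j, the next level invades from the left: the lowered
    kink between 2 PI j and 2 PI (j + 1), moving to the right so slowly that
    the transport term stays below eta, is a subsolution. It is placed so far to the
    left that it lies below u initially. *)
Lemma invasion_left f0 Theta0 n u j q T :
  well_solution f0 Theta0 n u -> (j < n)%nat -> 0 < q <= f0 / 6 -> 0 <= T ->
  (forall x, 2 * PI * INR j - q / 2 <= u x T) ->
  exists T', forall t x, T' <= t -> x <= 0 -> 2 * PI * INR (S j) - 2 * q <= u x t.
Proof.
  intros Hu Hj Hq HT Hbase.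
  assert (Had := well_admissible _ _ _ _ Hu).
  destruct (front_defect f0 Theta0 q Had Hq) as [eta [Heta Hdef]].
  assert (HS : 0 < sin Theta0) by (apply sin_gt_0; apply Had).
  set (k := sqrt (sin Theta0)). assert (Hk : 0 < k) by now apply sqrt_lt_R0.
  assert (Hkk : k * k = sin Theta0) by (apply sqrt_sqrt; lra).
  (* The slope of the kink is at most 2 k, so the speed c costs at most eta. *)
  set (c := eta / (2 * k)). assert (Hc : 0 < c) by (apply Rdiv_lt_0_compat; lra).
  assert (HPI := PI_RGT_0).
  assert (HjN : 2 * PI * INR (S j) <= 2 * PI * INR n).
  { apply Rmult_le_compat_l; [lra|]. apply le_INR. lia. }
  rewrite S_INR in *.
  destruct (well_far_left _ _ _ _ T q Hu ltac:(lra)) as [r [Hr Hfar]].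
  assert (Hqk : 0 < q * k) by (apply Rmult_lt_0_compat; lra).
  (* Right of - r the kink centred at x0 is below q / 2, left of it u exceeds its top. *)
  set (x0 := - r - 8 / (q * k)).
  set (prof := fun y => 4 * atan (exp (- k * y))).
  assert (Hatan : forall y, 0 < atan y < PI / 2 \/ y <= 0).
  { intros y. destruct (Rle_lt_dec y 0); [now right|left]. split.
    - rewrite <- atan_0. now apply atan_increasing.
    - apply atan_bound. }
  assert (Hprof : forall y, 0 < prof y < 2 * PI).
  { intros y. unfold prof. assert (He := exp_pos (- k * y)).
    destruct (Hatan (exp (- k * y))); lra. }
  set (psi := fun x t => (2 * PI * INR j - q) + prof (x - x0 - c * (t - T))).
  assert (Hsmall : forall a, 0 < a -> exp (- a) <= / a).
  { intros a Ha. rewrite exp_Ropp. apply Rinv_le_contravar; auto.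
    assert (1 + a < exp a) by (apply exp_ineq1; lra). lra. }
  assert (Hmono : forall a b, a <= b -> exp a <= exp b).
  { intros a b [H|H]; [left; now apply exp_increasing|right; now f_equal]. }
  assert (Hcmp : forall x t, T <= t -> psi x t <= u x t).
  { intros x t Ht. assert (psi x t - u x t <= 0); [|lra].
    apply (line_max_principle (fun x t => psi x t - u x t) T t 1 (2 * PI * INR j + 2 * PI)); try lra.
    - apply continuous2_minus; [|apply Hu].
      apply continuous2_plus; [apply continuous2_const|].
      apply (continuous2_lift prof (fun x t => x - x0 - c * (t - T))).
      + intros y. apply (ex_derive_continuous prof). unfold prof. auto_derive; auto.
      + cont2.
    - intros y s Hs. assert (Hr1 := well_range _ _ _ _ y s Hu ltac:(lra)).
      unfold psi. specialize (Hprof (y - x0 - c * (s - T))). lra.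
    - intros y. unfold psi. replace (y - x0 - c * (T - T)) with (y - x0) by ring.
      destruct (Rle_lt_dec y (- r)) as [Hy|Hy].
      + specialize (Hfar y T ltac:(lra) Hy). specialize (Hprof (y - x0)). lra.
      + specialize (Hbase y). assert (prof (y - x0) <= q / 2); [|lra].
        unfold prof. assert (He := exp_pos (- k * (y - x0))).
        assert (Ha := atan_le_id (exp (- k * (y - x0))) ltac:(lra)).
        assert (exp (- k * (y - x0)) <= exp (- (8 / q))).
        { apply Hmono. assert (k * (8 / (q * k)) <= k * (y - x0)).
          { apply Rmult_le_compat_l; unfold x0; lra. }
          replace (k * (8 / (q * k))) with (8 / q) in * by (field; lra). lra. }
        assert (exp (- (8 / q)) <= / (8 / q)) by (apply Hsmall, Rdiv_lt_0_compat; lra).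
        replace (/ (8 / q)) with (q / 8) in * by (field; lra). lra.
    - intros y s Hs Hpos.
      set (e := exp (- k * (y - x0 - c * (s - T)))).
      assert (He : 0 < e) by apply exp_pos.
      set (p := prof (y - x0 - c * (s - T))).
      exists (c * (4 * k * e / (1 + e ^ 2)) - sin Theta0 * sin p - reaction f0 Theta0 (u y s)).
      split.
      + apply heat_minus; [|apply Hu; lra].
        exists (c * (4 * k * e / (1 + e ^ 2))),
          (fun y => - 4 * k * exp (- k * (y - x0 - c * (s - T)))
                     / (1 + exp (- k * (y - x0 - c * (s - T))) ^ 2)),
          (sin Theta0 * sin p).
        unfold psi, prof. refine (conj _ (conj _ (conj _ _))).
        * auto_derive; auto. fold e. unfold Rminus in *. fold e. field. nra.
        * intros v. auto_derive; auto. unfold Rminus. field.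
          assert (Hv := exp_pos (- k * (v + - x0 + - (c * (s + - T))))). nra.
        * unfold p, prof. rewrite sin_4atan, <- Hkk. auto_derive.
          -- assert (Hv := exp_pos (- k * (y - x0 - c * (s - T)))). nra.
          -- unfold Rminus. assert (Hv := exp_pos (- k * (y + - x0 + - (c * (s + - T))))). field. nra.
        * ring.
      + assert (e / (1 + e ^ 2) <= / 2).
        { apply Rmult_le_reg_r with (1 + e ^ 2); [nra|].
          replace (e / (1 + e ^ 2) * (1 + e ^ 2)) with e by (field; nra). assert (0 <= (1 - e) ^ 2) by apply pow2_ge_0. lra. }
        assert (c * 4 * k * (e / (1 + e ^ 2)) <= c * 4 * k * / 2).
        { apply Rmult_le_compat_l; auto. apply Rmult_le_pos; [apply Rmult_le_pos|]; lra. }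
        assert (c * 4 * k * / 2 = eta) by (unfold c; field; lra).
        assert (Hf := reaction_upper f0 Theta0 (u y s) (psi y s) ltac:(lra)).
        unfold psi in Hf at 1. fold p in Hf.
        replace (2 * PI * INR j - q + p) with (2 * PI * INR j + (p - q)) in Hf by ring.
        rewrite reaction_period in Hf. specialize (Hdef p).
        replace (c * (4 * k * e / (1 + e ^ 2))) with (c * 4 * k * (e / (1 + e ^ 2))) by (field; nra).
        lra. }
  (* By then the kink has travelled beyond 0 by 4 / (q k), where it is above 2 PI - q. *)
  exists (T + (Rabs x0 + 4 / (q * k)) / c). intros t x Ht Hx.
  assert (H4 : 0 < 4 / (q * k)) by (apply Rdiv_lt_0_compat; lra).
  assert (0 <= (Rabs x0 + 4 / (q * k)) / c).
  { apply Rdiv_le_0_compat; auto. assert (Hp := Rabs_pos x0). lra. }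
  assert (Hct : Rabs x0 + 4 / (q * k) <= c * (t - T)).
  { replace (Rabs x0 + 4 / (q * k)) with (c * ((Rabs x0 + 4 / (q * k)) / c)) by (field; lra).
    apply Rmult_le_compat_l; lra. }
  apply Rle_trans with (psi x t); [|apply Hcmp; lra]. unfold psi.
  assert (2 * PI - q <= prof (x - x0 - c * (t - T))); [|lra].
  set (y := x - x0 - c * (t - T)).
  assert (Hy : y <= - (4 / (q * k))).
  { unfold y. assert (Ha := Rle_abs (- x0)). rewrite Rabs_Ropp in Ha. lra. }
  unfold prof. assert (Hinv := atan_inv (exp (k * y)) (exp_pos _)).
  rewrite <- exp_Ropp in Hinv. replace (- (k * y)) with (- k * y) in Hinv by ring.
  rewrite Hinv.
  assert (Ha := atan_le_id (exp (k * y)) (Rlt_le _ _ (exp_pos _))).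
  assert (exp (k * y) <= exp (- (4 / q))).
  { apply Hmono. assert (k * y <= k * - (4 / (q * k))) by (apply Rmult_le_compat_l; lra).
    replace (k * - (4 / (q * k))) with (- (4 / q)) in * by (field; lra). lra. }
  assert (exp (- (4 / q)) <= / (4 / q)) by (apply Hsmall, Rdiv_lt_0_compat; lra).
  replace (/ (4 / q)) with (q / 4) in * by (field; lra). lra.
Qed.

(** Induction on j, with fronts coming from both sides at each stage. The tolerance q is
    reduced at every level because a front only reaches its upper state up to 2 q. *)
Lemma well_filling f0 Theta0 n u (j : nat) :
  well_solution f0 Theta0 n u -> (j <= n)%nat ->
  forall q, 0 < q -> exists T, 0 <= T /\ forall x, 2 * PI * INR j - q <= u x T.
Proof.
  intros Hu. induction j as [|j IH]; intros Hj q Hq.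
  - exists 0. split; [lra|]. intros x.
    assert (Hr := well_range _ _ _ _ x 0 Hu ltac:(lra)). simpl. lra.
  - assert (Hf0 : 0 < f0 < 1) by apply Hu.
    set (q1 := Rmin (q / 2) (f0 / 6)).
    assert (Hq1 : 0 < q1) by (apply Rmin_glb_lt; lra).
    assert (Hq2 : q1 <= q / 2) by apply Rmin_l. assert (Hq3 : q1 <= f0 / 6) by apply Rmin_r.
    destruct (IH ltac:(lia) (q1 / 2) ltac:(lra)) as [T [HT H]].
    destruct (invasion_left _ _ _ _ j q1 T Hu) as [T1 H1]; auto.
    destruct (invasion_left _ _ _ _ j q1 T (well_reflect _ _ _ _ Hu)) as [T2 H2]; auto.
    exists (Rmax 0 (Rmax T1 T2)). split; [apply Rmax_l|]. intros x.
    assert (HT1 : T1 <= Rmax 0 (Rmax T1 T2)) by (apply Rle_trans with (2 := Rmax_r 0 (Rmax T1 T2)), Rmax_l).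
    assert (HT2 : T2 <= Rmax 0 (Rmax T1 T2)) by (apply Rle_trans with (2 := Rmax_r 0 (Rmax T1 T2)), Rmax_r).
    destruct (Rle_lt_dec x 0) as [Hx|Hx].
    + specialize (H1 _ x HT1 Hx). lra.
    + specialize (H2 _ (- x) HT2 ltac:(lra)). rewrite Ropp_involutive in H2. lra.
Qed.

(** The time at which the minimum of u passes the level c, never to return. *)
Definition crossing_time (u : R -> R -> R) (c tau : R) : Prop :=
  0 < tau /\
  (forall t, 0 <= t < tau -> exists x, u x t < c) /\
  (forall x, c <= u x tau) /\ (exists x, u x tau = c) /\
  (forall t, tau < t -> forall x, c < u x t).

(** A level c with f(c) >= 0 that u has reached everywhere is exceeded ever after, so the times
    at which u goes below c form an interval; filling makes it bounded and
    continuity makes it open on the right. *)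
Lemma crossing_time_exists f0 Theta0 n u c :
  well_solution f0 Theta0 n u -> 0 < c < 2 * PI * INR n -> 0 <= reaction f0 Theta0 c ->
  exists tau, crossing_time u c tau.
Proof.
  intros Hu Hc Hf.
  set (S := fun t => 0 <= t /\ exists x, u x t < c).
  assert (Hlater : forall t, 0 <= t -> ~ S t -> forall s, t < s -> forall x, c < u x s).
  { intros t Ht HS s Hs. apply (well_above_constant f0 Theta0 n u t s c); auto; try lra.
    intros x. apply Rnot_lt_le. intros Hlt. apply HS. split; eauto. }
  assert (Hopen : forall t, S t -> exists d, 0 < d /\ forall s, 0 <= s -> Rabs (s - t) < d -> S s).
  { intros t [Ht [x Hx]].
    destruct (continuous2_lt u x t c (well_cont _ _ _ _ Hu) Hx) as [d [Hd H]].
    exists d. split; auto. intros s Hs Hsd. split; auto. exists x. apply H; auto.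
    rewrite Rminus_diag, Rabs_R0. exact Hd. }
  assert (HS0 : S 0).
  { split; [lra|]. destruct (well_init_zero _ _ _ _ Hu) as [x Hx]. exists x. lra. }
  destruct (well_filling _ _ _ _ n Hu (le_n n) (2 * PI * INR n - c) ltac:(lra)) as [T [HT HTc]].
  assert (HnT : ~ S T).
  { intros [_ [x Hx]]. specialize (HTc x). lra. }
  destruct (completeness S) as [tau [Hub Hlub]].
  { exists T. intros s [Hs [x Hx]]. apply Rnot_lt_le. intros Hlt.
    specialize (Hlater T HT HnT s Hlt x). lra. }
  { now exists 0. }
  assert (Hbelow : forall t, 0 <= t < tau -> S t).
  { intros t Ht. apply NNPP. intros Hn. assert (tau <= t); [|lra]. apply Hlub.
    intros s [Hs [x Hx]]. apply Rnot_lt_le. intros Hlt.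
    specialize (Hlater t ltac:(lra) Hn s Hlt x). lra. }
  assert (Htau0 : 0 <= tau) by now apply Hub.
  assert (HnS : ~ S tau).
  { intros HS. destruct (Hopen tau HS) as [d [Hd H]].
    assert (tau + d / 2 <= tau); [|lra]. apply Hub, H; [lra|].
    rewrite Rabs_right; lra. }
  assert (Hge : forall x, c <= u x tau).
  { intros x. apply Rnot_lt_le. intros Hlt. apply HnS. split; eauto. }
  assert (Htau : 0 < tau).
  { destruct Htau0 as [|<-]; auto. contradiction. }
  exists tau. split; auto. split; [|split; [|split]]; auto.
  - intros t Ht. now apply Hbelow.
  - apply NNPP. intros Hno.
    destruct (well_above_stable _ _ _ _ tau c Hu) as [d [Hd H]]; try lra.
    { intros x. destruct (Hge x) as [|He]; auto. exfalso. apply Hno. now exists x. }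
    set (e := Rmin tau d). assert (0 < e) by (apply Rmin_glb_lt; lra).
    assert (e <= tau) by apply Rmin_l. assert (e <= d) by apply Rmin_r.
    destruct (Hbelow (tau - e / 2) ltac:(lra)) as [_ [x Hx]].
    specialize (H (tau - e / 2) ltac:(lra)). rewrite Rabs_left in H by lra.
    specialize (H ltac:(lra) x). lra.
  - intros t Ht. now apply (Hlater tau).
Qed.

(** * Strict monotonicity of the flanks and the flow of the reaction *)

Definition minimizer (g : R -> R) (m : R) : Prop := forall x, g m <= g x.

Lemma well_minimizer f0 Theta0 n u t :
  well_solution f0 Theta0 n u -> 0 <= t -> exists m, minimizer (fun x => u x t) m.
Proof.
  intros Hu Ht. destruct (classic (exists x, u x t < 2 * PI * INR n)) as [[x0 H0]|Hno].
  - destruct (well_far _ _ _ _ t (2 * PI * INR n - u x0 t) Hu) as [r [Hr Hfar]]; [lra|].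
    destruct (segment_min (fun x => u x t) (- r) r) as [m [Hm Hmin]]; [lra| |].
    { intros y. apply continuous2_slice_x, Hu. }
    assert (Hout : forall x, r <= Rabs x -> u x0 t < u x t).
    { intros x Hx. specialize (Hfar x t ltac:(lra) Hx). lra. }
    assert (Hx0 : Rabs x0 < r).
    { apply Rnot_le_lt. intros Hx. specialize (Hout x0 Hx). lra. }
    exists m. intros x. destruct (Rle_lt_dec r (Rabs x)) as [Hx|Hx].
    + apply Rabs_def2 in Hx0. specialize (Hout x Hx). specialize (Hmin x0 ltac:(lra)). lra.
    + apply Rabs_def2 in Hx. apply Hmin. lra.
  - exists 0. intros x.
    assert (~ u x t < 2 * PI * INR n) by (intros H; apply Hno; eauto).
    assert (Hr := well_range _ _ _ _ 0 t Hu Ht). lra.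
Qed.

(** If u were constant on a segment of the left flank, take the leftmost such segment at that level.
    Near it and shortly before time t, the function u(x) - u(x + h) is nonnegative by
    quasiconvexity; it is positive at a point just before the segment and zero at
    a point of the segment, against the spreading of positivity. *)
Lemma no_flat_left_flank f0 Theta0 n u t x1 x2 y :
  well_solution f0 Theta0 n u -> 0 < t -> x1 < x2 < y ->
  u x1 t < 2 * PI * INR n -> u y t < u x2 t -> u x1 t <> u x2 t.
Proof.
  intros Hu Ht Hx HN Hy Heq. set (c := u x2 t) in *. rewrite Heq in HN.
  assert (Hqc : forall s, 0 <= s -> quasiconvex (fun x => u x s))
    by (intros s Hs; now apply (well_quasiconvex f0 Theta0 n)).
  assert (Hc := well_cont _ _ _ _ Hu).
  assert (Hge : forall x, x <= x2 -> c <= u x t).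
  { intros x Hxx. destruct (Hqc t ltac:(lra) x x2 y); [lra|auto|]. fold c in H. lra. }
  destruct (well_far_left _ _ _ _ t (2 * PI * INR n - c) Hu) as [r [Hr Hfar]]; [lra|].
  set (E := fun x => x <= x1 /\ c < u x t).
  destruct (completeness E) as [sig [Hub Hlub]].
  { exists x1. intros x Hxx. apply Hxx. }
  { exists (Rmin (- r) x1). split; [apply Rmin_r|].
    specialize (Hfar (Rmin (- r) x1) t ltac:(lra) (Rmin_l _ _)). lra. }
  assert (Hsig : sig <= x1) by (apply Hlub; intros x Hxx; apply Hxx).
  assert (Hleft : forall x, x < sig -> c < u x t).
  { intros x Hxs. apply NNPP. intros Hn. assert (sig <= x); [|lra].
    apply Hlub. intros w [Hw1 Hw2]. apply Rnot_lt_le. intros Hxw. apply Hn.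
    destruct (Hqc t ltac:(lra) x w y); [lra|lra|]. lra. }
  assert (Hflat : forall x, sig < x <= x2 -> u x t = c).
  { intros x Hxs. apply Rle_antisym; [|apply Hge; lra].
    destruct (Rle_lt_dec x x1) as [Hx1|Hx1].
    - apply Rnot_lt_le. intros Hlt. assert (x <= sig); [|lra]. apply Hub. now split.
    - destruct (Hqc t ltac:(lra) x1 x y); lra. }
  (* sig starts the plateau; sig - h / 2 is before it and reaches it after a shift by h,
     whereas sig + h / 2 and its shift both lie on it. *)
  set (h := (x2 - sig) / 3). assert (Hh : 0 < h) by (unfold h; lra).
  assert (H3h : sig + 3 * h = x2) by (unfold h; lra).
  set (mid := (c + u y t) / 2).
  destruct (tube u (sig - h / 2) x2 t mid Hc) as [d1 [Hd1 H1]].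
  { intros x Hxx. specialize (Hge x ltac:(lra)). unfold mid. lra. }
  destruct (continuous2_lt u y t mid Hc) as [d2 [Hd2 H2]]; [unfold mid; lra|].
  set (w := fun x t => u x t - u (x + h) t).
  assert (Hw : continuous2 w) by (apply continuous2_minus; [|apply continuous2_translate]; auto).
  destruct (continuous2_gt w (sig - h / 2) t 0 Hw) as [d3 [Hd3 H3]].
  { unfold w. rewrite (Hflat (sig - h / 2 + h)) by lra.
    specialize (Hleft (sig - h / 2) ltac:(lra)). lra. }
  set (eta := Rmin (Rmin d1 d2) (Rmin d3 t)).
  assert (Heta : 0 < eta) by (repeat apply Rmin_glb_lt; lra).
  assert (He1 : eta <= d1) by (apply Rle_trans with (2 := Rmin_l d1 d2), Rmin_l).
  assert (He2 : eta <= d2) by (apply Rle_trans with (2 := Rmin_r d1 d2), Rmin_l).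
  assert (He3 : eta <= d3) by (apply Rle_trans with (2 := Rmin_l d3 t), Rmin_r).
  assert (He4 : eta <= t) by (apply Rle_trans with (2 := Rmin_r d3 t), Rmin_r).
  assert (Hnear : forall s, t - eta / 2 <= s <= t -> Rabs (s - t) < eta).
  { intros s Hs. apply Rabs_def1; lra. }
  assert (0 < w (sig + h / 2) t).
  { apply (spreading_positivity w (sig - h / 2) (sig + h) (t - eta / 2) t 1); try lra; auto.
    - intros x s Hxx Hs. unfold w. specialize (Hnear s Hs).
      assert (u (x + h) s <= u x s); [|lra].
      destruct (Hqc s ltac:(lra) x (x + h) y) as [H|H]; [lra|exact H|].
      specialize (H1 (x + h) s ltac:(lra) ltac:(lra)).
      specialize (H2 y s ltac:(rewrite Rminus_diag, Rabs_R0; lra) ltac:(lra)). lra.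
    - intros s Hs. specialize (Hnear s Hs). apply H3; [|lra].
      rewrite Rminus_diag, Rabs_R0. lra.
    - intros x s Hxx Hs. specialize (Hnear s ltac:(lra)).
      exists (reaction f0 Theta0 (u x s) - reaction f0 Theta0 (u (x + h) s)). split.
      + apply heat_minus; [|apply (heat_translate u h)]; apply Hu; lra.
      + assert (u (x + h) s <= u x s).
        { destruct (Hqc s ltac:(lra) x (x + h) y) as [H|H]; [lra|exact H|].
          specialize (H1 (x + h) s ltac:(lra) ltac:(lra)).
          specialize (H2 y s ltac:(rewrite Rminus_diag, Rabs_R0; lra) ltac:(lra)). lra. }
        assert (H' := reaction_lower f0 Theta0 (u (x + h) s) (u x s) H). unfold w. lra. }
  unfold w in H. rewrite (Hflat (sig + h / 2)), (Hflat (sig + h / 2 + h)) in H; lra.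
Qed.

(** The equation theta' = f(theta) is a Riccati equation for tan((theta + Theta0) / 2), with rest points
    - tan(Theta0 / 2) and tan(Theta0 / 2); this is the explicit orbit joining them. *)
Lemma reaction_flow f0 Theta0 (j : nat) v s0 :
  admissible f0 Theta0 -> 2 * PI * INR j - 2 * Theta0 < v < 2 * PI * INR j ->
  exists theta : R -> R, theta s0 = v /\
    (forall t, is_derive theta t (reaction f0 Theta0 (theta t))) /\
    (forall t, theta t < 2 * PI * INR j).
Proof.
  intros Had Hv. assert (HT : 0 < Theta0 < PI) by apply Had.
  assert (HPI := PI_RGT_0).
  set (Y := tan (Theta0 / 2)).
  assert (HaY : atan Y = Theta0 / 2) by (apply atan_tan; lra).
  assert (HY : 0 < Y) by (apply tan_gt_0; lra).
  assert (Hsin : sin Theta0 = 2 * Y / (1 + Y ^ 2)).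
  { rewrite <- sin_2atan, HaY. f_equal. field. }
  assert (Hcos : f0 = - ((1 - Y ^ 2) / (1 + Y ^ 2))).
  { rewrite <- cos_2atan, HaY. replace (2 * (Theta0 / 2)) with Theta0 by field.
    destruct Had as (_ & _ & ->). ring. }
  set (a0 := (v - 2 * PI * INR j + Theta0) / 2). set (y0 := tan a0).
  assert (Hay : atan y0 = a0) by (apply atan_tan; unfold a0; lra).
  assert (HyY : y0 < Y) by (apply tan_increasing; unfold a0; lra).
  assert (HyY' : - Y < y0).
  { unfold Y. rewrite <- tan_neg. apply tan_increasing; unfold a0; lra. }
  (* B fixes the value at s0: (B - 1) / (B + 1) = y0 / Y. *)
  set (B := (Y + y0) / (Y - y0)). assert (HB : 0 < B) by (apply Rdiv_lt_0_compat; lra).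
  set (E := fun t => B * exp (sin Theta0 * (t - s0))).
  assert (HE : forall t, 0 < E t).
  { intros t. apply Rmult_lt_0_compat; auto. apply exp_pos. }
  assert (HdE : forall t, is_derive E t (sin Theta0 * E t)).
  { intros t. unfold E. auto_derive; auto. unfold Rminus. ring. }
  assert (HE0 : E s0 = B).
  { unfold E. rewrite Rminus_diag, Rmult_0_r, exp_0. ring. }
  clearbody E.
  set (y := fun t => Y * ((E t - 1) / (E t + 1))).
  exists (fun t => 2 * PI * INR j - Theta0 + 2 * atan (y t)). split; [|split].
  - assert (y s0 = y0).
    { unfold y. rewrite HE0. unfold B. field. lra. }
    rewrite H, Hay. unfold a0. field.
  - intros t. specialize (HE t).
    assert (Hf : reaction f0 Theta0 (2 * PI * INR j - Theta0 + 2 * atan (y t))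
      = (1 - y t ^ 2) / (1 + y t ^ 2) - (1 - Y ^ 2) / (1 + Y ^ 2)).
    { unfold reaction.
      replace (2 * PI * INR j - Theta0 + 2 * atan (y t) + Theta0)
        with (2 * atan (y t) + 2 * INR j * PI) by ring.
      rewrite cos_period, cos_2atan, Hcos at 1. ring. }
    rewrite Hf. unfold y.
    assert (HexE : ex_derive E t) by (eexists; apply HdE).
    auto_derive.
    + split; auto. split; auto. lra.
    + replace (Derive (fun x : R => E x) t) with (sin Theta0 * E t)
        by (symmetry; apply is_derive_unique, HdE).
      rewrite Hsin. field. repeat split; [nra|lra|].
      assert (0 < (E t + 1) ^ 2) by (apply pow_lt; lra).
      assert (0 <= (Y * (E t - 1)) ^ 2) by apply pow2_ge_0. lra.
  - intros t. specialize (HE t).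
    assert (y t < Y).
    { unfold y. assert ((E t - 1) / (E t + 1) < 1).
      { apply Rmult_lt_reg_r with (E t + 1); [lra|].
        replace ((E t - 1) / (E t + 1) * (E t + 1)) with (E t - 1) by (field; lra). lra. }
      assert (Y * ((E t - 1) / (E t + 1)) < Y * 1) by (apply Rmult_lt_compat_l; lra). lra. }
    assert (Ha := atan_increasing _ _ H). rewrite HaY in Ha. lra.
Qed.

(** On a plateau u_xx = 0, so u moves there as the reaction alone dictates. *)
Lemma heat_at_plateau u x t l d :
  heat_at u x t l -> 0 < d -> (forall y, Rabs (y - x) < d -> u y t = u x t) ->
  is_derive (fun s => u x s) t l.
Proof.
  intros (zt & zx & zxx & H1 & H2 & H3 & ->) Hd Hflat.
  assert (zxx <= 0).
  { apply (derive2_local_max (fun y => u y t) zx x zxx d); auto.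
    intros y Hy. rewrite (Hflat y Hy). lra. }
  assert (- zxx <= 0).
  { apply (derive2_local_max (fun y => - u y t) (fun y => - zx y) x (- zxx) d); auto.
    - intros y. apply (is_derive_opp (fun y => u y t) y (zx y) (H2 y)).
    - apply (is_derive_opp zx x zxx H3).
    - intros y Hy. rewrite (Hflat y Hy). lra. }
  replace (zt - zxx) with zt by lra. exact H1.
Qed.

(** If u had a flat bottom during a whole interval of time, then u_xx would vanish there and the minimum would
    follow the flow theta' = f(theta) exactly. But u starts above this flow and is strictly
    above it afterwards, as the sides of the well pull it up. *)
Lemma single_minimizer_instant f0 Theta0 n u (j : nat) s0 t1 m :
  well_solution f0 Theta0 n u -> (j <= n)%nat -> 0 < s0 < t1 ->
  minimizer (fun x => u x s0) m ->
  2 * PI * INR j - 2 * Theta0 < u m s0 < 2 * PI * INR j ->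
  exists s, s0 <= s < t1 /\
    forall p q, p < q -> minimizer (fun x => u x s) p -> ~ minimizer (fun x => u x s) q.
Proof.
  intros Hu Hj Ht Hm Hv. apply NNPP. intros Hno.
  assert (Hflat : forall s, s0 <= s < t1 -> exists p q, p < q /\ minimizer (fun x => u x s) p /\ minimizer (fun x => u x s) q).
  { intros s Hs. apply NNPP. intros Hn. apply Hno. exists s. split; auto.
    intros p q Hpq Hp Hq. apply Hn. now exists p, q. }
  clear Hno.
  assert (Hcont := well_cont _ _ _ _ Hu).
  destruct (reaction_flow f0 Theta0 j (u m s0) s0 (well_admissible _ _ _ _ Hu) Hv)
    as (theta & Hth0 & Hdth & Hthb).
  assert (HthN : forall t, theta t < 2 * PI * INR n).
  { intros t. apply Rlt_le_trans with (1 := Hthb t).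
    apply Rmult_le_compat_l; [assert (H := PI_RGT_0); lra|]. now apply le_INR. }
  destruct (segment_max theta s0 t1) as [tm [Htm Hmax]]; [lra| |].
  { intros x. eapply is_derive_continuous, Hdth. }
  assert (Habove : forall x, theta t1 < u x t1).
  { apply (well_above_subsolution f0 Theta0 n u theta
      (fun t => reaction f0 Theta0 (theta t)) s0 t1 (theta tm)); auto; try lra.
    - intros; lra.
    - intros x. rewrite Hth0. apply Hm. }
  destruct (well_minimizer _ _ _ _ t1 Hu ltac:(lra)) as [m1 Hm1].
  set (rho := u m1 t1 - theta t1).
  assert (Hrho : 0 < rho) by (specialize (Habove m1); unfold rho; lra).
  (* The strict supersolution up exceeds theta by only rho / 2 at time t1. *)
  set (del := rho / 2 * exp (- (2 * (t1 - s0)))).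
  assert (Hdel : 0 < del) by (apply Rmult_lt_0_compat; [lra|apply exp_pos]).
  set (up := fun t => theta t + del * exp (2 * (t - s0))).
  assert (Hpen : forall t, 0 < del * exp (2 * (t - s0))).
  { intros t. apply Rmult_lt_0_compat; auto. apply exp_pos. }
  assert (Hdup : forall t, is_derive up t
     (reaction f0 Theta0 (theta t) + 2 * (del * exp (2 * (t - s0))))).
  { intros t. apply (is_derive_plus theta (fun t => del * exp (2 * (t - s0)))).
    - apply Hdth.
    - auto_derive; auto. unfold Rminus. ring. }
  assert (Hcup : forall t, continuous up t).
  { intros t. eapply is_derive_continuous, Hdup. }
  assert (Hreach : exists x, u x t1 <= up t1).
  { apply (real_induction s0 t1 (fun t => exists x, u x t <= up t)); [lra| | |].
    - exists m. unfold up. rewrite Hth0. specialize (Hpen s0). lra.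
    - intros s Hs [x Hx]. destruct (Hflat s Hs) as (p & q & Hpq & Hp & Hq).
      set (c := (p + q) / 2).
      assert (Hmid : forall y, p <= y <= q -> u y s = u p s).
      { intros y Hy. apply Rle_antisym; [|apply Hp].
        destruct (well_quasiconvex _ _ _ _ s Hu ltac:(lra) p y q Hy) as [H|H]; auto.
        apply Rle_trans with (1 := H). apply Hq. }
      assert (Hcx : u c s <= up s).
      { rewrite Hmid by (unfold c; lra). specialize (Hp x). cbv beta in Hp. lra. }
      destruct Hcx as [Hlt|Heq].
      + destruct (continuous2_gt (fun x t => up t - u x t) c s 0) as [d [Hd H]].
        { apply continuous2_minus; auto. apply (continuous2_lift up (fun _ t => t)); auto.
          apply continuous2_snd. } { lra. }
        exists d. split; auto. intros s' Hs' _. exists c.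
        specialize (H c s'). rewrite Rminus_diag, Rabs_R0, Rabs_right in H by lra.
        specialize (H Hd ltac:(lra)). lra.
      + destruct (derive_pos_increasing (fun t => up t - u c t) s
          (reaction f0 Theta0 (theta s) + 2 * (del * exp (2 * (s - s0)))
            - reaction f0 Theta0 (u c s))) as [d [Hd [H _]]].
        * apply (is_derive_minus up (fun t => u c t)); [apply Hdup|].
          apply (heat_at_plateau u c s _ ((q - p) / 2)); [apply Hu; lra|lra|].
          intros y Hy. apply Rabs_def2 in Hy. unfold c in *. rewrite (Hmid y), (Hmid ((p + q) / 2)); lra.
        * rewrite Heq. unfold up. specialize (Hpen s).
          assert (H := reaction_upper f0 Theta0 (theta s)
            (theta s + del * exp (2 * (s - s0))) ltac:(lra)). lra.
        * exists d. split; auto. intros s' Hs' _. exists c.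
          specialize (H s' Hs'). rewrite Heq in H. lra.
    - intros s Hs Hbefore. apply NNPP. intros Hn.
      destruct (well_minimizer _ _ _ _ s Hu ltac:(lra)) as [ms Hms].
      assert (Hgap : up s < u ms s) by (apply Rnot_le_lt; intros H; apply Hn; now exists ms).
      set (c := (up s + u ms s) / 2).
      assert (Hr := well_range _ _ _ _ ms s Hu ltac:(lra)).
      destruct (well_above_stable _ _ _ _ s c Hu) as [d [Hd H]]; [unfold c; lra|lra| |].
      { intros x. specialize (Hms x). cbv beta in Hms. unfold c. lra. }
      destruct (continuous2_lt (fun _ t => up t) 0 s c) as [e [He H']].
      { apply (continuous2_lift up (fun _ t => t)); auto. apply continuous2_snd. }
      { unfold c. lra. }
      set (b := Rmin (Rmin d e) (s - s0)).
      assert (Hb : 0 < b) by (repeat apply Rmin_glb_lt; lra).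
      assert (Hb1 : b <= d) by (apply Rle_trans with (2 := Rmin_l d e), Rmin_l).
      assert (Hb2 : b <= e) by (apply Rle_trans with (2 := Rmin_r d e), Rmin_l).
      assert (Hb3 : b <= s - s0) by apply Rmin_r.
      assert (Habs : Rabs (s - b / 2 - s) < b) by (rewrite Rabs_left; lra).
      destruct (Hbefore (s - b / 2) ltac:(lra)) as [x Hx].
      specialize (H (s - b / 2) ltac:(lra) ltac:(lra) x).
      specialize (H' 0 (s - b / 2)). rewrite Rminus_diag, Rabs_R0 in H'.
      specialize (H' He ltac:(lra)). lra. }
  destruct Hreach as [x Hx]. specialize (Hm1 x). cbv beta in Hm1.
  assert (Hend : up t1 = theta t1 + rho / 2).
  { unfold up, del. rewrite Rmult_assoc, <- exp_plus, Rplus_opp_l, exp_0. ring. }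
  unfold rho in *. lra.
Qed.

(** * Uniqueness of the bottom point *)

(** A rational bump is enough: its support is the whole line, but a failure of
    quasiconvexity that it causes needs a variation of at least 1/2, hence a point near m. *)
Definition bump (a m x : R) : R := / (1 + a * (x - m) ^ 2).

Lemma bump_range a m x : 0 < a -> 0 < bump a m x <= 1.
Proof.
  intros Ha. unfold bump. assert (0 <= a * (x - m) ^ 2).
  { apply Rmult_le_pos; [lra|apply pow2_ge_0]. }
  split; [apply Rinv_0_lt_compat; lra|].
  rewrite <- Rinv_1. apply Rinv_le_contravar; lra.
Qed.

Lemma bump_heat a m : 0 < a ->
  exists g : R -> R, (forall x t, heat_at (fun x _ => bump a m x) x t (g x)) /\
    (forall x, Rabs (g x) <= 6 * a).
Proof.
  intros Ha.
  set (D := fun x => 1 + a * (x - m) ^ 2).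
  assert (HD : forall x, 1 <= D x).
  { intros x. unfold D. assert (0 <= a * (x - m) ^ 2)
      by (apply Rmult_le_pos; [lra|apply pow2_ge_0]). lra. }
  exists (fun x => - (2 * a * (3 * (D x - 1) - 1) / (D x) ^ 3)). split.
  - intros x t. apply (heat_space _ (fun x => - (2 * a * (x - m)) / (D x) ^ 2)).
    + intros y. specialize (HD y). unfold bump, D in *. auto_derive.
      * lra.
      * field. lra.
    + specialize (HD x). unfold D in *. auto_derive.
      * apply Rgt_not_eq. repeat apply Rmult_lt_0_compat; lra.
      * field. lra.
  - intros x. specialize (HD x). rewrite Rabs_Ropp.
    assert (Hp : D x <= D x ^ 3).
    { replace (D x ^ 3) with (D x * (D x * D x)) by ring.
      rewrite <- (Rmult_1_r (D x)) at 1. apply Rmult_le_compat_l; nra. }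
    apply Rabs_le. split; apply Rmult_le_reg_r with (D x ^ 3); try lra.
    + replace (2 * a * (3 * (D x - 1) - 1) / D x ^ 3 * D x ^ 3)
        with (2 * a * (3 * (D x - 1) - 1)) by (field; lra).
      assert (a * 1 <= a * D x ^ 3) by (apply Rmult_le_compat_l; lra).
      assert (a * 1 <= a * D x) by (apply Rmult_le_compat_l; lra). lra.
    + replace (2 * a * (3 * (D x - 1) - 1) / D x ^ 3 * D x ^ 3)
        with (2 * a * (3 * (D x - 1) - 1)) by (field; lra).
      assert (a * D x <= a * D x ^ 3) by (apply Rmult_le_compat_l; lra). lra.
Qed.

Lemma bump_lipschitz a m x y : 0 < a ->
  Rabs (bump a m x - bump a m y) <= (1 + a) * Rabs (x - y).
Proof.
  intros Ha.
  assert (HD : forall x, 1 <= 1 + a * (x - m) ^ 2).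
  { intros v. assert (0 <= a * (v - m) ^ 2)
      by (apply Rmult_le_pos; [lra|apply pow2_ge_0]). lra. }
  destruct (MVT_gen (bump a m) y x (fun x => - (2 * a * (x - m)) / (1 + a * (x - m) ^ 2) ^ 2))
    as [c [_ Hc]].
  - intros v _. specialize (HD v). unfold bump. auto_derive; [lra|field; lra].
  - intros v _. specialize (HD v). apply continuity_pt_filterlim.
    apply (ex_derive_continuous (bump a m)). unfold bump. auto_derive. lra.
  - rewrite Hc, Rabs_mult. apply Rmult_le_compat_r; [apply Rabs_pos|].
    specialize (HD c). set (w := c - m) in *. set (d := 1 + a * w ^ 2) in *.
    assert (Hd2 : d <= d ^ 2) by (simpl; nra).
    assert (Hsq1 : 0 <= (1 - a * w) ^ 2) by apply pow2_ge_0.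
    assert (Hsq2 : 0 <= (1 + a * w) ^ 2) by apply pow2_ge_0.
    assert (Hk : (1 + a) * d = 1 + a * a * w ^ 2 + (a + a * w ^ 2)) by (unfold d; ring).
    assert (0 <= a * w ^ 2) by (unfold d in HD; lra).
    assert (Hk2 : (1 + a) * d <= (1 + a) * d ^ 2) by (apply Rmult_le_compat_l; lra).
    apply Rabs_le. split; apply Rmult_le_reg_r with (d ^ 2); try lra;
      replace (- (2 * a * w) / d ^ 2 * d ^ 2) with (- (2 * a * w)) by (field; lra); lra.
Qed.

(** The flank is strictly decreasing, hence decreases by a uniform amount over
    a fixed distance d on a compact set of points. *)
Lemma left_flank_gap f0 Theta0 n u s m p q d :
  well_solution f0 Theta0 n u -> 0 < s -> 0 < d ->
  (forall x, x <> m -> u m s < u x s) ->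
  (forall x, p <= x <= q -> u x s < 2 * PI * INR n) ->
  exists del, 0 < del /\
    forall x, p <= x <= q -> x <= m -> del <= u (x - d) s - u x s.
Proof.
  intros Hu Hs Hd Hm HN.
  assert (Hpos : forall x, p <= x <= q -> x <= m -> 0 < u (x - d) s - u x s).
  { intros x Hx Hxm. destruct (Req_dec x m) as [->|Hne].
    - specialize (Hm (m - d) ltac:(lra)). lra.
    - assert (Hmx := Hm x Hne).
      destruct (well_quasiconvex _ _ _ _ s Hu ltac:(lra) (x - d) x m) as [H|H]; [lra| |lra].
      assert (u (x - d) s <> u x s); [|lra].
      intros He. apply (no_flat_left_flank f0 Theta0 n u s (x - d) x m); auto; try lra.
      rewrite He. now apply HN. }
  destruct (Rle_lt_dec p (Rmin q m)) as [Hp|Hp].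
  - destruct (segment_min (fun x => u (x + - d) s - u x s) p (Rmin q m) Hp) as [x [Hx Hmin]].
    { intros x. assert (Hc := well_cont _ _ _ _ Hu).
      apply (continuous_minus (fun x => u (x + - d) s) (fun x => u x s)).
      - apply (continuous2_slice_x (fun x t => u (x + - d) t)).
        now apply continuous2_translate.
      - now apply continuous2_slice_x. }
    assert (Rmin q m <= q) by apply Rmin_l. assert (Rmin q m <= m) by apply Rmin_r.
    exists (u (x + - d) s - u x s). split.
    + apply Hpos; lra.
    + intros y Hy Hym. apply Hmin. split; [lra|]. apply Rmin_glb; lra.
  - exists 1. split; [lra|]. intros x Hx Hxm.
    assert (x <= Rmin q m) by (apply Rmin_glb; lra). lra.
Qed.

Lemma right_flank_gap f0 Theta0 n u s m p q d :
  well_solution f0 Theta0 n u -> 0 < s -> 0 < d ->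
  (forall x, x <> m -> u m s < u x s) ->
  (forall x, p <= x <= q -> u x s < 2 * PI * INR n) ->
  exists del, 0 < del /\
    forall x, p <= x <= q -> m <= x -> del <= u (x + d) s - u x s.
Proof.
  intros Hu Hs Hd Hm HN.
  destruct (left_flank_gap _ _ _ _ s (- m) (- q) (- p) d (well_reflect _ _ _ _ Hu))
    as [del [Hdel H]]; auto.
  - intros x Hx. rewrite Ropp_involutive. apply Hm. lra.
  - intros x Hx. apply HN. lra.
  - exists del. split; auto. intros x Hx Hxm. specialize (H (- x) ltac:(lra) ltac:(lra)).
    rewrite Ropp_involutive in H. replace (- (- x - d)) with (x + d) in H by ring. exact H.
Qed.

(** A flat bottom [p, q] at time T forces a flat bottom at all slightly earlier times.
    Adding a bump of arbitrarily small height e to u breaks quasiconvexity at time T by 3 e / 4,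
    and the three-point principle carries a failure of size e / 2 back to time s, where s does not
    depend on e. If the bottom at time s were a single point, the flanks would drop by a
    definite amount over the distance d that the bump needs to vary by 1/2, and a small
    enough e could not produce such a failure. *)
Lemma flat_minimum_persists_backwards f0 Theta0 n u T p q :
  well_solution f0 Theta0 n u -> 0 < T -> p < q ->
  minimizer (fun x => u x T) p -> minimizer (fun x => u x T) q ->
  u p T < 2 * PI * INR n ->
  exists s0, 0 < s0 < T /\ forall s m, s0 <= s < T ->
    minimizer (fun x => u x s) m -> exists x, x <> m /\ u x s <= u m s.
Proof.
  intros Hu HT Hpq Hp Hq HN.
  set (N := 2 * PI * INR n) in *. set (c := u p T) in *.
  assert (Hcont := well_cont _ _ _ _ Hu).
  assert (Hflat : forall x, p <= x <= q -> u x T = c).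
  { intros x Hx. apply Rle_antisym; [|apply Hp].
    destruct (well_quasiconvex _ _ _ _ T Hu ltac:(lra) p x q Hx) as [H|H]; auto.
    apply Rle_trans with (1 := H). apply Hq. }
  (* With this a the bump is 1 at the middle and 1/4 at both ends of the plateau. *)
  set (mid := (p + q) / 2). set (a := 12 / (q - p) ^ 2).
  assert (Hqp : 0 < (q - p) ^ 2) by (apply pow_lt; lra).
  assert (Ha : 0 < a) by (apply Rdiv_lt_0_compat; lra).
  assert (Hbmid : bump a mid mid = 1).
  { unfold bump. rewrite Rminus_diag. replace (1 + a * 0 ^ 2) with 1 by ring. apply Rinv_1. }
  assert (Hbp : bump a mid p = / 4).
  { unfold bump, a, mid. f_equal. field. lra. }
  assert (Hbq : bump a mid q = / 4).
  { unfold bump, a, mid. f_equal. field. lra. }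
  assert (Hb0 : forall x, 0 < bump a mid x <= 1) by (intros x; now apply bump_range).
  assert (Hbin : forall x, / 4 < bump a mid x -> p <= x <= q).
  { intros x Hx.
    assert (a * (x - mid) ^ 2 < 3).
    { assert (0 <= a * (x - mid) ^ 2) by (apply Rmult_le_pos; [lra|apply pow2_ge_0]).
      apply Rnot_le_lt. intros H3. assert (bump a mid x <= / 4); [|lra].
      apply Rinv_le_contravar; lra. }
    assert ((x - mid) ^ 2 < ((q - p) / 2) ^ 2).
    { apply Rmult_lt_reg_l with a; auto.
      replace (a * ((q - p) / 2) ^ 2) with 3 by (unfold a; field; lra). exact H. }
    assert (Habs : Rabs (x - mid) < Rabs ((q - p) / 2)).
    { apply Rsqr_lt_abs_0. unfold Rsqr. lra. }
    rewrite (Rabs_right ((q - p) / 2)) in Habs by lra.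
    apply Rabs_def2 in Habs. unfold mid in Habs. lra. }
  destruct (bump_heat a mid Ha) as [g [Hg Hgb]].
  (* A difference of at least e / 2 bounds e, hence also the error terms of the bump: 3
     from the reaction and 24 a from the second derivative. *)
  set (K := 3 + 24 * a).
  set (d := / (2 * (1 + a))). assert (Hd : 0 < d) by (apply Rinv_0_lt_compat; lra).
  assert (Hbd : forall x y, / 2 <= bump a mid x - bump a mid y -> d <= Rabs (x - y)).
  { intros x y H. assert (HL := bump_lipschitz a mid x y Ha).
    rewrite Rabs_right in HL by lra.
    apply Rmult_le_reg_l with (1 + a); [lra|].
    replace ((1 + a) * d) with (/ 2) by (unfold d; field; lra). lra. }
  destruct (tube (fun x t => - u x t) p q T (- ((c + N) / 2))) as [d1 [Hd1 Htube]].
  { now apply continuous2_opp. }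
  { intros x Hx. rewrite Hflat; lra. }
  assert (Hln : 0 < ln (3 / 2)) by (rewrite <- ln_1; apply ln_increasing; lra).
  assert (HKp : 0 < K + 1) by (unfold K; lra).
  assert (HlnK : 0 < ln (3 / 2) / (K + 1)) by now apply Rdiv_lt_0_compat.
  set (w := Rmin (Rmin d1 T) (ln (3 / 2) / (K + 1)) / 2).
  assert (Hw : 0 < w).
  { unfold w. assert (0 < Rmin (Rmin d1 T) (ln (3 / 2) / (K + 1)))
      by (repeat apply Rmin_glb_lt; lra). lra. }
  assert (Hw1 : 2 * w <= Rmin d1 T).
  { replace (2 * w) with (Rmin (Rmin d1 T) (ln (3 / 2) / (K + 1))) by (unfold w; field).
    apply Rmin_l. }
  assert (Hw2 : 2 * w <= d1) by (apply Rle_trans with (1 := Hw1), Rmin_l).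
  assert (Hw3 : 2 * w <= T) by (apply Rle_trans with (1 := Hw1), Rmin_r).
  assert (Hw4 : 2 * w <= ln (3 / 2) / (K + 1)).
  { replace (2 * w) with (Rmin (Rmin d1 T) (ln (3 / 2) / (K + 1))) by (unfold w; field).
    apply Rmin_r. }
  exists (T - w). split; [lra|]. intros s m Hs Hm. apply NNPP. intros Hno.
  assert (Huniq : forall x, x <> m -> u m s < u x s).
  { intros x Hx. apply Rnot_le_lt. intros H. apply Hno. now exists x. }
  assert (Hupper : forall x t, p <= x <= q -> s <= t <= T -> u x t < (c + N) / 2).
  { intros x t Hx Ht. specialize (Htube x t Hx).
    assert (Rabs (t - T) < d1) by (apply Rabs_def1; lra). specialize (Htube H). lra. }
  destruct (left_flank_gap f0 Theta0 n u s m p q d Hu) as [l1 [Hl1 Hgap1]]; auto; [lra| |].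
  { intros x Hx. specialize (Hupper x s Hx ltac:(lra)). fold N. lra. }
  destruct (right_flank_gap f0 Theta0 n u s m p q d Hu) as [l2 [Hl2 Hgap2]]; auto; [lra| |].
  { intros x Hx. specialize (Hupper x s Hx ltac:(lra)). fold N. lra. }
  (* Below the gaps of both flanks, and small enough for u + e to stay below N on [p, q]. *)
  set (e := Rmin (Rmin l1 l2) ((N - c) / 2)).
  assert (He : 0 < e) by (repeat apply Rmin_glb_lt; lra).
  assert (He1 : e <= l1) by (apply Rle_trans with (2 := Rmin_l l1 l2), Rmin_l).
  assert (He2 : e <= l2) by (apply Rle_trans with (2 := Rmin_r l1 l2), Rmin_l).
  assert (He3 : e <= (N - c) / 2) by apply Rmin_r.
  set (z := fun x t => u x t + e * bump a mid x).
  destruct (well_far _ _ _ _ T (e / 4) Hu ltac:(lra)) as [r [Hr Hfar]]. fold N in Hfar.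
  assert (Hgrow : e / 2 * exp ((K + 1) * (T - s)) <= 3 / 4 * e).
  { assert (exp ((K + 1) * (T - s)) <= 3 / 2).
    { rewrite <- (exp_ln (3 / 2)) by lra. left. apply exp_increasing.
      assert ((K + 1) * (T - s) <= (K + 1) * w) by (apply Rmult_le_compat_l; lra).
      assert ((K + 1) * (2 * w) <= (K + 1) * (ln (3 / 2) / (K + 1)))
        by (apply Rmult_le_compat_l; lra).
      replace ((K + 1) * (ln (3 / 2) / (K + 1))) with (ln (3 / 2)) in * by (field; lra). lra. }
    assert (e / 2 * exp ((K + 1) * (T - s)) <= e / 2 * (3 / 2))
      by (apply Rmult_le_compat_l; lra). lra. }
  destruct (three_point_principle z (fun x t => reaction f0 Theta0 (u x t) + e * g x)
      s T K (e / 2) r) with (a := p) (x := mid) (b := q)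
    as (y1 & y & y2 & Hord & H1 & H2); try (unfold K; lra).
  - unfold z. apply continuous2_plus; auto. apply continuous2_mult; [apply continuous2_const|].
    apply (continuous2_lift (bump a mid) (fun x _ => x)).
    + intros x. apply (ex_derive_continuous (bump a mid)). unfold bump. auto_derive.
      assert (0 <= a * (x - mid) ^ 2) by (apply Rmult_le_pos; [lra|apply pow2_ge_0]).
      unfold Rminus in *. lra.
    + apply continuous2_fst.
  - intros x t Ht. apply heat_plus; [apply Hu; lra|]. apply (heat_scal e (fun x _ => bump a mid x)), Hg.
  - intros x x' t Ht Hz. unfold z in *.
    assert (Hr1 := reaction_lipschitz f0 Theta0 (u x t) (u x' t)).
    assert (Hr2 := Rle_abs (reaction f0 Theta0 (u x t) - reaction f0 Theta0 (u x' t))).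
    assert (B1 := Hb0 x). assert (B2 := Hb0 x').
    assert (Heb : - e <= e * (bump a mid x - bump a mid x') <= e).
    { split.
      - assert (e * (-1) <= e * (bump a mid x - bump a mid x')) by (apply Rmult_le_compat_l; lra). lra.
      - assert (e * (bump a mid x - bump a mid x') <= e * 1) by (apply Rmult_le_compat_l; lra). lra. }
    assert (Hu1 : Rabs (u x t - u x' t)
       <= 3 * (u x t + e * bump a mid x - (u x' t + e * bump a mid x'))).
    { apply Rabs_le. lra. }
    assert (G1 := Hgb x). assert (G2 := Hgb x').
    apply Rabs_le_between in G1. apply Rabs_le_between in G2.
    assert (e * (g x - g x') <= e * (12 * a)) by (apply Rmult_le_compat_l; lra).
    assert (12 * a * e <= 12 * a * (2 * (u x t + e * bump a mid x - (u x' t + e * bump a mid x'))))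
      by (apply Rmult_le_compat_l; lra).
    unfold K. lra.
  - intros x1 x x2 t Ht Hx Hx1 Hx2.
    assert (Hnear : forall y, e / 2 <= z x t - z y t -> u y t <= N - e / 4).
    { intros v Hv. unfold z in Hv.
      assert (Bx := Hb0 x). assert (Bv := Hb0 v).
      assert (Hebv : 0 < e * bump a mid v) by (apply Rmult_lt_0_compat; lra).
      destruct (Rle_lt_dec (bump a mid x) (/ 4)) as [Hb|Hb].
      - assert (Hrx := well_range _ _ _ _ x t Hu ltac:(lra)). fold N in Hrx.
        assert (e * bump a mid x <= e * / 4) by (apply Rmult_le_compat_l; lra). lra.
      - specialize (Hupper x t (Hbin x Hb) Ht).
        assert (e * bump a mid x <= e * 1) by (apply Rmult_le_compat_l; lra). lra. }
    split; apply Rnot_le_lt; intros Hle.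
    + specialize (Hfar x1 t ltac:(lra)). rewrite Rabs_left1 in Hfar by lra.
      specialize (Hfar ltac:(lra)). specialize (Hnear x1 Hx1). lra.
    + specialize (Hfar x2 t ltac:(lra)). rewrite Rabs_right in Hfar by lra.
      specialize (Hfar ltac:(lra)). specialize (Hnear x2 Hx2). lra.
  - unfold mid. lra.
  - unfold z. rewrite (Hflat mid), (Hflat p), Hbmid, Hbp by (unfold mid; lra). lra.
  - unfold z. rewrite (Hflat mid), (Hflat q), Hbmid, Hbq by (unfold mid; lra). lra.
  - assert (Hqc : quasiconvex (fun x => u x s)) by (apply (well_quasiconvex f0 Theta0 n); auto; lra).
    assert (Hfin : forall v l, u y s <= u v s -> e / 2 <= z y s - z v s -> e <= l ->
       (p <= y <= q -> d <= Rabs (y - v) -> u v s < u y s + l -> False) -> False).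
    { intros v l Hv Hz Hl Hc. unfold z in Hz.
      assert (B1 := Hb0 y). assert (B2 := Hb0 v).
      assert (Heb : e * / 2 <= e * (bump a mid y - bump a mid v)) by lra.
      apply Rmult_le_reg_l in Heb; auto.
      apply Hc.
      - apply Hbin. lra.
      - now apply Hbd.
      - assert (e * (bump a mid y - bump a mid v) <= e * 1) by (apply Rmult_le_compat_l; lra).
        lra. }
    destruct (Rle_lt_dec y m) as [Hy|Hy].
    + apply (Hfin y1 l1); auto.
      * destruct (Hqc y1 y m) as [H|H]; [lra|exact H|].
        apply Rle_trans with (1 := H), Hm.
      * intros Hin Hdist Hlt. rewrite Rabs_right in Hdist by lra.
        specialize (Hgap1 y Hin Hy).
        destruct (Hqc y1 (y - d) y) as [H|H]; lra.
    + apply (Hfin y2 l2); auto.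
      * destruct (Hqc m y y2) as [H|H]; [lra| |exact H].
        apply Rle_trans with (1 := H), Hm.
      * intros Hin Hdist Hlt. rewrite Rabs_left1 in Hdist by lra.
        specialize (Hgap2 y Hin ltac:(lra)).
        destruct (Hqc y (y + d) y2) as [H|H]; lra.
Qed.

(** A flat bottom would persist backwards, while every interval of time ending at T contains
    instants with a single bottom point. The range of levels is the interval where the
    reaction is positive, on which its flow is explicit. *)
Lemma unique_minimizer f0 Theta0 n u (j : nat) T p :
  well_solution f0 Theta0 n u -> (j <= n)%nat -> 0 < T ->
  minimizer (fun x => u x T) p ->
  2 * PI * INR j - 2 * Theta0 < u p T < 2 * PI * INR j ->
  forall x, x <> p -> u p T < u x T.
Proof.
  intros Hu Hj HT Hp Hv x Hx.
  assert (HjN : 2 * PI * INR j <= 2 * PI * INR n).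
  { apply Rmult_le_compat_l; [assert (H := PI_RGT_0); lra|]. now apply le_INR. }
  assert (Hcont := well_cont _ _ _ _ Hu).
  assert (Htwo : forall p q, p < q -> minimizer (fun x => u x T) p ->
     minimizer (fun x => u x T) q ->
     2 * PI * INR j - 2 * Theta0 < u p T < 2 * PI * INR j -> False).
  { clear p Hp Hv x Hx. intros p q Hpq Hp Hq Hv.
    destruct (flat_minimum_persists_backwards f0 Theta0 n u T p q) as [s0 [Hs0 Hpast]]; auto; [lra|].
    destruct (well_above_stable _ _ _ _ T (2 * PI * INR j - 2 * Theta0) Hu)
      as [d [Hd Hab]]; try lra.
    { intros x. specialize (Hp x). cbv beta in Hp. lra. }
    destruct (continuous2_lt u p T (2 * PI * INR j) Hcont) as [e [He Hbe]]; [lra|].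
    set (b := Rmin (Rmin d e) (T - s0) / 2).
    assert (Hmin : 0 < Rmin (Rmin d e) (T - s0)) by (repeat apply Rmin_glb_lt; lra).
    assert (Hm0 := Rmin_l (Rmin d e) (T - s0)). assert (Hm1 := Rmin_r (Rmin d e) (T - s0)).
    assert (Hm2 := Rmin_l d e). assert (Hm3 := Rmin_r d e).
    assert (Habs : Rabs (T - b - T) < Rmin (Rmin d e) (T - s0)).
    { rewrite Rabs_left; unfold b; lra. }
    destruct (well_minimizer _ _ _ _ (T - b) Hu) as [m Hm]; [unfold b; lra|].
    destruct (single_minimizer_instant f0 Theta0 n u j (T - b) T m Hu Hj) as [s [Hs Hone]].
    - unfold b; lra.
    - exact Hm.
    - split.
      + apply Hab; [unfold b|]; lra.
      + apply Rle_lt_trans with (1 := Hm p). apply Hbe; [|lra].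
        rewrite Rminus_diag, Rabs_R0. lra.
    - assert (Hs' : s0 <= s < T) by (unfold b in Hs; lra).
      destruct (well_minimizer _ _ _ _ s Hu ltac:(lra)) as [m' Hm'].
      destruct (Hpast s m' Hs' Hm') as [y [Hy Hle]].
      assert (Hy' : minimizer (fun x => u x s) y).
      { intros v. apply Rle_trans with (1 := Hle), Hm'. }
      destruct (Rtotal_order y m') as [H|[H|H]]; [|contradiction|].
      + exact (Hone y m' H Hy' Hm').
      + exact (Hone m' y H Hm' Hy'). }
  destruct (Hp x) as [H|H]; auto. exfalso. cbv beta in H.
  assert (Hx' : minimizer (fun x => u x T) x).
  { intros y. rewrite <- H. apply Hp. }
  destruct (Rtotal_order x p) as [Hl|[Hl|Hl]]; [|contradiction|].
  - apply (Htwo x p); auto. rewrite <- H. exact Hv.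
  - now apply (Htwo p x).
Qed.

(** * Level pairs and position curves *)

(** The shape of a level set of the well: two points with the sublevel set between
    them. The degenerate case a = b is the collision. *)
Record level_pair (g : R -> R) (c a b : R) : Prop := {
  pair_le : a <= b;
  pair_left : g a = c;
  pair_right : g b = c;
  pair_inside : forall x, a < x < b -> g x < c;
  pair_outside : forall x, x < a \/ b < x -> c < g x
}.

Lemma level_pair_below g c a b x : level_pair g c a b -> g x < c -> a < x < b.
Proof.
  intros H Hx. split; apply Rnot_le_lt; intros [Hl|Hl].
  - assert (Ho := pair_outside _ _ _ _ H x (or_introl Hl)). lra.
  - subst x. assert (He := pair_left _ _ _ _ H). lra.
  - assert (Ho := pair_outside _ _ _ _ H x (or_intror Hl)). lra.
  - subst x. assert (He := pair_right _ _ _ _ H). lra.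
Qed.

Lemma level_pair_root g c a b x : level_pair g c a b -> g x = c -> x = a \/ x = b.
Proof.
  intros H Hx. destruct (Rtotal_order x a) as [Hl|[Hl|Hl]]; auto.
  { assert (Ho := pair_outside _ _ _ _ H x (or_introl Hl)). lra. }
  destruct (Rtotal_order x b) as [Hr|[Hr|Hr]]; auto.
  - assert (Hi := pair_inside _ _ _ _ H x (conj Hl Hr)). lra.
  - assert (Ho := pair_outside _ _ _ _ H x (or_intror Hr)). lra.
Qed.

Lemma level_pair_reflect g c a b :
  level_pair g c a b -> level_pair (fun x => g (- x)) c (- b) (- a).
Proof.
  intros H. split.
  - assert (Hle := pair_le _ _ _ _ H). lra.
  - rewrite Ropp_involutive. apply H.
  - rewrite Ropp_involutive. apply H.
  - intros x Hx. apply H. lra.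
  - intros x Hx. apply H. lra.
Qed.

(** Existence is the intermediate value theorem; that the level is crossed only once on the flank
    is quasiconvexity together with the absence of flat pieces. *)
Lemma left_root f0 Theta0 n u t c y :
  well_solution f0 Theta0 n u -> 0 < t -> c < 2 * PI * INR n -> u y t < c ->
  exists a, a < y /\ u a t = c /\ (forall x, a < x <= y -> u x t < c) /\
    (forall x, x < a -> c < u x t).
Proof.
  intros Hu Ht Hc Hy.
  destruct (well_far_left _ _ _ _ t (2 * PI * INR n - c) Hu) as [r [Hr Hfar]]; [lra|].
  set (x0 := Rmin (- r) (y - 1)).
  assert (Hx0 : x0 <= - r) by apply Rmin_l. assert (Hx0' : x0 <= y - 1) by apply Rmin_r.
  specialize (Hfar x0 t ltac:(lra) Hx0).
  assert (Hcont := well_cont _ _ _ _ Hu).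
  destruct (IVT_gen (fun x => u x t) x0 y c) as [a [Ha Hac]].
  { intros x. apply continuity_pt_filterlim. now apply (continuous2_slice_x u). }
  { rewrite Rmin_right, Rmax_left; lra. }
  rewrite Rmin_left, Rmax_right in Ha by lra.
  assert (Hqc : quasiconvex (fun x => u x t)) by (apply (well_quasiconvex f0 Theta0 n); auto; lra).
  assert (Hay : a < y).
  { destruct Ha as [_ [H|H]]; auto. subst a. lra. }
  exists a. split; [auto|split; [auto|split]].
  - intros x Hx. destruct (Req_dec x y) as [->|Hne]; auto.
    destruct (Hqc a x y) as [H|H]; [lra| |lra].
    destruct H as [H|H]; [lra|]. exfalso.
    apply (no_flat_left_flank f0 Theta0 n u t a x y); auto; lra.
  - intros x Hx.
    assert (c <= u x t) by (destruct (Hqc x a y) as [H|H]; lra).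
    destruct H as [H|H]; auto. exfalso.
    apply (no_flat_left_flank f0 Theta0 n u t x a y); auto; lra.
Qed.

Lemma level_pair_exists f0 Theta0 n u t c y :
  well_solution f0 Theta0 n u -> 0 < t -> c < 2 * PI * INR n -> u y t < c ->
  exists a b, a < b /\ level_pair (fun x => u x t) c a b.
Proof.
  intros Hu Ht Hc Hy.
  destruct (left_root _ _ _ _ t c y Hu Ht Hc Hy) as (a & Hay & Ha & Ha1 & Ha2).
  destruct (left_root _ _ _ _ t c (- y) (well_reflect _ _ _ _ Hu) Ht Hc)
    as (b & Hby & Hb & Hb1 & Hb2).
  { now rewrite Ropp_involutive. }
  exists a, (- b). split; [lra|]. split; auto; [lra| |].
  - intros x Hx. destruct (Rle_lt_dec x y); [apply Ha1; lra|].
    specialize (Hb1 (- x)). rewrite Ropp_involutive in Hb1. apply Hb1. lra.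
  - intros x [Hx|Hx]; [now apply Ha2|].
    specialize (Hb2 (- x)). rewrite Ropp_involutive in Hb2. apply Hb2. lra.
Qed.

Lemma filterlim_within_iff (I : R -> Prop) (xi : R -> R) t :
  filterlim xi (within I (locally t)) (locally (xi t)) <->
  forall e, 0 < e -> exists d, 0 < d /\
    forall s, I s -> Rabs (s - t) < d -> Rabs (xi s - xi t) < e.
Proof.
  split.
  - intros H e He.
    destruct (H (fun y => Rabs (y - xi t) < e)) as [d Hd].
    { exists (mkposreal e He). intros y Hy. exact Hy. }
    exists d. split; [apply cond_pos|]. intros s Hs Hsd. now apply (Hd s).
  - intros H P [e HP]. destruct (H e (cond_pos e)) as [d [Hd Hd']].
    exists (mkposreal d Hd). intros s Hs HI. apply HP. now apply (Hd' s).
Qed.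

(** Odd multiples of PI are isolated, so the level cannot change along a continuous curve of
    positions. *)
Lemma odd_multiples_apart (k l : Z) :
  Rabs (IZR (2 * k + 1) * PI - IZR (2 * l + 1) * PI) < PI -> k = l.
Proof.
  intros H. assert (HPI := PI_RGT_0). apply Rabs_def2 in H.
  rewrite <- Rmult_minus_distr_r, <- minus_IZR in H.
  assert (H1 : IZR (2 * k + 1 - (2 * l + 1)) < 1) by (apply Rmult_lt_reg_r with PI; lra).
  assert (H2 : -1 < IZR (2 * k + 1 - (2 * l + 1))) by (apply Rmult_lt_reg_r with PI; lra).
  apply lt_IZR in H1. apply lt_IZR in H2. lia.
Qed.

Lemma curve_near (u : R -> R -> R) xi0 I xi s e :
  continuous2 u -> position_curve u xi0 I xi -> I s -> 0 < e ->
  exists d, 0 < d /\ forall s', I s' -> Rabs (s' - s) < d ->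
    Rabs (u (xi s') s' - u (xi s) s) < e.
Proof.
  intros Hc Hxi Hs He.
  destruct (continuous2_ball u (xi s) s e Hc He) as [d [Hd H]].
  destruct (proj1 (filterlim_within_iff I xi s) (curve_cont _ _ _ _ Hxi s Hs) d Hd)
    as [d' [Hd' H']].
  exists (Rmin d d'). split; [now apply Rmin_glb_lt|]. intros s' Hs' Hnear.
  assert (Rmin d d' <= d) by apply Rmin_l. assert (Rmin d d' <= d') by apply Rmin_r.
  apply H; [apply H'|]; auto; lra.
Qed.

Lemma curve_level (u : R -> R -> R) xi0 I xi :
  continuous2 u -> position_curve u xi0 I xi ->
  forall t, I t -> u (xi t) t = u xi0 0.
Proof.
  intros Hc Hxi t Ht. assert (HPI := PI_RGT_0).
  assert (Ht0 := curve_dom_ge0 _ _ _ _ Hxi t Ht).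
  assert (HI : forall s, 0 <= s <= t -> I s).
  { intros s Hs. now apply (curve_dom_itv _ _ _ _ Hxi s t). }
  assert (Hlock : forall s s', I s -> I s' ->
     Rabs (u (xi s') s' - u (xi s) s) < PI -> u (xi s') s' = u (xi s) s).
  { intros s s' Hs Hs' Hnear.
    destruct (curve_pos _ _ _ _ Hxi s Hs) as [k Hk].
    destruct (curve_pos _ _ _ _ Hxi s' Hs') as [l Hl].
    rewrite Hk, Hl in *. apply odd_multiples_apart in Hnear. now subst. }
  apply (real_induction 0 t (fun t => u (xi t) t = u xi0 0)); auto.
  - now rewrite (curve_init _ _ _ _ Hxi).
  - intros s Hs Heq.
    destruct (curve_near u xi0 I xi s PI Hc Hxi) as [d [Hd H]]; auto; [apply HI; lra|].
    exists d. split; auto. intros s' Hs' Hle. rewrite <- Heq.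
    apply Hlock; [apply HI; lra|apply HI; lra|]. apply H; [apply HI; lra|].
    rewrite Rabs_right; lra.
  - intros s Hs Hbefore.
    destruct (curve_near u xi0 I xi s PI Hc Hxi) as [d [Hd H]]; auto; [apply HI; lra|].
    set (b := Rmin d s). assert (0 < b) by (apply Rmin_glb_lt; lra).
    assert (b <= d) by apply Rmin_l. assert (b <= s) by apply Rmin_r.
    rewrite <- (Hbefore (s - b / 2)) by lra. symmetry.
    apply Hlock; [apply HI; lra|apply HI; lra|]. apply H; [apply HI; lra|].
    rewrite Rabs_left; lra.
Qed.

(** Positivity of u - c to the left of a root is stable by the tube argument, and so is
    negativity just after it. At tau there is no point with u < c; there the upper bound
    comes from the stable region to the right of the collision point. *)
Lemma left_root_continuous f0 Theta0 n u c tau alpha beta t :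
  well_solution f0 Theta0 n u -> c < 2 * PI * INR n ->
  (forall t, 0 <= t <= tau -> level_pair (fun x => u x t) c (alpha t) (beta t)) ->
  (forall t, 0 <= t < tau -> alpha t < beta t) -> alpha tau = beta tau ->
  0 <= t <= tau ->
  filterlim alpha (within (fun s => 0 <= s <= tau) (locally t)) (locally (alpha t)).
Proof.
  intros Hu Hc Hpair Hlt Heq Ht. apply filterlim_within_iff. intros e He.
  assert (Hpt := Hpair t Ht).
  destruct (well_above_left_stable _ _ _ _ t c (alpha t - e) Hu Hc) as [d1 [Hd1 H1]]; [lra| |].
  { intros x Hx. apply (pair_outside _ _ _ _ Hpt x). lra. }
  assert (Hlow : forall s, 0 <= s <= tau -> Rabs (s - t) < d1 -> alpha t - e < alpha s).
  { intros s Hs Hsd. apply Rnot_le_lt. intros Hle.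
    specialize (H1 s ltac:(lra) Hsd (alpha s) Hle).
    rewrite (pair_left _ _ _ _ (Hpair s Hs)) in H1. lra. }
  assert (Hup : exists d2, 0 < d2 /\ forall s, 0 <= s <= tau -> Rabs (s - t) < d2 ->
    alpha s < alpha t + e).
  { destruct (Req_dec t tau) as [->|Hne].
    - destruct (well_above_right_stable _ _ _ _ tau c (alpha tau + e) Hu Hc) as [d2 [Hd2 H2]]; [lra| |].
      { intros x Hx. apply (pair_outside _ _ _ _ Hpt x). lra. }
      exists d2. split; auto. intros s Hs Hsd. apply Rnot_le_lt. intros Hle.
      specialize (H2 s ltac:(lra) Hsd (alpha s) Hle).
      rewrite (pair_left _ _ _ _ (Hpair s Hs)) in H2. lra.
    - specialize (Hlt t ltac:(lra)).
      set (y := Rmin (beta t) (alpha t + e)).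
      assert (Hy : alpha t < y) by (apply Rmin_glb_lt; lra).
      assert (Hy1 : y <= beta t) by apply Rmin_l. assert (Hy2 : y <= alpha t + e) by apply Rmin_r.
      destruct (continuous2_lt u ((alpha t + y) / 2) t c (well_cont _ _ _ _ Hu)) as [d2 [Hd2 H2]].
      { apply (pair_inside _ _ _ _ Hpt). lra. }
      exists d2. split; auto. intros s Hs Hsd.
      specialize (H2 ((alpha t + y) / 2) s). rewrite Rminus_diag, Rabs_R0 in H2.
      destruct (level_pair_below _ _ _ _ _ (Hpair s Hs) (H2 Hd2 Hsd)). lra. }
  destruct Hup as [d2 [Hd2 H2]].
  exists (Rmin d1 d2). split; [now apply Rmin_glb_lt|]. intros s Hs Hsd.
  assert (Rmin d1 d2 <= d1) by apply Rmin_l. assert (Rmin d1 d2 <= d2) by apply Rmin_r.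
  apply Rabs_def1.
  - specialize (H2 s Hs ltac:(lra)). lra.
  - specialize (Hlow s Hs ltac:(lra)). lra.
Qed.

(** A curve of positions stays on its level, hence on one of the two roots, and cannot jump from the left
    to the right one, since a point with u < c separates them. The left root itself is a curve on
    [0, tau] extending any such curve, so maximality gives the domain. After tau
    the level is no longer taken. *)
Lemma maximal_left_curve f0 Theta0 n u c tau alpha beta I xi :
  well_solution f0 Theta0 n u -> c < 2 * PI * INR n ->
  (exists k, c = IZR (2 * k + 1) * PI) -> 0 < tau ->
  (forall t, 0 <= t <= tau -> level_pair (fun x => u x t) c (alpha t) (beta t)) ->
  (forall t, 0 <= t < tau -> alpha t < beta t) -> alpha tau = beta tau ->
  (forall t, tau < t -> forall x, c < u x t) ->
  maximal_position_curve u (alpha 0) I xi ->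
  (forall t, I t <-> 0 <= t <= tau) /\ (forall t, 0 <= t <= tau -> xi t = alpha t).
Proof.
  intros Hu Hc Hodd Htau Hpair Hlt Heq Hafter [Hxi Hmax].
  assert (Hcont := well_cont _ _ _ _ Hu).
  assert (Hlev : forall t, I t -> u (xi t) t = c).
  { intros t Ht. rewrite (curve_level u (alpha 0) I xi Hcont Hxi t Ht).
    apply (pair_left _ _ _ _ (Hpair 0 ltac:(lra))). }
  assert (HI : forall t, I t -> 0 <= t <= tau).
  { intros t Ht. split; [now apply (curve_dom_ge0 _ _ _ _ Hxi)|].
    apply Rnot_lt_le. intros H. specialize (Hafter t H (xi t)).
    rewrite (Hlev t Ht) in Hafter. lra. }
  assert (Hroot : forall t, I t -> xi t = alpha t \/ xi t = beta t).
  { intros t Ht. apply (level_pair_root (fun x => u x t) c); auto. }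
  (* A point y with u < c at time s separates the two roots at all nearby times. *)
  assert (Hsep : forall s, I s -> s < tau -> exists d y, 0 < d /\
     forall s', I s' -> Rabs (s' - s) < d -> alpha s' < y < beta s' /\
       (xi s < y -> xi s' < y) /\ (y < xi s -> y < xi s')).
  { intros s Hs Hst. assert (Hs0 := HI s Hs). specialize (Hlt s ltac:(lra)).
    set (y := (alpha s + beta s) / 2).
    destruct (continuous2_lt u y s c Hcont) as [d1 [Hd1 H1]].
    { apply (pair_inside _ _ _ _ (Hpair s Hs0)). unfold y; lra. }
    assert (Hgap : 0 < (beta s - alpha s) / 2) by lra.
    destruct (proj1 (filterlim_within_iff I xi s) (curve_cont _ _ _ _ Hxi s Hs) _ Hgap)
      as [d2 [Hd2 H2]].
    exists (Rmin d1 d2), y. split; [now apply Rmin_glb_lt|]. intros s' Hs' Hnear.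
    assert (Rmin d1 d2 <= d1) by apply Rmin_l. assert (Rmin d1 d2 <= d2) by apply Rmin_r.
    split.
    - apply (level_pair_below (fun x => u x s') c); auto. apply H1; [|lra].
      rewrite Rminus_diag, Rabs_R0. exact Hd1.
    - specialize (H2 s' Hs' ltac:(lra)). apply Rabs_def2 in H2.
      unfold y in *. destruct (Hroot s Hs) as [E|E]; rewrite E in *; lra. }
  assert (Hbefore : forall t, I t -> t < tau -> xi t = alpha t).
  { intros t Ht Htt. assert (HIt : forall s, 0 <= s <= t -> I s).
    { intros s Hs. now apply (curve_dom_itv _ _ _ _ Hxi s t). }
    apply (real_induction 0 t (fun t => xi t = alpha t)).
    - now apply HI.
    - apply (curve_init _ _ _ _ Hxi).
    - intros s Hs Hxs.
      destruct (Hsep s) as (d & y & Hd & H); [apply HIt; lra|lra|].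
      exists d. split; auto. intros s' Hs' Hle.
      destruct (H s) as [Hy _]; [apply HIt; lra|rewrite Rminus_diag, Rabs_R0; lra|].
      destruct (H s') as [Hy' [H1 _]]; [apply HIt; lra|rewrite Rabs_right; lra|].
      destruct (Hroot s') as [E|E]; auto; [apply HIt; lra|].
      rewrite E in H1. rewrite Hxs in H1. lra.
    - intros s Hs Hpast.
      destruct (Hsep s) as (d & y & Hd & H); [apply HIt; lra|lra|].
      destruct (H s) as [Hy _]; [apply HIt; lra|rewrite Rminus_diag, Rabs_R0; lra|].
      set (b := Rmin d s). assert (0 < b) by (apply Rmin_glb_lt; lra).
      assert (b <= d) by apply Rmin_l. assert (b <= s) by apply Rmin_r.
      destruct (H (s - b / 2)) as [Hy' [_ Hgt]]; [apply HIt; lra|rewrite Rabs_left; lra|].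
      destruct (Hroot s) as [E|E]; auto; [apply HIt; lra|].
      rewrite E in Hgt. rewrite Hpast in Hgt by lra. lra. }
  assert (Hagree : forall t, I t -> xi t = alpha t).
  { intros t Ht. destruct (HI t Ht) as [_ [H|H]]; [now apply Hbefore|].
    subst t. destruct (Hroot tau Ht) as [E|E]; congruence. }
  assert (Hall : forall t, 0 <= t <= tau -> I t).
  { apply (Hmax (fun t => 0 <= t <= tau) alpha).
    - split; try (intros; lra).
      + intros t Ht. now apply (left_root_continuous f0 Theta0 n u c tau alpha beta).
      + intros t Ht. destruct Hodd as [k Hk]. exists k. rewrite <- Hk.
        apply (pair_left _ _ _ _ (Hpair t Ht)).
    - intros t Ht. split; [now apply HI|]. symmetry. now apply Hagree. }
  split.
  - intros t. split; auto.
  - intros t Ht. auto.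
Qed.

Lemma position_curve_reflect u xi0 I xi :
  position_curve u xi0 I xi ->
  position_curve (fun x t => u (- x) t) (- xi0) I (fun t => - xi t).
Proof.
  intros H. split.
  - apply H.
  - apply H.
  - apply H.
  - now rewrite (curve_init _ _ _ _ H).
  - intros t Ht. refine (proj2 (filterlim_within_iff I (fun t => - xi t) t) _). intros e He.
    destruct (proj1 (filterlim_within_iff I xi t) (curve_cont _ _ _ _ H t Ht) e He) as [d [Hd Hd']].
    exists d. split; auto. intros s Hs Hsd. replace (- xi s - - xi t) with (- (xi s - xi t)) by ring.
    rewrite Rabs_Ropp. now apply Hd'.
  - intros t Ht. destruct (curve_pos _ _ _ _ H t Ht) as [k Hk]. exists k.
    now rewrite Ropp_involutive.
Qed.

Lemma position_curve_ext u v xi0 I xi :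
  (forall x t, 0 <= t -> u x t = v x t) ->
  position_curve u xi0 I xi -> position_curve v xi0 I xi.
Proof.
  intros E H. split; try apply H.
  intros t Ht. destruct (curve_pos _ _ _ _ H t Ht) as [k Hk]. exists k.
  rewrite <- E; auto. now apply (curve_dom_ge0 _ _ _ _ H).
Qed.

Lemma maximal_curve_ext u v xi0 I xi :
  (forall x t, 0 <= t -> u x t = v x t) ->
  maximal_position_curve u xi0 I xi -> maximal_position_curve v xi0 I xi.
Proof.
  intros E [H Hmax]. split; [now apply (position_curve_ext u)|].
  intros I' xi' H'. apply Hmax. apply (position_curve_ext v); auto.
  intros x t Ht. symmetry. auto.
Qed.

Lemma maximal_curve_reflect u xi0 I xi :
  maximal_position_curve u xi0 I xi ->
  maximal_position_curve (fun x t => u (- x) t) (- xi0) I (fun t => - xi t).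
Proof.
  intros [H Hmax]. split; [now apply position_curve_reflect|].
  intros I' xi' H' Hext. apply (Hmax I' (fun t => - xi' t)).
  - apply position_curve_reflect in H'. rewrite Ropp_involutive in H'.
    apply (position_curve_ext (fun x t => u (- - x) t)); auto.
    intros x t _. now rewrite Ropp_involutive.
  - intros t Ht. destruct (Hext t Ht) as [H1 H2]. split; auto. rewrite H2. ring.
Qed.

(** * The kink-antikink initial datum *)

(** The order properties and the value at the centre of the mollified step determine
    where the datum crosses the odd multiples of PI. *)
Record kink_profile (e : R) (h : R -> R) : Prop := {
  kink_left : forall x, x <= - e -> h x = 2 * PI;
  kink_right : forall x, e <= x -> h x = 0;
  kink_decreasing : forall x y, x <= y -> h y <= h x;
  kink_center : h 0 = PI;
  kink_before : forall x, x < 0 -> PI < h x;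
  kink_after : forall x, 0 < x -> h x < PI
}.

Lemma is_RInt_gen_eventually (f : R -> R) (A B l : R) :
  (forall a b, a < A -> B < b -> is_RInt f a b l) ->
  is_RInt_gen f (Rbar_locally m_infty) (Rbar_locally p_infty) l.
Proof.
  intros H P HP. apply (Filter_prod _ _ _ (fun a => a < A) (fun b => B < b)).
  - now exists A.
  - now exists B.
  - intros a b Ha Hb. exists l. split; [now apply H|]. now apply locally_singleton.
Qed.

Lemma mollifier_continuous e r : mollifier e r -> forall x, continuous r x.
Proof.
  intros H x. apply (ex_derive_continuous r). apply (mollifier_smooth _ _ H 1 x).
Qed.

Lemma mollifier_ex_RInt e r a b : mollifier e r -> ex_RInt r a b.
Proof.
  intros H. apply (ex_RInt_continuous r). intros z _. now apply (mollifier_continuous e).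
Qed.

(** At the edges of the support, nonnegativity comes from continuity. *)
Lemma mollifier_nonneg e r x : 0 < e -> mollifier e r -> 0 <= r x.
Proof.
  intros He H. destruct (Rtotal_order (Rabs x) e) as [Hx|[Hx|Hx]].
  - left. now apply (mollifier_pos _ _ H).
  - assert (Hedge : 0 <= r e).
    { apply Rnot_lt_le. intros Hneg.
      destruct (mollifier_continuous e r H e (fun v => v < 0)) as [d Hd].
      { now apply open_lt. }
      assert (Hdp := cond_pos d).
      assert (r (e + d / 2) < 0).
      { apply (Hd (e + d / 2)). change (Rabs (e + d / 2 - e) < d). rewrite Rabs_right; lra. }
      rewrite (mollifier_supp _ _ H) in H0; [lra|]. rewrite Rabs_right; lra. }
    destruct (Rcase_abs x) as [Hn|Hp].
    + rewrite Rabs_left in Hx by lra. rewrite <- (Ropp_involutive x), (mollifier_sym _ _ H), Hx.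
      exact Hedge.
    + rewrite Rabs_right in Hx by lra. now rewrite Hx.
  - right. symmetry. now apply (mollifier_supp _ _ H).
Qed.

Lemma mollifier_RInt_outside e r a b :
  0 < e -> mollifier e r -> a <= b -> (e <= a \/ b <= - e) -> RInt r a b = 0.
Proof.
  intros He H Hab Hout. rewrite (RInt_ext r (fun _ => 0)).
  - rewrite RInt_const. apply Rmult_0_r.
  - intros x Hx. rewrite Rmin_left, Rmax_right in Hx by lra.
    apply (mollifier_supp _ _ H). destruct Hout.
    + rewrite Rabs_right; lra.
    + rewrite Rabs_left; lra.
Qed.

Lemma mollifier_Chasles e r a b c :
  mollifier e r -> RInt r a c = RInt r a b + RInt r b c.
Proof.
  intros H. symmetry. apply (RInt_Chasles r); now apply (mollifier_ex_RInt e).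
Qed.

Lemma mollifier_RInt_sym e r a b :
  mollifier e r -> RInt r (- b) (- a) = RInt r a b.
Proof.
  intros H. apply is_RInt_unique. rewrite <- (opp_opp (RInt r a b)). apply (is_RInt_swap r).
  assert (HI := RInt_correct r a b (mollifier_ex_RInt e r a b H)).
  rewrite <- (Ropp_involutive a), <- (Ropp_involutive b) in HI at 1.
  apply is_RInt_comp_opp, is_RInt_opp in HI.
  apply (is_RInt_ext _ r) in HI; [exact HI|].
  intros x _. rewrite opp_opp. apply (mollifier_sym _ _ H).
Qed.

Lemma mollifier_RInt_total e r : 0 < e -> mollifier e r -> RInt r (- e) e = 1.
Proof.
  intros He H.
  rewrite <- (is_RInt_gen_unique _ _ (mollifier_int _ _ H)). symmetry.
  apply is_RInt_gen_unique, (is_RInt_gen_eventually r (- e) e).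
  intros a b Ha Hb.
  replace (RInt r (- e) e) with (RInt r a b).
  - apply (RInt_correct r). now apply (mollifier_ex_RInt e).
  - rewrite (mollifier_Chasles e r a (- e) b H), (mollifier_Chasles e r (- e) e b H).
    rewrite (mollifier_RInt_outside e r a (- e)), (mollifier_RInt_outside e r e b); auto; lra.
Qed.

Lemma convolution_Hminus e r x :
  0 < e -> mollifier e r -> convolution r Hminus x = 2 * PI * RInt r x e.
Proof.
  intros He H. apply is_RInt_gen_unique.
  apply (is_RInt_gen_eventually _ (Rmin x (- e)) (Rmax x e)). intros a b Ha Hb.
  assert (Rmin x (- e) <= x) by apply Rmin_l. assert (x <= Rmax x e) by apply Rmax_l.
  assert (e <= Rmax x e) by apply Rmax_r.
  replace (2 * PI * RInt r x e) with (plus (scal (x - a) 0) (scal (2 * PI) (RInt r x b))).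
  - apply (is_RInt_Chasles (fun y => r y * Hminus (x - y)) a x b (scal (x - a) 0) (scal (2 * PI) (RInt r x b))).
    + apply (is_RInt_ext (fun _ => 0)); [|apply (is_RInt_const a x 0)].
      intros y Hy. rewrite Rmin_left, Rmax_right in Hy by lra. unfold Hminus.
      destruct (Rlt_dec (x - y) 0); [lra|]. destruct (Req_EM_T (x - y) 0); [lra|]. symmetry. apply Rmult_0_r.
    + apply (is_RInt_ext (fun y => scal (2 * PI) (r y))).
      * intros y Hy. rewrite Rmin_left, Rmax_right in Hy by lra. unfold Hminus.
        destruct (Rlt_dec (x - y) 0); [|lra]. apply Rmult_comm.
      * apply (is_RInt_scal r), (RInt_correct r). now apply (mollifier_ex_RInt e).
  - rewrite (mollifier_Chasles e r x e b H), (mollifier_RInt_outside e r e b) by (auto; lra).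
    unfold plus, scal; simpl; unfold mult; simpl. ring.
Qed.

Lemma convolution_Hplus e r x :
  0 < e -> mollifier e r -> convolution r Hplus x = 2 * PI * RInt r (- x) e.
Proof.
  intros He H. apply is_RInt_gen_unique.
  apply (is_RInt_gen_eventually _ (Rmin x (- e)) (Rmax x e)). intros a b Ha Hb.
  assert (Rmin x (- e) <= x) by apply Rmin_l. assert (x <= Rmax x e) by apply Rmax_l.
  assert (Rmin x (- e) <= - e) by apply Rmin_r.
  replace (2 * PI * RInt r (- x) e) with (plus (scal (2 * PI) (RInt r a x)) (scal (b - x) 0)).
  - apply (is_RInt_Chasles (fun y => r y * Hplus (x - y)) a x b (scal (2 * PI) (RInt r a x)) (scal (b - x) 0)).
    + apply (is_RInt_ext (fun y => scal (2 * PI) (r y))).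
      * intros y Hy. rewrite Rmin_left, Rmax_right in Hy by lra. unfold Hplus, Hminus.
        destruct (Rlt_dec (- (x - y)) 0); [|lra]. apply Rmult_comm.
      * apply (is_RInt_scal r), (RInt_correct r). now apply (mollifier_ex_RInt e).
    + apply (is_RInt_ext (fun _ => 0)); [|apply (is_RInt_const x b 0)].
      intros y Hy. rewrite Rmin_left, Rmax_right in Hy by lra. unfold Hplus, Hminus.
      destruct (Rlt_dec (- (x - y)) 0); [lra|]. destruct (Req_EM_T (- (x - y)) 0); [lra|]. symmetry. apply Rmult_0_r.
  - rewrite (mollifier_Chasles e r a (- e) x H), (mollifier_RInt_outside e r a (- e)) by (auto; lra).
    rewrite <- (mollifier_RInt_sym e r (- e) x H), Ropp_involutive.
    unfold plus, scal; simpl; unfold mult; simpl. ring.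
Qed.

(** The mollified step is 2 PI times the mass of the mollifier to the right of x; half of the
    mass lies on each side of 0 by symmetry. *)
Lemma mollified_kink e r :
  0 < e -> mollifier e r -> kink_profile e (fun x => 2 * PI * RInt r x e).
Proof.
  intros He H. assert (HPI := PI_RGT_0).
  assert (Hmono : forall x y, x <= y -> RInt r y e <= RInt r x e).
  { intros x y Hxy. rewrite (mollifier_Chasles e r x y e H).
    assert (0 <= RInt r x y); [|lra].
    apply RInt_ge_0; auto; [now apply (mollifier_ex_RInt e)|].
    intros z _. now apply (mollifier_nonneg e). }
  assert (Hstrict : forall x y, - e <= x -> x < y -> y <= e -> RInt r y e < RInt r x e).
  { intros x y Hx Hxy Hy. rewrite (mollifier_Chasles e r x y e H).
    assert (0 < RInt r x y); [|lra].
    apply RInt_gt_0; auto.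
    - intros z Hz. apply (mollifier_pos _ _ H). apply Rabs_def1; lra.
    - intros z _. now apply (mollifier_continuous e). }
  assert (Hhalf : RInt r 0 e = / 2).
  { assert (Ht := mollifier_RInt_total e r He H).
    rewrite (mollifier_Chasles e r (- e) 0 e H) in Ht.
    assert (Hs := mollifier_RInt_sym e r 0 e H). rewrite Ropp_0 in Hs. lra. }
  split.
  - intros x Hx. rewrite (mollifier_Chasles e r x (- e) e H), (mollifier_RInt_outside e r x (- e)) by (auto; lra).
    rewrite mollifier_RInt_total; auto. ring.
  - intros x Hx. rewrite <- (opp_RInt_swap r e x) by now apply (mollifier_ex_RInt e).
    rewrite (mollifier_RInt_outside e r e x) by (auto; lra).
    unfold opp; simpl. ring.
  - intros x y Hxy. apply Rmult_le_compat_l; [lra|]. now apply Hmono.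
  - rewrite Hhalf. field.
  - intros x Hx. replace PI with (2 * PI * RInt r 0 e) at 1 by (rewrite Hhalf; field).
    apply Rmult_lt_compat_l; [lra|].
    apply Rlt_le_trans with (RInt r (Rmax x (- e)) e).
    + apply Hstrict; [apply Rmax_r|apply Rmax_lub_lt; lra|lra].
    + apply Hmono, Rmax_l.
  - intros x Hx. replace PI with (2 * PI * RInt r 0 e) at 2 by (rewrite Hhalf; field).
    apply Rmult_lt_compat_l; [lra|].
    apply Rle_lt_trans with (RInt r (Rmin x e) e).
    + apply Hmono, Rmin_l.
    + apply Hstrict; [lra|apply Rmin_glb_lt; lra|apply Rmin_r].
Qed.

Lemma sum_le (a b : nat -> R) n :
  (forall k, (1 <= k <= n)%nat -> a k <= b k) -> sum_n_m a 1 n <= sum_n_m b 1 n.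
Proof.
  induction n as [|n IH]; intros H.
  - rewrite !sum_n_m_zero by lia. lra.
  - rewrite !sum_n_Sm by lia. apply Rplus_le_compat.
    + apply IH. intros k Hk. apply H. lia.
    + apply H. lia.
Qed.

Lemma sum_lt (a b : nat -> R) n j :
  (1 <= j <= n)%nat -> (forall k, (1 <= k <= n)%nat -> a k <= b k) -> a j < b j ->
  sum_n_m a 1 n < sum_n_m b 1 n.
Proof.
  induction n as [|n IH]; intros Hj H Hlt; [lia|].
  rewrite !sum_n_Sm by lia. unfold plus; simpl.
  destruct (Nat.eq_dec j (S n)) as [->|Hne].
  - apply Rplus_le_lt_compat; auto. apply sum_le. intros k Hk. apply H. lia.
  - apply Rplus_lt_le_compat; [apply IH; auto; try lia; intros k Hk; apply H; lia|].
    apply H. lia.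
Qed.

Lemma sum_const (c : R) n : sum_n_m (fun _ => c) 1 n = c * INR n.
Proof.
  rewrite sum_n_m_const. replace (S n - 1)%nat with n by lia. apply Rmult_comm.
Qed.

(** At the position j the kinks further in contribute 2 PI, the kink j
    contributes PI, and those further out contribute nothing. *)
Lemma sum_step (a : nat -> R) n j :
  (1 <= j <= n)%nat -> (forall k, (1 <= k < j)%nat -> a k = 2 * PI) -> a j = PI ->
  (forall k, (j < k <= n)%nat -> a k = 0) ->
  sum_n_m a 1 n = (2 * INR j - 1) * PI.
Proof.
  intros Hj Hlow Hmid Hhigh.
  assert (Hbase : sum_n_m a 1 j = (2 * INR j - 1) * PI).
  { destruct j as [|j]; [lia|]. rewrite sum_n_Sm by lia. rewrite Hmid.
    rewrite (sum_n_m_ext_loc a (fun _ => 2 * PI)).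
    - rewrite sum_const, S_INR. unfold plus; simpl. ring.
    - intros k Hk. apply Hlow. lia. }
  rewrite <- Hbase. destruct (Nat.eq_dec j n) as [->|Hne]; auto.
  rewrite (sum_n_m_Chasles a 1 j n) by lia.
  rewrite (sum_n_m_ext_loc a (fun _ => 0) (S j) n).
  - rewrite sum_n_m_const, Rmult_0_r. apply Rplus_0_r.
  - intros k Hk. apply Hhigh. lia.
Qed.

(** The left half of the datum, a descending staircase whose steps have midpoints xi j; the right half is
    the reflection of another one. On either side of xc one of the two halves vanishes. *)
Record staircase (n : nat) (xi : nat -> R) (xc : R) (S : R -> R) : Prop := {
  stair_range : forall x, 0 <= S x <= 2 * PI * INR n;
  stair_decreasing : forall x y, x <= y -> S y <= S x;
  stair_zero : forall x, xc <= x -> S x = 0;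
  stair_top : exists L, forall x, x <= - L -> S x = 2 * PI * INR n;
  stair_level : forall j, (1 <= j <= n)%nat -> S (xi j) = (2 * INR j - 1) * PI;
  stair_before : forall j x, (1 <= j <= n)%nat -> x < xi j -> (2 * INR j - 1) * PI < S x;
  stair_after : forall j x, (1 <= j <= n)%nat -> xi j < x -> S x < (2 * INR j - 1) * PI
}.

(** The widths keep the transition layers disjoint: at any of the positions, all
    other kinks have already reached one of their two end values. *)
Lemma kink_sum_staircase n xi eps xc (h : nat -> R -> R) :
  (forall j, (1 <= j <= n)%nat -> 0 < eps j) ->
  (forall j, (1 <= j <= n)%nat -> kink_profile (eps j) (h j)) ->
  (forall j, (1 <= j < n)%nat -> xi (S j) < xi j) ->
  (forall j, (1 <= j < n)%nat ->
     eps j < (xi j - xi (S j)) / 2 /\ eps (S j) < (xi j - xi (S j)) / 2) ->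
  ((1 <= n)%nat -> xi 1%nat + eps 1%nat <= xc) ->
  staircase n xi xc (fun x => sum_n_m (fun j => h j (x - xi j)) 1 n).
Proof.
  intros Heps Hh Hxi Hgap Hxc. assert (HPI := PI_RGT_0).
  assert (Hanti : forall i j, (1 <= i)%nat -> (i <= j)%nat -> (j <= n)%nat -> xi j <= xi i).
  { intros i j Hi Hij. induction Hij as [|j Hij IH]; intros Hj; [lra|].
    specialize (IH ltac:(lia)). specialize (Hxi j ltac:(lia)). lra. }
  assert (Hbelow : forall i j, (1 <= i)%nat -> (i < j)%nat -> (j <= n)%nat ->
     xi j <= xi i - eps i /\ xi j + eps j <= xi i).
  { intros i j Hi Hij Hj. split.
    - assert (H1 := Hanti (S i) j ltac:(lia) ltac:(lia) Hj).
      assert (H2 := Heps i ltac:(lia)). destruct (Hgap i ltac:(lia)) as [H3 _]. lra.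
    - destruct j as [|j]; [lia|].
      assert (H1 := Hanti i j ltac:(lia) ltac:(lia) ltac:(lia)).
      assert (H2 := Heps (S j) ltac:(lia)). destruct (Hgap j ltac:(lia)) as [_ H3]. lra. }
  assert (Hhr : forall j x, (1 <= j <= n)%nat -> 0 <= h j x <= 2 * PI).
  { intros j x Hj. specialize (Hh j Hj). specialize (Heps j Hj). split.
    - destruct (Rle_lt_dec x (eps j)) as [Hx|Hx].
      + rewrite <- (kink_right _ _ Hh (eps j)) by lra. now apply (kink_decreasing _ _ Hh).
      + right. symmetry. apply (kink_right _ _ Hh). lra.
    - destruct (Rle_lt_dec x (- eps j)) as [Hx|Hx].
      + right. now apply (kink_left _ _ Hh).
      + rewrite <- (kink_left _ _ Hh (- eps j)) by lra. apply (kink_decreasing _ _ Hh). lra. }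
  assert (Hlevel : forall j, (1 <= j <= n)%nat ->
     sum_n_m (fun k => h k (xi j - xi k)) 1 n = (2 * INR j - 1) * PI).
  { intros j Hj. apply sum_step; auto.
    - intros k Hk. apply (kink_left _ _ (Hh k ltac:(lia))).
      destruct (Hbelow k j ltac:(lia) ltac:(lia) ltac:(lia)). lra.
    - rewrite Rminus_diag. apply (kink_center _ _ (Hh j Hj)).
    - intros k Hk. apply (kink_right _ _ (Hh k ltac:(lia))).
      destruct (Hbelow j k ltac:(lia) ltac:(lia) ltac:(lia)). lra. }
  split.
  - intros x. split.
    + replace 0 with (0 * INR n) by ring. rewrite <- sum_const. apply sum_le.
      intros k Hk. now apply Hhr.
    + rewrite <- sum_const. apply sum_le. intros k Hk. now apply Hhr.
  - intros x y Hxy. apply sum_le. intros k Hk. apply (kink_decreasing _ _ (Hh k Hk)). lra.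
  - intros x Hx. rewrite (sum_n_m_ext_loc _ (fun _ => 0)).
    + rewrite sum_const. ring.
    + intros k Hk. apply (kink_right _ _ (Hh k Hk)). specialize (Hxc ltac:(lia)).
      assert (H1 := Heps 1%nat ltac:(lia)).
      destruct (Nat.eq_dec k 1) as [->|Hne]; [lra|].
      destruct (Hbelow 1%nat k ltac:(lia) ltac:(lia) ltac:(lia)). lra.
  - assert (HL : exists L, forall j, (1 <= j <= n)%nat -> - L <= xi j - eps j).
    { clear - xi. induction n as [|n [L HL]].
      - exists 0. intros j Hj. lia.
      - exists (Rmax L (- (xi (S n) - eps (S n)))). intros j Hj.
        assert (H1 := Rmax_l L (- (xi (S n) - eps (S n)))).
        assert (H2 := Rmax_r L (- (xi (S n) - eps (S n)))).
        destruct (Nat.eq_dec j (S n)) as [->|Hne]; [lra|].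
        specialize (HL j ltac:(lia)). lra. }
    destruct HL as [L HL]. exists L. intros x Hx.
    rewrite (sum_n_m_ext_loc _ (fun _ => 2 * PI)).
    + now rewrite sum_const.
    + intros k Hk. apply (kink_left _ _ (Hh k Hk)). specialize (HL k Hk). lra.
  - exact Hlevel.
  - intros j x Hj Hx. rewrite <- (Hlevel j Hj). apply (sum_lt _ _ n j Hj).
    + intros k Hk. apply (kink_decreasing _ _ (Hh k Hk)). lra.
    + rewrite Rminus_diag, (kink_center _ _ (Hh j Hj)). apply (kink_before _ _ (Hh j Hj)). lra.
  - intros j x Hj Hx. rewrite <- (Hlevel j Hj). apply (sum_lt _ _ n j Hj).
    + intros k Hk. apply (kink_decreasing _ _ (Hh k Hk)). lra.
    + rewrite Rminus_diag, (kink_center _ _ (Hh j Hj)). apply (kink_after _ _ (Hh j Hj)). lra.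
Qed.

Lemma initial_datum_staircases rho n xim xip epsm epsp :
  (forall eps, 0 < eps -> mollifier eps (rho eps)) -> (1 <= n)%nat ->
  ordered_positions n n xim xip -> admissible_widths n n xim xip epsm epsp ->
  exists xc A B, staircase n xim xc A /\ staircase n (fun j => - xip j) (- xc) B /\
    forall x, initial_datum rho n n xim xip epsm epsp x = A x + B (- x).
Proof.
  intros Hrho Hn (Ho1 & Ho2 & Ho3) (Hw1 & Hw2 & Hw3 & Hw4 & Hw5).
  specialize (Ho3 Hn Hn). destruct (Hw5 Hn Hn) as [Hw6 Hw7].
  exists ((xim 1%nat + xip 1%nat) / 2).
  exists (fun x => sum_n_m (fun j =>
    (fun y => 2 * PI * RInt (rho (epsm j)) y (epsm j)) (x - xim j)) 1 n).
  exists (fun x => sum_n_m (fun j =>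
    (fun y => 2 * PI * RInt (rho (epsp j)) y (epsp j)) (x - - xip j)) 1 n).
  split; [|split].
  - apply (kink_sum_staircase n xim epsm _
      (fun j y => 2 * PI * RInt (rho (epsm j)) y (epsm j))); auto.
    + intros j Hj. apply mollified_kink; auto.
    + intros _. lra.
  - apply (kink_sum_staircase n (fun j => - xip j) epsp _
      (fun j y => 2 * PI * RInt (rho (epsp j)) y (epsp j))); auto.
    + intros j Hj. apply mollified_kink; auto.
    + intros j Hj. specialize (Ho2 j Hj). lra.
    + intros j Hj. destruct (Hw4 j Hj). lra.
    + intros _. lra.
  - intros x. unfold initial_datum. f_equal; apply sum_n_m_ext_loc; intros k Hk.
    + apply convolution_Hminus; auto.
    + rewrite (convolution_Hplus (epsp k)) by auto. do 2 f_equal. ring.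
Qed.

(** * Collisions and annihilations *)

Lemma staircase_position_lt n xi xc A j :
  staircase n xi xc A -> (1 <= j <= n)%nat -> xi j < xc.
Proof.
  intros H Hj. apply Rnot_le_lt. intros Hle.
  assert (H1 := stair_level _ _ _ _ H j Hj). rewrite (stair_zero _ _ _ _ H) in H1 by exact Hle.
  assert (1 <= INR j) by (apply (le_INR 1 j); lia).
  assert (0 < (2 * INR j - 1) * PI) by (apply Rmult_lt_0_compat; [lra|apply PI_RGT_0]). lra.
Qed.

Lemma staircases_level_pair n xim xip xc A B j :
  staircase n xim xc A -> staircase n (fun j => - xip j) (- xc) B -> (1 <= j <= n)%nat ->
  xim j < xip j /\
  level_pair (fun x => A x + B (- x)) ((2 * INR j - 1) * PI) (xim j) (xip j).
Proof.
  intros HA HB Hj.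
  assert (Hm := staircase_position_lt _ _ _ _ j HA Hj).
  assert (Hp := staircase_position_lt _ _ _ _ j HB Hj). cbv beta in Hp.
  assert (ZA : forall x, xc <= x -> A x = 0) by apply HA.
  assert (ZB : forall x, x <= xc -> B (- x) = 0) by (intros x Hx; apply HB; lra).
  split; [lra|]. split; [lra| | | |].
  - rewrite (stair_level _ _ _ _ HA j Hj), ZB by lra. ring.
  - rewrite (stair_level _ _ _ _ HB j Hj), ZA by lra. ring.
  - intros x Hx. destruct (Rle_lt_dec x xc) as [Hc|Hc].
    + rewrite ZB by lra. assert (H := stair_after _ _ _ _ HA j x Hj ltac:(lra)). lra.
    + rewrite ZA by lra. assert (H := stair_after _ _ _ _ HB j (- x) Hj ltac:(lra)). lra.
  - intros x [Hx|Hx].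
    + rewrite ZB by lra. assert (H := stair_before _ _ _ _ HA j x Hj Hx). lra.
    + rewrite ZA by lra. assert (H := stair_before _ _ _ _ HB j (- x) Hj ltac:(lra)). lra.
Qed.

(** Freezing the solution for negative times; the sum of the two staircases is
    quasiconvex because at every point one of them vanishes. *)
Lemma classical_well_solution f0 Theta0 n xim xip xc A B u0 u :
  admissible f0 Theta0 ->
  staircase n xim xc A -> staircase n xip (- xc) B ->
  (forall x, u0 x = A x + B (- x)) ->
  classical_solution (reaction f0 Theta0) u0 u ->
  well_solution f0 Theta0 n (fun x t => u x (Rmax 0 t)).
Proof.
  intros Had HA HB Hu0 Hu.
  assert (ZA : forall x, xc <= x -> A x = 0) by apply HA.
  assert (ZB : forall x, x <= xc -> B (- x) = 0) by (intros x Hx; apply HB; lra).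
  assert (Hinit : forall x, u x (Rmax 0 0) = A x + B (- x)).
  { intros x. rewrite Rmax_left by lra. rewrite (sol_init _ _ _ Hu). apply Hu0. }
  split.
  - exact Had.
  - intros x t P HP.
    destruct (sol_cont _ _ _ Hu x (Rmax 0 t) (Rmax_l 0 t) P HP) as [d Hd].
    exists d. intros [y s] [Hy Hs]. apply (Hd (y, Rmax 0 s)).
    + split; [exact Hy|]. change (Rabs (Rmax 0 s - Rmax 0 t) < d).
      change (Rabs (s - t) < d) in Hs. apply Rle_lt_trans with (2 := Hs).
      unfold Rmax. destruct (Rle_dec 0 s), (Rle_dec 0 t);
        unfold Rabs; repeat destruct Rcase_abs; lra.
    + apply Rmax_l.
  - intros x t Ht. rewrite (Rmax_right 0 t) by lra.
    exists (Derive (fun s => u x s) t), (fun y => Derive (fun y => u y t) y),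
      (Derive_n (fun y => u y t) 2 x).
    refine (conj _ (conj _ (conj _ _))).
    + apply (is_derive_ext_loc (fun s => u x s)).
      * exists (mkposreal t Ht). intros s Hs. change (Rabs (s - t) < t) in Hs.
        apply Rabs_def2 in Hs. rewrite Rmax_right; lra.
      * apply Derive_correct, (sol_ex_t _ _ _ Hu x t Ht).
    + intros y. apply (is_derive_ext (fun y => u y t)).
      * intros w. rewrite Rmax_right; lra.
      * apply Derive_correct, (sol_ex_x _ _ _ Hu y t Ht).
    + apply (Derive_correct (fun y => Derive (fun y => u y t) y)).
      apply (sol_ex_xx _ _ _ Hu x t Ht).
    + rewrite (sol_eq _ _ _ Hu x t Ht). ring.
  - intros T. destruct (sol_bounded _ _ _ Hu T) as [M HM]. exists M.
    intros x t Ht. apply HM. rewrite Rmax_right; lra.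
  - intros x. rewrite Hinit. assert (H1 := stair_range _ _ _ _ HA x).
    assert (H2 := stair_range _ _ _ _ HB (- x)).
    destruct (Rle_lt_dec x xc); [rewrite ZB|rewrite ZA]; lra.
  - destruct (stair_top _ _ _ _ HA) as [L1 HL1]. destruct (stair_top _ _ _ _ HB) as [L2 HL2].
    set (M := Rmax (Rmax L1 L2) (Rabs xc)). exists M. intros x Hx. rewrite Hinit.
    assert (M1 : L1 <= M) by (apply Rle_trans with (2 := Rmax_l (Rmax L1 L2) (Rabs xc)), Rmax_l).
    assert (M2 : L2 <= M) by (apply Rle_trans with (2 := Rmax_l (Rmax L1 L2) (Rabs xc)), Rmax_r).
    assert (M3 : Rabs xc <= M) by apply Rmax_r.
    assert (C1 := Rle_abs xc). assert (C2 := Rle_abs (- xc)). rewrite Rabs_Ropp in C2.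
    destruct (Rcase_abs x) as [Hn|Hp].
    + rewrite Rabs_left in Hx by lra. rewrite HL1, ZB by lra. ring.
    + rewrite Rabs_right in Hx by lra. rewrite HL2, ZA by lra. ring.
  - intros a x b Hx. rewrite !Hinit. destruct (Rle_lt_dec x xc) as [Hc|Hc].
    + left. rewrite !ZB by lra.
      assert (H := stair_decreasing _ _ _ _ HA a x ltac:(lra)). lra.
    + right. rewrite !ZA by lra.
      assert (H := stair_decreasing _ _ _ _ HB (- b) (- x) ltac:(lra)). lra.
  - exists xc. rewrite Hinit, ZA, ZB by lra. ring.
Qed.

Lemma crossing_time_lt u c c' tau tau' :
  crossing_time u c tau -> crossing_time u c' tau' -> c < c' -> tau < tau'.
Proof.
  intros (_ & _ & _ & [x Hx] & _) (_ & _ & Hge & _ & Hgt) Hc.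
  apply Rnot_le_lt. intros [H|H].
  - specialize (Hgt tau H x). lra.
  - subst tau'. specialize (Hge x). lra.
Qed.

Lemma crossing_time_minimum u c tau s :
  crossing_time u c tau -> 0 <= s -> is_minimum (fun x => u x s) c <-> s = tau.
Proof.
  intros (_ & Hbefore & Hge & Hat & Hafter) Hs. split.
  - intros [[x Hx] Hmin]. destruct (Rtotal_order s tau) as [H|[H|H]]; auto.
    + destruct (Hbefore s (conj Hs H)) as [y Hy]. specialize (Hmin y). lra.
    + specialize (Hafter s H x). lra.
  - intros ->. now split.
Qed.

Lemma reaction_odd_level f0 Theta0 (j : nat) :
  admissible f0 Theta0 -> 0 <= reaction f0 Theta0 ((2 * INR j - 1) * PI).
Proof.
  intros Had. replace ((2 * INR j - 1) * PI) with (2 * PI * INR j + - PI) by ring.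
  rewrite reaction_period, (reaction_expand _ _ _ Had), cos_neg, sin_neg, cos_PI, sin_PI.
  assert (H : 0 < f0 < 1) by apply Had. lra.
Qed.

Lemma admissible_angle f0 Theta0 : admissible f0 Theta0 -> PI / 2 < Theta0.
Proof.
  intros (Hf & HT & Hc). apply Rnot_le_lt. intros H.
  assert (0 <= cos Theta0) by (apply cos_ge_0; lra). lra.
Qed.

(** At time 0 the pair is read off the datum, between 0 and tau it comes from the flanks,
    and at tau the uniqueness of the bottom point makes the two roots coincide. *)
Lemma pairs_until_crossing f0 Theta0 n u (j : nat) tau a0 b0 :
  well_solution f0 Theta0 n u -> (1 <= j <= n)%nat ->
  crossing_time u ((2 * INR j - 1) * PI) tau ->
  a0 < b0 -> level_pair (fun x => u x 0) ((2 * INR j - 1) * PI) a0 b0 ->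
  exists alpha beta : R -> R, alpha 0 = a0 /\ beta 0 = b0 /\
    (forall t, 0 <= t <= tau ->
       level_pair (fun x => u x t) ((2 * INR j - 1) * PI) (alpha t) (beta t)) /\
    (forall t, 0 <= t < tau -> alpha t < beta t) /\ alpha tau = beta tau.
Proof.
  intros Hu Hj (Htau & Hbefore & Hge & [p Hp] & _) Hab0 Hpair0.
  assert (HPI := PI_RGT_0). assert (Had := well_admissible _ _ _ _ Hu).
  assert (Hangle := admissible_angle _ _ Had).
  set (c := (2 * INR j - 1) * PI) in *.
  assert (HcN : c < 2 * PI * INR n).
  { assert (INR j <= INR n) by (apply le_INR; lia).
    assert (2 * PI * INR j <= 2 * PI * INR n) by (apply Rmult_le_compat_l; lra).
    unfold c. lra. }
  (* Outside [0, tau] the choice of the pair is arbitrary. *)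
  assert (Hex : forall t, exists ab : R * R,
    (t = 0 -> ab = (a0, b0)) /\
    (0 <= t <= tau -> level_pair (fun x => u x t) c (fst ab) (snd ab)) /\
    (0 <= t < tau -> fst ab < snd ab) /\ (t = tau -> fst ab = snd ab)).
  { intros t. destruct (Req_dec t 0) as [->|H0].
    { exists (a0, b0). simpl. split; [auto|split; [auto|split; [auto|lra]]]. }
    destruct (Req_dec t tau) as [->|H1].
    { exists (p, p). simpl. split; [lra|split; [|split; [lra|auto]]]. intros _.
      split; auto; [lra|intros; lra|].
      intros x Hx. rewrite <- Hp.
      apply (unique_minimizer f0 Theta0 n u j tau p); auto; try lia.
      - intros y. rewrite Hp. apply Hge.
      - rewrite Hp. unfold c. lra.
      - lra. }
    destruct (Rlt_dec 0 t) as [H2|H2].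
    2: { exists (0, 0). simpl. split; [lra|split; [lra|split; lra]]. }
    destruct (Rlt_dec t tau) as [H3|H3].
    2: { exists (0, 0). simpl. split; [lra|split; [lra|split; lra]]. }
    destruct (Hbefore t ltac:(lra)) as [y Hy].
    destruct (level_pair_exists f0 Theta0 n u t c y) as (a & b & Hab & Hpair); auto.
    exists (a, b). simpl. split; [lra|split; [auto|split; [auto|lra]]]. }
  set (ab := fun t => proj1_sig (constructive_indefinite_description _ (Hex t))).
  assert (Hab : forall t, (t = 0 -> ab t = (a0, b0)) /\
    (0 <= t <= tau -> level_pair (fun x => u x t) c (fst (ab t)) (snd (ab t))) /\
    (0 <= t < tau -> fst (ab t) < snd (ab t)) /\ (t = tau -> fst (ab t) = snd (ab t))).
  { intros t. unfold ab. apply proj2_sig. }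
  exists (fun t => fst (ab t)), (fun t => snd (ab t)).
  destruct (Hab 0) as [H0 _]. rewrite H0 by reflexivity.
  split; [reflexivity|split; [reflexivity|split; [|split]]].
  - intros t Ht. now apply Hab.
  - intros t Ht. now apply Hab.
  - now apply Hab.
Qed.

Theorem proposition22 :
  forall (f0 Theta0 : R)
    (Hf0 : 0 < f0 < 1)
    (HTheta0 : 0 < Theta0 < PI)
    (Hf00 : reaction f0 Theta0 0 = 0)
    (rho : R -> R -> R)
    (Hrho : forall eps, 0 < eps -> mollifier eps (rho eps))
    (n : nat) (Hn : (1 <= n)%nat)
    (xim xip epsm epsp : nat -> R)
    (Hxi : ordered_positions n n xim xip)
    (Heps : admissible_widths n n xim xip epsm epsp)
    (u : R -> R -> R)
    (Hu : classical_solution (reaction f0 Theta0)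
            (initial_datum rho n n xim xip epsm epsp) u)
    (Im Ip : nat -> R -> Prop) (Xim Xip : nat -> R -> R)
    (HXim : forall j, (1 <= j <= n)%nat ->
       maximal_position_curve u (xim j) (Im j) (Xim j))
    (HXip : forall j, (1 <= j <= n)%nat ->
       maximal_position_curve u (xip j) (Ip j) (Xip j)),
  exists t : nat -> R,
    0 < t 1%nat /\
    (forall j, (1 <= j < n)%nat -> t j < t (S j)) /\
    (forall j, (1 <= j <= n)%nat ->
       unique (meet_at (Im j) (Xim j) (Ip j) (Xip j)) (t j)) /\
    (forall j, (1 <= j <= n - 1)%nat ->
       exists! s : R,
         t j < s < t (S j) /\
         is_minimum (fun x => u x s) (2 * PI * INR j)).
Proof.
  intros. assert (HPI := PI_RGT_0).
  assert (Had : admissible f0 Theta0).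
  { split; [auto|split; [auto|]]. unfold reaction in Hf00. rewrite Rplus_0_l in Hf00. lra. }
  destruct (initial_datum_staircases rho n xim xip epsm epsp Hrho Hn Hxi Heps)
    as (xc & A & B & HA & HB & Hsum).
  assert (Hv := classical_well_solution _ _ _ _ _ _ _ _ _ _ Had HA HB Hsum Hu).
  set (v := fun x t => u x (Rmax 0 t)) in *.
  assert (Huv : forall x t, 0 <= t -> u x t = v x t).
  { intros x t Ht. unfold v. now rewrite Rmax_right. }
  assert (Hcross : forall c, 0 < c < 2 * PI * INR n -> 0 <= reaction f0 Theta0 c ->
     exists tau, crossing_time v c tau).
  { intros c Hc Hf. now apply (crossing_time_exists f0 Theta0 n). }
  assert (HINR : forall i j, (i <= j)%nat -> 2 * PI * INR i <= 2 * PI * INR j).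
  { intros i j Hij. apply Rmult_le_compat_l; [lra|]. now apply le_INR. }
  assert (Hpos : forall j, (1 <= j)%nat -> 2 * PI <= 2 * PI * INR j).
  { intros j Hj. specialize (HINR 1%nat j Hj). simpl in HINR. lra. }
  (* Collisions happen at the levels (2 j - 1) PI, annihilations at 2 PI j. *)
  assert (Ht : forall j, exists tau, (1 <= j <= n)%nat -> crossing_time v ((2 * INR j - 1) * PI) tau).
  { intros j. destruct (le_dec 1 j) as [H1|H1]; [|exists 0; lia].
    destruct (le_dec j n) as [H2|H2]; [|exists 0; lia].
    destruct (Hcross ((2 * INR j - 1) * PI)) as [tau Htau].
    - specialize (HINR j n H2). specialize (Hpos j H1). lra.
    - now apply reaction_odd_level.
    - now exists tau. }
  set (t := fun j => proj1_sig (constructive_indefinite_description _ (Ht j))).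
  assert (Hcoll : forall j, (1 <= j <= n)%nat -> crossing_time v ((2 * INR j - 1) * PI) (t j)).
  { intros j. unfold t. apply proj2_sig. }
  clearbody t. clear Ht. exists t. split; [|split; [|split]].
  - apply (Hcoll 1%nat). lia.
  - intros j Hj. apply (crossing_time_lt v ((2 * INR j - 1) * PI) ((2 * INR (S j) - 1) * PI)).
    + apply Hcoll. lia.
    + apply Hcoll. lia.
    + rewrite S_INR. lra.
  - intros j Hj. assert (Htau := Hcoll j Hj).
    set (c := (2 * INR j - 1) * PI) in *.
    destruct (staircases_level_pair n xim xip xc A B j HA HB Hj) as [Hab0 Hpair0].
    assert (Hpair0' : level_pair (fun x => v x 0) c (xim j) (xip j)).
    { assert (E : forall x, v x 0 = A x + B (- x)).
      { intros x. rewrite <- Huv by lra. rewrite (sol_init _ _ _ Hu). apply Hsum. }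
      split; intros; rewrite ?E; apply Hpair0; auto. }
    destruct (pairs_until_crossing f0 Theta0 n v j (t j) (xim j) (xip j) Hv Hj Htau Hab0 Hpair0')
      as (alpha & beta & Ha0 & Hb0 & Hpair & Hlt & Heq).
    destruct Htau as (Htau & _ & _ & _ & Hafter). fold c in Hpair.
    assert (HcN : c < 2 * PI * INR n).
    { specialize (HINR j n ltac:(lia)). unfold c. lra. }
    assert (Hodd : exists k, c = IZR (2 * k + 1) * PI).
    { exists (Z.of_nat j - 1)%Z. unfold c. f_equal.
      replace (2 * (Z.of_nat j - 1) + 1)%Z with (2 * Z.of_nat j - 1)%Z by ring.
      rewrite minus_IZR, mult_IZR, <- INR_IZR_INZ. reflexivity. }
    destruct (maximal_left_curve f0 Theta0 n v c (t j) alpha beta (Im j) (Xim j)) as [HIm HXm]; auto.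
    { rewrite Ha0. apply (maximal_curve_ext u); auto. }
    destruct (maximal_left_curve f0 Theta0 n (fun x s => v (- x) s) c (t j)
       (fun s => - beta s) (fun s => - alpha s) (Ip j) (fun s => - Xip j s)) as [HIp HXp]; auto.
    { now apply well_reflect. }
    { intros s Hs. apply (level_pair_reflect (fun x => v x s)). auto. }
    { intros s Hs. specialize (Hlt s Hs). lra. }
    { lra. }
    { rewrite Hb0. apply (maximal_curve_reflect v). apply (maximal_curve_ext u); auto. }
    split.
    + repeat split; [apply HIm; lra|apply HIp; lra|].
      specialize (HXp (t j) ltac:(lra)). rewrite HXm by lra. lra.
    + intros s (Hs1 & Hs2 & Hs3). apply HIm in Hs1.
      rewrite HXm in Hs3 by exact Hs1. specialize (HXp s Hs1).
      destruct Hs1 as [Hs0 [Hs1|Hs1]]; [|auto].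
      specialize (Hlt s (conj Hs0 Hs1)). lra.
  - intros j Hj.
    destruct (Hcross (2 * PI * INR j)) as [s Hs].
    { specialize (Hpos j ltac:(lia)). specialize (HINR (S j) n ltac:(lia)).
      rewrite S_INR in HINR. lra. }
    { rewrite reaction_rest by exact Had. lra. }
    assert (Htj := Hcoll j ltac:(lia)). assert (HtS := Hcoll (S j) ltac:(lia)).
    assert (Hmin : forall r, 0 <= r -> is_minimum (fun x => u x r) (2 * PI * INR j) <-> r = s).
    { intros r Hr. rewrite <- (crossing_time_minimum v _ s r Hs Hr).
      unfold is_minimum. split; intros [[x Hx] Hm]; split.
      - exists x. now rewrite <- Huv.
      - intros y. rewrite <- Huv; auto.
      - exists x. now rewrite Huv.
      - intros y. rewrite Huv; auto. }
    assert (Htj0 : 0 < t j) by apply Htj.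
    exists s. split; [split; [split|]|].
    + apply (crossing_time_lt v _ _ _ _ Htj Hs). lra.
    + apply (crossing_time_lt v _ _ _ _ Hs HtS). rewrite S_INR. lra.
    + apply Hmin; auto. left. apply Hs.
    + intros r [Hr Hrm]. symmetry. apply Hmin; auto. lra.
Qed.
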